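(* Let $(M,g)$ be a non-flat Kasner spacetime of dimension 4 with exponents $p_1\le p_2\le p_3<1$. There is an open and dense subset $\mathcal{A}$ of the space of initial data at $t=1$ for the source free Maxwell's equations on $(M,g)$, in the $C^\infty$ topology, such that if $F$ is a solution with initial data in $\mathcal{A}$, the following holds. Define the stress-energy tensor $T$ associated with $F$ by $$T_{\alpha\beta}=\frac{1}{4\pi}\left(F_{\alpha\gamma}F_\beta{}^{\gamma}-\frac14 g_{\alpha\beta}F_{\mu\nu}F^{\mu\nu}\right).$$ Then for almost every timelike geodesic $\gamma$ the energy density $T(\dot\gamma,\dot\gamma)$ along $\gamma$ blows up like $t^{-(2p_2+4p_3)}$ as $t\to0$.
   Context: A (vacuum) Kasner spacetime is $M=(0,\infty)\times\mathbb{T}^3$ with $g=-dt\otimes dt+\sum_{i=1}^3t^{2p_i}dx^i\otimes dx^i$, where $p_i$ are constants with $p_1+p_2+p_3=p_1^2+p_2^2+p_3^2=1$, ordered $p_1\le p_2\le p_3$. Non-flat means $p_3<1$ (then $p_1<0<p_2$). The source free Maxwell's equations for $F\in\Omega^2(M)$ are $\mathrm{div}\,F=0$, $dF=0$, where $(\mathrm{div}\,F)_\beta=\nabla^\alpha F_{\alpha\beta}$. Initial data at $t=1$ consist of the smooth real components $(F_{t1},F_{t2},F_{t3},F_{12},F_{13},F_{23})|_{t=1}$ on $\mathbb{T}^3$, subject to the constraints $\sum_i\partial_iF_{ti}|_{t=1}=0$ and $\partial_1F_{23}-\partial_2F_{13}+\partial_3F_{12}=0$ at $t=1$; the space of such data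 carries the $C^\infty$ (subspace) topology. Timelike geodesics are past directed and parametrized by proper time ($g(\dot\gamma,\dot\gamma)=-1$). For a fixed $t_0$, inextendible timelike geodesics are identified with the manifold $P$ of past directed unit timelike vectors with base point in the Cauchy surface $\{t_0\}\times\mathbb{T}^3$. ''Almost every timelike geodesic'' means: all except a set corresponding to a subset of measure zero in $P$. ''Blows up like $t^{-a}$ as $t\to0$'' means that along $\gamma$, $t^{a}\,T(\dot\gamma,\dot\gamma)$ converges to a positive finite limit as $t\to0$ (i.e. the leading order behavior is a positive constant times $t^{-a}$). *)

(* Defs.v *)
From HB Require Import structures.
From mathcomp Require Import all_boot all_order all_algebra.
From mathcomp Require Import all_classical all_reals all_analysis.

Set Implicit Arguments.
Unset Strict Implicit.
Unset Printing Implicit Defensive.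

Import Order.TTheory GRing.Theory Num.Theory.
Import numFieldNormedType.Exports.

Local Open Scope classical_set_scope.
Local Open Scope ring_scope.

(* Everything is written on the universal cover: T^3 = R^3 / Z^3, functions on
   T^3 are 1-periodic functions of 'rV_3, and M is covered by the half-space
   t > 0 of 'rV_4.  Index 0 of 'I_4 is t; index i of 'I_3 is the spatial
   coordinate x^(i+1), whose spacetime index is [spatial i]. *)

Section calculus.
Context {R : realType} {n : nat}.
Implicit Types f : 'rV[R]_n -> R.

Definition partial (i : 'I_n) f : 'rV[R]_n -> R :=
  fun x => 'D_(delta_mx 0 i) f x.

Definition iter_partial (l : seq 'I_n) f : 'rV[R]_n -> R := foldr partial f l.

(* For open [U]: all iterated partial derivatives exist and are continuous. *)
Definition smooth_on (U : set 'rV[R]_n) f : Prop :=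
  forall (l : seq 'I_n) (x : 'rV[R]_n), U x ->
    {for x, continuous (iter_partial l f)} /\
    (forall i, derivable (iter_partial l f) x (delta_mx 0 i)).

Definition component {m : nat} (F : 'rV[R]_n -> 'M[R]_m) (a b : 'I_m) :
  'rV[R]_n -> R := fun x => F x a b.

End calculus.

Section spacetime.
Context {R : realType}.

Definition spatial (i : 'I_3) : 'I_4 := rshift 1 i.

Definition event (t : R) (x : 'rV[R]_3) : 'rV[R]_4 := row_mx t%:M x.

Definition time (X : 'rV[R]_4) : R := X 0 0.

Definition spacetime : set 'rV[R]_4 := [set X | 0 < time X].

Section metric.
Variable g : 'rV[R]_4 -> 'M[R]_4.

Definition christoffel (X : 'rV[R]_4) (l m n : 'I_4) : R :=
  2^-1 * \sum_s invmx (g X) l s *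
    (partial m (component g s n) X + partial n (component g s m) X
     - partial s (component g m n) X).

(* [nabla F X m a b] is nabla_m F_{ab}. *)
Definition nabla (F : 'rV[R]_4 -> 'M[R]_4) (X : 'rV[R]_4) (m a b : 'I_4) : R :=
  partial m (component F a b) X
  - \sum_l christoffel X l m a * F X l b
  - \sum_l christoffel X l m b * F X a l.

Definition divergence (F : 'rV[R]_4 -> 'M[R]_4) (X : 'rV[R]_4) (b : 'I_4) : R :=
  \sum_a \sum_m invmx (g X) a m * nabla F X m a b.

Definition ext_deriv (F : 'rV[R]_4 -> 'M[R]_4) (X : 'rV[R]_4) (a b c : 'I_4) : R :=
  partial a (component F b c) X + partial b (component F c a) X
  + partial c (component F a b) X.

Definition maxwell_solution (F : 'rV[R]_4 -> 'M[R]_4) : Prop :=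
  [/\ forall X, spacetime X -> (F X)^T = - F X,
      forall X i, spacetime X -> F (X + delta_mx 0 (spatial i)) = F X,
      forall a b, smooth_on spacetime (component F a b),
      forall X b, spacetime X -> divergence F X b = 0
    & forall X a b c, spacetime X -> ext_deriv F X a b c = 0].

Definition stress_energy (F : 'rV[R]_4 -> 'M[R]_4) (X : 'rV[R]_4) : 'M[R]_4 :=
  \matrix_(a, b) ((4 * pi)^-1 *
    (\sum_c F X a c * (\sum_d invmx (g X) c d * F X b d)
     - 4^-1 * g X a b *
       \sum_m \sum_n F X m n *
         (\sum_r \sum_s invmx (g X) m r * invmx (g X) n s * F X r s))).

Definition coordinate (gam : R -> 'rV[R]_4) (m : 'I_4) : R -> R :=
  fun s => gam s 0 m.

Definition velocity (gam : R -> 'rV[R]_4) (s : R) : 'rV[R]_4 :=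
  \row_m derive1 (coordinate gam m) s.

Definition energy_density (F : 'rV[R]_4 -> 'M[R]_4) (gam : R -> 'rV[R]_4)
    (s : R) : R :=
  let v := velocity gam s in
  \sum_a \sum_b stress_energy F (gam s) a b * v 0 a * v 0 b.

Definition past_timelike_geodesic (gam : R -> 'rV[R]_4) (I : set R) : Prop :=
  [/\ open I, is_interval I &
   forall s, I s ->
    [/\ spacetime (gam s),
        forall m, derivable (coordinate gam m) s 1 /\
                  derivable (derive1 (coordinate gam m)) s 1,
        forall m, derive1n 2 (coordinate gam m) s
          + \sum_a \sum_b christoffel (gam s) m a b
                          * velocity gam s 0 a * velocity gam s 0 b = 0,
        \sum_a \sum_b g (gam s) a b
                      * velocity gam s 0 a * velocity gam s 0 b = -1
      & velocity gam s 0 0 < 0]].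

Definition inextendible_past_timelike_geodesic
    (gam : R -> 'rV[R]_4) (I : set R) : Prop :=
  past_timelike_geodesic gam I /\
  forall (gam' : R -> 'rV[R]_4) (J : set R), past_timelike_geodesic gam' J ->
    I `<=` J -> (forall s, I s -> gam' s = gam s) -> J `<=` I.

(* The filter "t -> 0 along gam" on the parameter domain [I]. *)
Definition to_singularity (gam : R -> 'rV[R]_4) (I : set R) : set_system R :=
  filter_from [set e : R | 0 < e] (fun e => [set s | I s /\ time (gam s) < e]).

(* Properness of the filter says that t does get arbitrarily close to 0 along
   gam, so that the limit is a genuine one. *)
Definition blows_up_like (F : 'rV[R]_4 -> 'M[R]_4) (a : R)
    (gam : R -> 'rV[R]_4) (I : set R) : Prop :=
  ProperFilter (to_singularity gam I) /\
  exists2 c : R, 0 < c &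
    time (gam s) `^ a * energy_density F gam s @[s --> to_singularity gam I] --> c.

End metric.

Definition kasner (p1 p2 p3 : R) (X : 'rV[R]_4) : 'M[R]_4 :=
  diag_mx (\row_m nth 0 [:: -1; time X `^ (2 * p1); time X `^ (2 * p2);
                            time X `^ (2 * p3)] m).

(* Maxwell data at t = 1: the value at t = 1 of all components F_{ab}, as an
   antisymmetric matrix (hence determined by its six entries a < b). *)
Definition maxwell_data : set ('rV[R]_3 -> 'M[R]_4) :=
  [set D | [/\ forall x, (D x)^T = - D x,
               forall x i, D (x + delta_mx 0 i) = D x,
               forall a b, smooth_on setT (component D a b),
               forall x, \sum_i partial i (component D 0 (spatial i)) x = 0
             & forall x, partial 0 (component D 2 3) x
                         - partial 1 (component D 1 3) x
                         + partial 2 (component D 1 2) x = 0]].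

Definition data_at1 (F : 'rV[R]_4 -> 'M[R]_4) : 'rV[R]_3 -> 'M[R]_4 :=
  fun x => F (event 1 x).

Definition jet (D : maxwell_data) :
    {ptws ('I_4 * 'I_4 * seq 'I_3)%type -> {uniform 'rV[R]_3 -> R}} :=
  fun k => iter_partial k.2 (component (val D) k.1.1 k.1.2).

(* The C^oo topology: uniform convergence of all partial derivatives of all
   components. *)
Definition data_space : topologicalType := initial_topology jet.

(* The manifold P of past directed unit timelike vectors based at t = t0 has the
   global chart (x, w), where x is the base point and w the spatial components
   of the vector; the t-component is determined by these.  A subset of P has
   measure zero iff it is Lebesgue null in this chart; letting x range over
   R^3 rather than T^3 does not change the null sets.  *)
Definition vec3 (a b c : R) : 'rV[R]_3 := \row_i nth 0 [:: a; b; c] i.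

Local Notation mR := (measurableTypeR R).
Local Notation leb := (@lebesgue_measure R).

Definition lebesgue6 :
    {measure set (mR * mR * mR * mR * mR * mR)%type -> \bar R} :=
  (leb \x leb \x leb \x leb \x leb \x leb)%E.

Definition almost_every_timelike_geodesic (g : 'rV[R]_4 -> 'M[R]_4) (t0 : R)
    (Q : (R -> 'rV[R]_4) -> set R -> Prop) : Prop :=
  {ae lebesgue6, forall z,
    let: (x1, x2, x3, w1, w2, w3) := z in
    forall (gam : R -> 'rV[R]_4) (I : set R),
      inextendible_past_timelike_geodesic g gam I -> I 0 ->
      gam 0 = event t0 (vec3 x1 x2 x3) ->
      (forall i, velocity gam 0 0 (spatial i) = vec3 w1 w2 w3 0 i) ->
      Q gam I}.

End spacetime.

Arguments data_space R : clear implicits.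

(* Main.v *)
(** Put e_i = t^(1 - 2 p_i) F_(ti) and B_i = F_(jk) for (i, j, k) cyclic.  Maxwell's evolution
    equations become d_t e = - curl (w B) and d_t B = curl (w e) with w_i = t^(2 p_i - 1).  For every
    multi-index l, the energy sum_i t^(2 (p_i - p_1)) int |d^l e_i|^2 + |d^l B_i|^2 is nondecreasing in t,
    because the curl terms cancel by parts; with the Sobolev inequality on T^3 it gives
    |d^l e_i|, |d^l B_i| <= C t^(p_1 - p_i) on (0, 1].  Hence the time derivatives of e_1, B_1 and of
    their spatial derivatives are O(t^(- p_3)), which is integrable: e_1 and B_1 converge to C^1
    profiles E and B on T^3, and the convergence constants depend continuously on the data.

    A timelike geodesic conserves t^(2 p_i) x_i', reaches t = 0 in finite proper time and its spatial
    position converges to some y.  Along it, t^(2 p_2 + 4 p_3) T(v, v) converges to a positive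
    combination of E(y)^2 and B(y)^2 as soon as the momentum c_3 is nonzero.  If E, B and their
    gradients have no common zero, then E(y) = B(y) = 0 only for a null set of geodesics: y is the
    initial position translated by a vector depending only on the velocity, and on a line the zeros of E
    at which its derivative does not vanish are isolated.

    Regularity of (E, B) in this sense is stable under small perturbations of the data.  It is also
    dense: constants may be added to e_1 and B_1 (they solve the equations), and by
    a Sard-type counting argument arbitrarily small constants move (E, B) away from 0 at all common
    critical points. *)

Require Import Defs.
From HB Require Import structures.
From mathcomp Require Import all_boot all_order all_algebra.
From mathcomp Require Import all_classical all_reals all_analysis.
From mathcomp Require Import ring lra zify.
Set Implicit Arguments.
Unset Strict Implicit.
Unset Printing Implicit Defensive.
Import Order.TTheory GRing.Theory Num.Theory numFieldNormedType.Exports.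
Local Open Scope classical_set_scope.
Local Open Scope ring_scope.

(** * Calculus in one variable *)

(** Every spatial derivative of the fields is a separate function indexed by its list l, and the
    energy argument sees only the resulting hierarchy of equations. The limits at t = 0 are taken
    pointwise for each list and enter later through inequalities only: the Lipschitz bounds and a
    second order Taylor estimate have constants uniform in t, so they survive the limit, and they
    are what the counting argument and the isolation of zeros rest on.

    For i > 1 the energy bound is borderline: the rescaled fields t^(p_i - p_1) e_i and t^(p_i -
    p_1) B_i, which enter the energy density, would merely stay bounded. Inserting the bounds into
    the evolution equations and integrating once more gives e_i, B_i = O(t^(2 p_1)), and t^(p_i +
    p_1) tends to 0 because p_i + p_1 = 1 - p_j for the third index j.

    Stability rests on linearity: the difference of two solutions obeys the same sup bound, without
    a power of t for i = 1. Data that are close at t = 1 therefore have uniformly close profiles,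
    whereas the generic constants leave a lower bound that is uniform over the torus. *)

Section one_variable.
Context {R : realType}.
Implicit Types (f df F : R -> R) (a b x : R).

Lemma is_derive_bound F x l :
  (forall e, 0 < e -> \forall h \near (0 : R), `|F (x + h) - F x - h * l| <= e * `|h|) ->
  is_derive x 1 F l.
Proof.
move=> H.
suff Hf : h^-1 *: ((F \o shift x) h%:A - F x) @[h --> 0^'] --> l.
  have F1 : 'D_1 F x = l by apply: cvg_lim.
  by apply: DeriveDef => //; apply/cvg_ex; exists l.
apply/cvgrPdist_le => e e0; near=> h.
have h0 : h != 0 by near: h; exact: nbhs_dnbhs_neq.
have Hh : `|F (x + h) - F x - h * l| <= e * `|h|.
  by near: h; exact: nbhs_dnbhs (H e e0).
have -> : l - h^-1 *: ((F \o shift x) h%:A - F x) = - (h^-1 * (F (x + h) - F x - h * l)).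
  by rewrite /= [h%:A]mulr1 [h + x]addrC /GRing.scale/=; field.
rewrite normrN normrM normfV.
by rewrite mulrC ler_pdivrMr ?normr_gt0.
Unshelve. all: by end_near. Qed.

Lemma is_derive_cont F x l : is_derive x 1 F l -> {for x, continuous F}.
Proof. by move=> [d _]; apply/differentiable_continuous/derivable1_diffP. Qed.

Lemma cont_within f a b : (forall x, a <= x <= b -> {for x, continuous f}) ->
  {within `[a, b], continuous f}.
Proof.
move=> cf; apply: continuous_in_subspaceT => x; rewrite inE /= in_itv /=; exact: cf.
Qed.

Lemma mvt F df a b : a <= b ->
  (forall x, a <= x <= b -> is_derive x 1 F (df x)) ->
  exists2 c, a <= c <= b & F b - F a = df c * (b - a).
Proof.
move=> ab dF.
have [x|c|c + ->] := @MVT_segment R F df a b ab.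
- by rewrite in_itv /= => /andP[x1 x2]; apply: dF; rewrite !ltW.
- by apply: cont_within => x xab; exact: is_derive_cont (dF _ xab).
by rewrite in_itv /= => cab; exists c.
Qed.

Lemma derive_ge0_le F df a b : a <= b ->
  (forall x, a <= x <= b -> is_derive x 1 F (df x)) ->
  (forall x, a <= x <= b -> 0 <= df x) -> F a <= F b.
Proof.
move=> ab dF df0; rewrite -subr_ge0; have [c cab ->] := mvt ab dF.
by rewrite mulr_ge0 ?subr_ge0// df0.
Qed.

(** Both [F \+ G] and [G \- F] are nondecreasing. With G a primitive of a bound on the derivative of
    F, this stands in for integrating that bound. *)
Lemma derive_bound_le F dF G dG a b : a <= b ->
  (forall x, a <= x <= b -> is_derive x 1 F (dF x)) ->
  (forall x, a <= x <= b -> is_derive x 1 G (dG x)) ->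
  (forall x, a <= x <= b -> `|dF x| <= dG x) -> `|F b - F a| <= G b - G a.
Proof.
move=> ab hF hG H; rewrite ler_norml; apply/andP; split.
- have := @derive_ge0_le (F \+ G) (fun x => dF x + dG x) a b ab _ _ => /=.
  move=> H'; suff : F a + G a <= F b + G b by lra.
  apply: H' => x xab.
    by have := hF x xab; have := hG x xab => ? ?; apply: is_deriveD.
  by have := H x xab; rewrite ler_norml => /andP[+ _]; lra.
- have := @derive_ge0_le (G \- F) (fun x => dG x - dF x) a b ab _ _ => /=.
  move=> H'; suff : G a - F a <= G b - F b by lra.
  apply: H' => x xab.
    by have := hF x xab; have := hG x xab => ? ?; apply: is_deriveB.
  by have := H x xab; rewrite ler_norml => /andP[_]; lra.
Qed.

Definition integ a b f : R := \int[@lebesgue_measure R]_(x in `[a, b]) f x.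

Section integ.
Variables a b : R.
Hypothesis ab : a < b.
Local Notation contab f := (forall x, a <= x <= b -> {for x, continuous f}).

Lemma cont_integrable f : contab f ->
  (@lebesgue_measure R).-integrable `[a, b] (EFin \o f).
Proof.
by move=> cf; apply: continuous_compact_integrable; [exact: segment_compact|exact: cont_within].
Qed.

Lemma integ_ftc F f : (forall x, a <= x <= b -> is_derive x 1 F (f x)) -> contab f ->
  integ a b f = F b - F a.
Proof.
move=> dF cf; rewrite /integ /Rintegral (@continuous_FTC2 _ f F)//.
- exact: cont_within.
- split => [x||].
  + by rewrite in_itv /= => /andP[ax xb]; case: (dF x); rewrite ?ltW.
  + apply: cvg_at_right_filter; apply: is_derive_cont; apply: dF; exact/andP/(conj (lexx _) (ltW ab)).
  + apply: cvg_at_left_filter; apply: is_derive_cont; apply: dF; exact/andP/(conj (ltW ab) (lexx _)).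
- move=> x; rewrite in_itv /= => /andP[ax xb].
  by rewrite derive1E; apply: derive_val; apply: dF; rewrite !ltW.
Qed.

Lemma eq_integ f g : (forall x, a <= x <= b -> f x = g x) -> integ a b f = integ a b g.
Proof. by move=> fg; apply: eq_Rintegral => x; rewrite inE /= in_itv /=; exact: fg. Qed.

Lemma le_integ f g : contab f -> contab g -> (forall x, a <= x <= b -> f x <= g x) ->
  integ a b f <= integ a b g.
Proof.
move=> cf cg fg; by apply: le_Rintegral => //; exact: cont_integrable.
Qed.

Lemma integD f g : contab f -> contab g ->
  integ a b (fun x => f x + g x) = integ a b f + integ a b g.
Proof. by move=> cf cg; apply: RintegralD => //; exact: cont_integrable. Qed.

Lemma integB f g : contab f -> contab g ->
  integ a b (fun x => f x - g x) = integ a b f - integ a b g.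
Proof. by move=> cf cg; apply: RintegralB => //; exact: cont_integrable. Qed.

Lemma integZ k f : contab f -> integ a b (fun x => k * f x) = k * integ a b f.
Proof. by move=> cf; apply: RintegralZl => //; exact: cont_integrable. Qed.

Lemma integ_cst k : integ a b (fun=> k) = k * (b - a).
Proof.
rewrite mulrBr; apply: (@integ_ftc (fun x => k * x)); last by move=> x _; exact: cvg_cst.
by move=> x _; have := is_deriveZ k (is_derive_id x (1:R)); rewrite [_ *: _]mulr1.
Qed.

Lemma integ_norm f k : contab f -> (forall x, a <= x <= b -> `|f x| <= k) ->
  `|integ a b f| <= k * (b - a).
Proof.
have cc c x : {for x, continuous (fun=> c : R)} by exact: cvg_cst.
move=> cf fk; rewrite ler_norml -mulNr -!integ_cst; apply/andP; split;
by apply: le_integ => // x /fk; rewrite ler_norml => /andP[].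
Qed.

End integ.
End one_variable.

(** * Integrals over a segment that depend on a parameter *)

Section parametric.
Context {R : realType}.
Variables a b : R.
Hypothesis ab : a < b.

Lemma tube (T : topologicalType) (P : T -> R -> Prop) (t : T) :
  (forall y, a <= y <= b -> \forall z \near (t, y), P z.1 z.2) ->
  \forall t' \near t, forall y, a <= y <= b -> P t' y.
Proof.
move=> H.
have /compact_near_coveringP/(_ T (nbhs t) P _) := @segment_compact R a b.
move=> K; have {}K : \near t, `[a, b] `<=` P t.
  apply: K => y; rewrite /= in_itv /= => /H [[A B] [/= At By] AB].
  by exists (B, A) => // -[y' t'] /= [? ?]; exact: (AB (t', y')).
near=> t' => y yab.
suff : `[a, b] `<=` P t' by apply; rewrite /= in_itv.
by near: t'.
Unshelve. all: by end_near. Qed.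

Lemma cont_section (T U V : topologicalType) (f : T * U -> V) t y :
  {for (t, y), continuous f} -> {for y, continuous (fun y => f (t, y))}.
Proof.
move=> cf; apply: (@continuous_comp _ _ _ (fun y => (t, y)) f) => //.
by apply: cvg_pair => //=; exact: cvg_cst.
Qed.

Lemma cont_integ (T : topologicalType) (f : T * R -> R) (t : T) :
  (\forall t' \near t, forall y, a <= y <= b -> {for (t', y), continuous f}) ->
  {for t, continuous (fun t => integ a b (fun y => f (t, y)))}.
Proof.
move=> nf.
have cf y : a <= y <= b -> {for (t, y), continuous f} by have := nbhs_singleton nf; apply.
apply/cvgrPdist_le => e e0.
have d0 : 0 < e / (b - a) by rewrite divr_gt0// subr_gt0.
have K : \forall t' \near t, forall y, a <= y <= b -> `|f (t, y) - f (t', y)| <= e / (b - a).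
  apply: tube => y yab.
  have d20 : 0 < e / (b - a) / 2 by rewrite divr_gt0.
  have c1 := cf y yab; have c2 := cont_section c1.
  have N1 : \forall z \near (t, y), `|f (t, y) - f z| <= e / (b - a) / 2.
    by move/cvgrPdist_le : c1; exact.
  have {}c2 : \forall z \near y, `|f (t, y) - f (t, z)| <= e / (b - a) / 2.
    by move/cvgrPdist_le : c2; exact.
  have N2 : \forall z \near (t, y), `|f (t, y) - f (t, z.2)| <= e / (b - a) / 2.
    exists (setT, [set z | `|f (t, y) - f (t, z)| <= e / (b - a) / 2]) => /=.
      by split; [exact: filterT|exact: c2].
    by move=> [? ?] [].
  near=> z.
  have -> : f (t, z.2) - f (z.1, z.2) = (f (t, y) - f z) - (f (t, y) - f (t, z.2)).
    by rewrite -surjective_pairing; ring.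
  rewrite [leRHS]splitr (le_trans (ler_normB _ _))// lerD//.
    by near: z.
  by near: z.
near=> t'.
rewrite -integB => //; last first.
- by move=> y yab; apply: cont_section; move: y yab; near: t'.
- by move=> y yab; apply: cont_section; exact: cf.
have := @integ_norm R a b ab (fun y => f (t, y) - f (t', y)) (e / (b - a)).
rewrite divfK ?gt_eqF ?subr_gt0//; apply.
  move=> y yab; apply: cvgB; apply: cont_section; first exact: cf.
  by move: y yab; near: t'.
by near: t'.
Unshelve. all: by end_near. Qed.

(** By the mean value theorem in t, the difference quotient of the integrand differs from
    [df (t, y)] by a difference of two values of [df], and [tube] makes that small uniformly in
    y. *)
Lemma derive_integ (f df : R * R -> R) (t : R) :
  (\forall t' \near t, forall y, a <= y <= b ->
     [/\ is_derive (t' : R) (1 : R) (fun t => f (t, y)) (df (t', y)),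
        {for y, continuous (fun y => f (t', y))} & {for (t', y), continuous df}]) ->
  is_derive t 1 (fun t => integ a b (fun y => f (t, y))) (integ a b (fun y => df (t, y))).
Proof.
move=> H; apply: is_derive_bound => e e0.
have d0 : 0 < e / (b - a) by rewrite divr_gt0// subr_gt0.
have Ht := nbhs_singleton H.
have K : \forall t' \near t, forall y, a <= y <= b -> `|df (t, y) - df (t', y)| <= e / (b - a).
  apply: tube => y yab.
  have d20 : 0 < e / (b - a) / 2 by rewrite divr_gt0.
  have [_ _ c1] := Ht y yab; have c2 := cont_section c1.
  have N1 : \forall z \near (t, y), `|df (t, y) - df z| <= e / (b - a) / 2.
    by move/cvgrPdist_le : c1; exact.
  have {}c2 : \forall z \near y, `|df (t, y) - df (t, z)| <= e / (b - a) / 2.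
    by move/cvgrPdist_le : c2; exact.
  have N2 : \forall z \near (t, y), `|df (t, y) - df (t, z.2)| <= e / (b - a) / 2.
    exists (setT, [set z | `|df (t, y) - df (t, z)| <= e / (b - a) / 2]) => /=.
      by split; [exact: filterT|exact: c2].
    by move=> [? ?] [].
  near=> z.
  have -> : df (t, z.2) - df (z.1, z.2) = (df (t, y) - df z) - (df (t, y) - df (t, z.2)).
    by rewrite -surjective_pairing; ring.
  rewrite [leRHS]splitr (le_trans (ler_normB _ _))// lerD//.
    by near: z.
  by near: z.
have [r /= r0 rH] : nbhs_ball t [set s | (forall y, a <= y <= b -> [/\ is_derive (s : R) (1 : R) (fun t => f (t, y)) (df (s, y)), {for y, continuous (fun y => f (s, y))} & {for (s, y), continuous df}]) /\ (forall y, a <= y <= b -> `|df (t, y) - df (s, y)| <= e / (b - a))].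
  by apply/nbhs_ballP; exact: filterI H K.
near=> h.
have hr : `|h| < r by near: h; apply/nbhs_ballP; exists r => // x; rewrite /ball /= sub0r normrN.
have H' s : `|s - t| <= `|h| -> ball t r s.
  by move=> sh; rewrite /ball /= distrC (le_lt_trans sh).
have Hth : ball t r (t + h) by apply: H'; rewrite addrC addKr.
have cf s : ball t r s -> forall y, a <= y <= b -> {for y, continuous (fun y => f (s, y))}.
  by move=> bs y yab; have [/(_ y yab)[]] := rH s bs.
have cd : forall y, a <= y <= b -> {for y, continuous (fun y => df (t, y))}.
  by move=> y yab; have [_ _ /cont_section] := Ht y yab.
have bt : ball t r t by exact: ballxx.
rewrite -integB//; [|exact: cf|exact: cf].
rewrite -integZ// -integB//; last 2 first.
- by move=> y yab; apply: cvgB; exact: cf.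
- by move=> y yab; apply: cvgM; [exact: cvg_cst|exact: cd].
have := @integ_norm R a b ab (fun y => f (t + h, y) - f (t, y) - h * df (t, y)) (e / (b - a) * `|h|).
have -> : e / (b - a) * `|h| * (b - a) = e * `|h| by rewrite mulrAC divfK// subr_eq0 gt_eqF.
apply.
  move=> y yab; apply: cvgB; first by apply: cvgB; exact: cf.
  by apply: cvgM; [exact: cvg_cst|exact: cd].
move=> y yab.
have D s : `|s - t| <= `|h| -> is_derive s 1 (fun t => f (t, y)) (df (s, y)).
  by move=> /H' /rH [/(_ y yab)[]].
have E s : `|s - t| <= `|h| -> `|df (t, y) - df (s, y)| <= e / (b - a).
  by move=> /H' /rH [_]; apply.
(* [mvt] takes its end points in increasing order, so the sign of h decides on which side of t it is
   applied. *)
have [s sh ->] : exists2 s, `|s - t| <= `|h| & f (t + h, y) - f (t, y) = df (s, y) * h.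
  have [h0|h0] := leP 0 h.
  - have [s|s sh ->] := @mvt R (fun t => f (t, y)) (fun s => df (s, y)) t (t + h) (ltac:(lra)).
      by move=> sh; apply: D; rewrite !ger0_norm; lra.
    by exists s; [rewrite !ger0_norm; lra|congr (_ * _); ring].
  - have [s|s sh E'] := @mvt R (fun t => f (t, y)) (fun s => df (s, y)) (t + h) t (ltac:(lra)).
      by move=> sh; apply: D; rewrite !ler0_norm; lra.
    exists s; first by rewrite !ler0_norm; lra.
    by rewrite -opprB E'; ring.
have -> : df (s, y) * h - h * df (t, y) = - ((df (t, y) - df (s, y)) * h) by ring.
by rewrite normrN normrM ler_wpM2r// E.
Unshelve. all: by end_near. Qed.

End parametric.

(** * Primitives on a half-line and limits at 0 *)

Section antiderivative.
Context {R : realType}.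
Implicit Types (f F : R -> R).

(** Integration starts at a base point inside the open half-line, with a sign change to its left;
    functions that are singular at [A], such as negative powers of t at 0, are thereby covered. *)
Lemma antiderivative f A : (forall x, A < x -> {for x, continuous f}) ->
  exists F, forall x, A < x -> is_derive x 1 F (f x).
Proof.
move=> cf; pose c := A + 1.
have ca x y : A < x -> forall z, x <= z <= y -> {for z, continuous f}.
  by move=> Ax z /andP[xz _]; apply: cf; exact: lt_le_trans xz.
have integ1 x : integ x x f = 0 by rewrite /integ set_itv1 Rintegral_set1.
have cat m x y : A < m -> m <= x -> x <= y -> integ m y f = integ m x f + integ x y f.
  move=> Am mx; rewrite le_eqVlt => /predU1P[<-|xy]; first by rewrite integ1 addr0.
  have my := le_lt_trans mx xy.
  have /= E := @Rintegral_itvB R f (BLeft m) (BRight y) x (cont_integrable (ca _ _ Am)).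
  apply/eqP; rewrite addrC -subr_eq /integ E ?bnd_simp//; last exact: ltW.
  rewrite Rintegral_itv_obnd_cbnd//.
  apply: integrableS (cont_integrable (ca m y Am)) => //.
  by apply: subset_itvr; rewrite bnd_simp.
exists (fun x => if c <= x then integ c x f else - integ x c f) => x Ax.
set F := (X in is_derive _ _ X _).
(* [m] lies below both [x] and the base point [c], so that near [x] the two branches of the
   primitive merge into the integral from [m] minus a constant. *)
pose m := (A + Num.min x c) / 2.
have Ac : A < c by rewrite /c ltrDl.
have [mx mc Am] : [/\ m < x, m < c & A < m].
  by rewrite /m; case: (leP x c) => xc; split; lra.
have FE y : m <= y -> F y = integ m y f - integ m c f.
  move=> my; rewrite /F; case: (leP c y) => cy.
    by rewrite (@cat m c y) ?(ltW mc)// addrC addKr.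
  by rewrite (@cat m y c) ?(ltW cy)//; ring.
have [dG G'] := @continuous_FTC1_closed R f m x (x + 1) (ltac:(lra)) (cont_integrable (ca _ _ Am)) mx (cf _ Ax).
have {}dG : is_derive x 1 (fun y => integ m y f - integ m c f) (f x).
  have D : is_derive x 1 (fun y => integ m y f) (f x).
    by apply: DeriveDef; [exact: dG|rewrite -derive1E].
  by rewrite -[f x]subr0; exact: is_deriveB.
apply: near_eq_is_derive dG.
near=> y; apply/esym/FE/ltW; rewrite //; near: y; exact: lt_nbhsr.
Unshelve. all: by end_near. Qed.

(** K / q * t^q is a primitive of the bound, so the intervals of radius K / q * t^q around F t are
    nested as t decreases. The limit is the supremum of their left end points, which yields the rate
    at once. *)
Lemma powR_limit F (dF : R -> R) (T K q : R) : 0 < T -> 0 < q ->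
  (forall t, 0 < t <= T -> is_derive t 1 F (dF t)) ->
  (forall t, 0 < t <= T -> `|dF t| <= K * t `^ (q - 1)) ->
  exists L, forall t, 0 < t <= T -> `|F t - L| <= K / q * t `^ q.
Proof.
move=> T0 q0 hF hK.
have H s t : 0 < s -> s <= t -> t <= T -> `|F t - F s| <= K / q * t `^ q - K / q * s `^ q.
  move=> s0 st tT.
  apply: (@derive_bound_le R F dF (fun t => K / q * t `^ q) (fun t => K / q * (q * t `^ (q - 1)))) => //.
  - by move=> x /andP[sx xt]; apply: hF; rewrite (lt_le_trans s0 sx) (le_trans xt tT).
  - move=> x /andP[sx xt]; have x0 := lt_le_trans s0 sx.
    have D := @is_derive1_powR R q x x0.
    exact: (@is_deriveZ _ _ _ (fun t => t `^ q) (K / q)).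
  - move=> x /andP[sx xt].
    rewrite mulrA divfK ?gt_eqF//; apply: hK.
    by rewrite (lt_le_trans s0 sx) (le_trans xt tT).
have K0 : 0 <= K.
  have := hK T; rewrite T0 lexx => /(_ isT) /(le_trans (normr_ge0 _)).
  by rewrite pmulr_lge0// powR_gt0.
have P s : 0 <= K / q * s `^ q by rewrite mulr_ge0 ?powR_ge0// divr_ge0// ltW.
pose G t := F t - K / q * t `^ q.
have GH s t : 0 < s <= T -> 0 < t <= T -> G t <= F s + K / q * s `^ q.
  move=> /andP[s0 sT] /andP[t0 tT]; rewrite /G.
  have [st|/ltW ts] := leP s t.
    have := H s t s0 st tT; rewrite ler_norml => /andP[_].
    have := P s; lra.
  have := H t s t0 ts sT; rewrite ler_norml => /andP[+ _].
  have := P t; lra.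
exists (sup [set G t | t in [set t | 0 < t <= T]]) => t tT.
set S := [set G t | t in _].
have St : S (G t) by exists t.
have ubS s : 0 < s <= T -> ubound S (F s + K / q * s `^ q).
  by move=> sT _ [u uT <-]; exact: GH.
have U1 : sup S <= F t + K / q * t `^ q.
  by apply: ge_sup; [exists (G t)|exact: ubS].
have U2 : G t <= sup S.
  by apply: ub_le_sup => //; exists (F t + K / q * t `^ q); exact: ubS.
rewrite ler_norml; apply/andP; split; move: U1 U2; rewrite /G; lra.
Qed.

End antiderivative.

(** * Integrals over the torus and a Sobolev inequality *)

Section slice_integral.
Context {R : realType} {T : topologicalType}.
Variable D : set T.
Hypothesis oD : open D.
Implicit Types f g : T * R -> R.

(** Integrating out the last coordinate of a nested pair makes the integral over T^3 a threefold
    application of one operation, on shrinking products. *)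
Definition integral01 (T : Type) (f : T * R -> R) (z : T) : R :=
  integ 0 1 (fun y => f (z, y)).

Definition cont_on (T : topologicalType) (D : set T) (f : T -> R) :=
  forall z, D z -> {for z, continuous f}.

Definition cylinder (T : Type) (D : set T) : set (T * R) := [set z | D z.1].

Lemma open_cylinder : open (cylinder D).
Proof. by apply: open_comp => // z _; exact: cvg_fst. Qed.

Lemma cont_on_slice f z : cont_on (cylinder D) f -> D z ->
  forall y, 0 <= y <= 1 -> {for y, continuous (fun y => f (z, y))}.
Proof. by move=> cf Dz y _; apply: cont_section; exact: cf. Qed.

Lemma cont_integral01 f : cont_on (cylinder D) f -> cont_on D (integral01 f).
Proof.
move=> cf z Dz; apply: cont_integ; first exact: ltr01.
have : \forall z' \near z, D z' by exact: open_nbhs_nbhs (conj oD Dz).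
by apply: filterS => z' Dz' y _; exact: cf.
Qed.

(** The curve [s] selects which of the remaining coordinates varies, so the same lemma serves for t
    and for the outer spatial variables. *)
Lemma derive_integral01 f df (s : R -> T) (x : R) :
  cont_on (cylinder D) f -> cont_on (cylinder D) df ->
  (forall z, D (s z) -> {for z, continuous s}) -> D (s x) ->
  (forall z y, D (s z) -> is_derive z 1 (fun z => f (s z, y)) (df (s z, y))) ->
  is_derive x 1 (fun z => integral01 f (s z)) (integral01 df (s x)).
Proof.
move=> cf cdf cs Dx df'.
apply: (@derive_integ R 0 1 ltr01 (fun p => f (s p.1, p.2)) (fun p => df (s p.1, p.2)) x).
have : \forall z \near x, D (s z).
  exact: (cs x Dx _ (open_nbhs_nbhs (conj oD Dx))).
apply: filterS => z Dz y yab; split; [exact: df'|exact: (cont_on_slice cf Dz yab)|].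
apply: (@continuous_comp _ _ _ (fun p : R * R => (s p.1, p.2)) df); last exact: cdf.
have cs1 : s p.1 @[p --> (z, y)] --> s z.
  by apply: (@cvg_comp _ _ _ (@fst R R) s _ (nbhs z)); [exact: cvg_fst|exact: (cs z Dz)].
exact: (@cvg_pair _ _ _ _ (nbhs (s z)) (nbhs y) _ _ _ (fun p => s p.1) snd cs1 cvg_snd).
Qed.

Lemma integral01D f g z : cont_on (cylinder D) f -> cont_on (cylinder D) g -> D z ->
  integral01 (f \+ g) z = integral01 f z + integral01 g z.
Proof. by move=> cf cg Dz; apply: integD => //; exact: cont_on_slice. Qed.

Lemma integral01Z k f z : cont_on (cylinder D) f -> D z ->
  integral01 (fun X => k * f X) z = k * integral01 f z.
Proof. by move=> cf Dz; apply: integZ => //; exact: cont_on_slice. Qed.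

Lemma le_integral01 f g z : cont_on (cylinder D) f -> cont_on (cylinder D) g -> D z ->
  (forall y, f (z, y) <= g (z, y)) -> integral01 f z <= integral01 g z.
Proof. by move=> cf cg Dz fg; apply: le_integ => //; exact: cont_on_slice. Qed.

Lemma integral01_derive f df z : cont_on (cylinder D) df -> D z ->
  (forall y, is_derive (y : R) (1 : R) (fun y => f (z, y)) (df (z, y))) ->
  integral01 df z = f (z, 1) - f (z, 0).
Proof.
move=> cdf Dz fdf.
by apply: (@integ_ftc _ 0 1 ltr01 (fun y => f (z, y))) => // *; exact: cont_on_slice.
Qed.

End slice_integral.

Section periodic_sobolev.
Context {R : realType}.

(** The representative in [0, 1] is chosen before the function, so it can be used for several
    periodic functions at once. *)
Lemma periodic_floor (x : R) : exists2 y, 0 <= y <= 1 &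
  forall g : R -> R, (forall y, g (y + 1) = g y) -> g y = g x.
Proof.
exists (x - (Num.floor x)%:~R) => [|g per].
  have := Num.Theory.floor_itv x; rewrite intrD; move=> /andP[? ?]; apply/andP; split; lra.
have perN n y : g (y + n%:R) = g y.
  by elim: n y => [|n IH] y; rewrite ?addr0// -natr1 addrA per IH.
case: (Num.floor x) => n; first by rewrite -(perN n) /= subrK.
by rewrite NegzE mulrNz opprK perN.
Qed.

(** The difference of g^2 at two points of [0, 1] is at most the integral of 2 |g g'| <= g^2 + g'^2;
    averaging over one of the points gives the claim. *)
Lemma sobolev1 (g dg : R -> R) x : (forall y : R, is_derive y (1 : R) g (dg y)) -> continuous dg ->
  (forall y, g (y + 1) = g y) ->
  g x ^+ 2 <= integ 0 1 (fun y => 2 * g y ^+ 2 + dg y ^+ 2).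
Proof.
move=> gdg cdg per; have cg y : {for y, continuous g} by exact: is_derive_cont (gdg y).
have [x' x'01 /(_ g per) <-] := periodic_floor x.
pose phi y := g y ^+ 2 + dg y ^+ 2.
have cphi y : {for y, continuous phi}.
  by apply: cvgD; apply: cvgM; try exact: cg; exact: cdg.
(* A half-line starting at -1 makes the primitive differentiable at the end point 0 as well. *)
have [Phi dPhi] := @antiderivative R phi (-1) (fun y _ => cphi y).
have dPhi' (y : R) : 0 <= y -> is_derive y (1 : R) Phi (phi y) by move=> y0; apply: dPhi; lra.
have phi0 y : 0 <= phi y by rewrite addr_ge0// sqr_ge0.
have mono y z : 0 <= y -> y <= z -> Phi y <= Phi z.
  move=> y0 yz; apply: (@derive_ge0_le R Phi phi y z yz) => // u /andP[yu _].
  by apply: dPhi'; exact: le_trans yu.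
have B y z : 0 <= y -> y <= z -> `|g z ^+ 2 - g y ^+ 2| <= Phi z - Phi y.
  move=> y0 yz; apply: (@derive_bound_le R (fun y => g y ^+ 2) (fun y => 2 * g y * dg y) Phi phi) => //.
  - move=> u _; have D := gdg u; have D2 := is_deriveM D D.
    by apply: is_derive_eq D2 _; rewrite /GRing.scale /=; ring.
  - by move=> u /andP[yu _]; apply: dPhi'; exact: le_trans yu.
  - move=> u _; rewrite /phi ler_norml; apply/andP; split.
      have := sqr_ge0 (g u + dg u); rewrite sqrrD; lra.
    have := sqr_ge0 (g u - dg u); rewrite sqrrB; lra.
have Phi01 : integ 0 1 phi = Phi 1 - Phi 0.
  by apply: integ_ftc => // y /andP[y0 _]; exact: dPhi'.
have -> : (fun y => 2 * g y ^+ 2 + dg y ^+ 2) = (fun y => g y ^+ 2 + phi y).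
  by apply/funext => y; rewrite /phi; ring.
rewrite integD ?Phi01//; last by move=> y _; apply: cvgM; exact: cg.
have E : g x' ^+ 2 - (Phi 1 - Phi 0) <= integ 0 1 (fun y => g y ^+ 2).
  rewrite -[leLHS]mulr1 -[X in _ * X]subr0 -(@integ_cst R 0 1 ltr01).
  apply: le_integ => //.
  - by move=> y _; exact: cvg_cst.
  - by move=> y _; apply: cvgM; exact: cg.
  move=> y /andP[y0 y1]; case/andP: x'01 => x0 x1.
  have M0 := mono 0 y (lexx _) y0; have M1 := mono y 1 y0 y1.
  have M2 := mono 0 x' (lexx _) x0; have M3 := mono x' 1 x0 x1.
  have [xy|/ltW yx] := leP x' y.
    have := B x' y x0 xy; rewrite ler_norml => /andP[? ?]; lra.
  have := B y x' y0 yx; rewrite ler_norml => /andP[? ?]; lra.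
lra.
Qed.

End periodic_sobolev.

Definition o0 : 'I_3 := @Ordinal 3 0 isT.
Definition o1 : 'I_3 := @Ordinal 3 1 isT.
Definition o2 : 'I_3 := @Ordinal 3 2 isT.

Lemma ord3_ind (P : 'I_3 -> Prop) : P o0 -> P o1 -> P o2 -> forall i, P i.
Proof.
move=> P0 P1 P2 [[|[|[|//]]] lti].
- by have -> : Ordinal lti = o0 by exact: val_inj.
- by have -> : Ordinal lti = o1 by exact: val_inj.
- by have -> : Ordinal lti = o2 by exact: val_inj.
Qed.

(** * Integration over the torus and integration by parts *)

Section torus_integral.
Context {R : realType}.
Local Notation point := (R * R * R * R)%type.
Implicit Types (f g df : point -> R) (X : point) (t : R).

Definition pos_time : set R := [set t | 0 < t].
Definition pos_points : set point := cylinder (cylinder (cylinder pos_time)).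

Definition shift_point (j : 'I_3) (h : R) (X : point) : point :=
  (X.1.1.1, X.1.1.2 + h *+ (val j == 0)%N, X.1.2 + h *+ (val j == 1)%N, X.2 + h *+ (val j == 2)%N).

Definition has_partial (j : 'I_3) f df :=
  forall X, pos_points X -> is_derive (0 : R) (1 : R) (fun h => f (shift_point j h X)) (df X).

Definition space_periodic f :=
  forall j X, pos_points X -> f (shift_point j 1 X) = f X.

Definition torus_integral f t : R := integral01 (integral01 (integral01 f)) t.

Lemma open_pos_time : open pos_time.
Proof. exact: open_gt. Qed.

Let oD1 := open_pos_time.
Let oD2 := @open_cylinder R _ _ oD1.
Let oD3 := @open_cylinder R _ _ oD2.

Lemma torus_integralD f g t : cont_on pos_points f -> cont_on pos_points g -> 0 < t ->
  torus_integral (f \+ g) t = torus_integral f t + torus_integral g t.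
Proof.
move=> cf cg t0; rewrite /torus_integral.
have cf3 := cont_integral01 oD3 cf; have cg3 := cont_integral01 oD3 cg.
have cf2 := cont_integral01 oD2 cf3; have cg2 := cont_integral01 oD2 cg3.
etransitivity; last exact: (@integral01D _ _ pos_time _ _ _ cf2 cg2 t0).
apply: eq_integ => a _; etransitivity; last exact: (@integral01D _ _ (cylinder pos_time) _ _ (t, a) cf3 cg3 t0).
by apply: eq_integ => b _; exact: (@integral01D _ _ (cylinder (cylinder pos_time)) _ _ (t, a, b) cf cg t0).
Qed.

Lemma torus_integralZ k f t : cont_on pos_points f -> 0 < t ->
  torus_integral (fun X => k * f X) t = k * torus_integral f t.
Proof.
move=> cf t0; rewrite /torus_integral.
have cf3 := cont_integral01 oD3 cf; have cf2 := cont_integral01 oD2 cf3.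
etransitivity; last exact: (@integral01Z _ _ pos_time k _ _ cf2 t0).
apply: eq_integ => a _; etransitivity; last exact: (@integral01Z _ _ (cylinder pos_time) k _ (t, a) cf3 t0).
by apply: eq_integ => b _; exact: (@integral01Z _ _ (cylinder (cylinder pos_time)) k _ (t, a, b) cf t0).
Qed.

Lemma le_torus_integral f g t : cont_on pos_points f -> cont_on pos_points g -> 0 < t ->
  (forall a b c, f (t, a, b, c) <= g (t, a, b, c)) -> torus_integral f t <= torus_integral g t.
Proof.
move=> cf cg t0 fg; rewrite /torus_integral.
have cf3 := cont_integral01 oD3 cf; have cg3 := cont_integral01 oD3 cg.
have cf2 := cont_integral01 oD2 cf3; have cg2 := cont_integral01 oD2 cg3.
apply: (le_integral01 cf2 cg2 t0) => a.
apply: (@le_integral01 _ _ (cylinder pos_time) _ _ (t, a) cf3 cg3 t0) => b.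
exact: (@le_integral01 _ _ (cylinder (cylinder pos_time)) _ _ (t, a, b) cf cg t0 (fg a b)).
Qed.

Lemma torus_integral_cst k t : torus_integral (fun=> k) t = k.
Proof. by rewrite /torus_integral /integral01 !(integ_cst ltr01); ring. Qed.

Lemma torus_integral_ge0 f t : cont_on pos_points f -> 0 < t ->
  (forall X, 0 <= f X) -> 0 <= torus_integral f t.
Proof.
move=> cf t0 f0; rewrite -(torus_integral_cst 0 t); apply: le_torus_integral => //.
by move=> X _; exact: cvg_cst.
Qed.

Lemma is_derive_shift0 (F : R -> R) (x l : R) :
  is_derive (0 : R) (1 : R) (fun h => F (x + h)) l -> is_derive x (1 : R) F l.
Proof.
move=> D.
have -> : F = (fun h => F (x + h)) \o (fun y => y - x).
  by apply/funext => y /=; rewrite addrC subrK.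
have D2 : is_derive x (1 : R) (fun y => y - x) 1.
  by rewrite -[X in is_derive _ _ _ X]subr0; exact: is_deriveB.
rewrite -[X in is_derive _ _ _ X]mulr1; apply: is_derive1_comp.
by rewrite subrr.
Qed.

Lemma cont_pair (U V W : topologicalType) (f : U -> V) (g : U -> W) x :
  {for x, continuous f} -> {for x, continuous g} -> {for x, continuous (fun x => (f x, g x))}.
Proof. by move=> cf cg; exact: (@cvg_pair _ _ _ _ (nbhs (f x)) (nbhs (g x)) _ _ _ f g cf cg). Qed.

Lemma has_partial0 f df t a b c : has_partial o0 f df -> 0 < t ->
  is_derive (a : R) (1 : R) (fun a => f (t, a, b, c)) (df (t, a, b, c)).
Proof.
move=> H t0; apply: is_derive_shift0.
rewrite (_ : (fun h : R => _) = fun h => f (shift_point o0 h (t, a, b, c))); first exact: H.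
by apply/funext => h; rewrite /shift_point /= !mulr0n !addr0.
Qed.

Lemma has_partial1 f df t a b c : has_partial o1 f df -> 0 < t ->
  is_derive (b : R) (1 : R) (fun b => f (t, a, b, c)) (df (t, a, b, c)).
Proof.
move=> H t0; apply: is_derive_shift0.
rewrite (_ : (fun h : R => _) = fun h => f (shift_point o1 h (t, a, b, c))); first exact: H.
by apply/funext => h; rewrite /shift_point /= !mulr0n !addr0.
Qed.

Lemma has_partial2 f df t a b c : has_partial o2 f df -> 0 < t ->
  is_derive (c : R) (1 : R) (fun c => f (t, a, b, c)) (df (t, a, b, c)).
Proof.
move=> H t0; apply: is_derive_shift0.
rewrite (_ : (fun h : R => _) = fun h => f (shift_point o2 h (t, a, b, c))); first exact: H.
by apply/funext => h; rewrite /shift_point /= !mulr0n !addr0.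
Qed.

Lemma periodic0 f t a b c : space_periodic f -> 0 < t -> f (t, a + 1, b, c) = f (t, a, b, c).
Proof. by move=> H t0; rewrite -(H o0 (t, a, b, c) t0) /shift_point /= ?mulr0n ?mulr1n ?addr0. Qed.

Lemma periodic1 f t a b c : space_periodic f -> 0 < t -> f (t, a, b + 1, c) = f (t, a, b, c).
Proof. by move=> H t0; rewrite -(H o1 (t, a, b, c) t0) /shift_point /= ?mulr0n ?mulr1n ?addr0. Qed.

Lemma periodic2 f t a b c : space_periodic f -> 0 < t -> f (t, a, b, c + 1) = f (t, a, b, c).
Proof. by move=> H t0; rewrite -(H o2 (t, a, b, c) t0) /shift_point /= ?mulr0n ?mulr1n ?addr0. Qed.

Lemma integral01_0 (T : Type) (f : T * R -> R) z : (forall y, f (z, y) = 0) -> integral01 f z = 0.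
Proof.
move=> f0; rewrite /integral01 (_ : (fun y => f (z, y)) = fun=> 0).
  by rewrite (integ_cst ltr01) mul0r.
by apply/funext.
Qed.

(** The derivative is moved outside the integrals that are nested inside the j-th one; there the
    fundamental theorem of calculus leaves a difference of values at 1 and 0, which vanishes by
    periodicity. The three cases differ in the number of inner integrals, which is two, one and
    none. *)
Lemma torus_integral_partial j f df t : cont_on pos_points f -> cont_on pos_points df ->
  has_partial j f df -> space_periodic f -> 0 < t -> torus_integral df t = 0.
Proof.
move=> cf cdf; move: j; apply: ord3_ind => hf pf t0.
- have cf3 := cont_integral01 oD3 cf; have cdf3 := cont_integral01 oD3 cdf.
  have cf2 := cont_integral01 oD2 cf3; have cdf2 := cont_integral01 oD2 cdf3.
  transitivity (integral01 (integral01 f) (t, 1) - integral01 (integral01 f) (t, 0)); last first.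
    apply/eqP; rewrite subr_eq0; apply/eqP.
    apply: eq_integ => b _; apply: eq_integ => c _.
    by rewrite -[in LHS](add0r 1) periodic0.
  apply: (@integral01_derive _ _ pos_time (integral01 (integral01 f)) _ t cdf2 t0) => a.
  apply: (@derive_integral01 R _ (cylinder pos_time) oD2 (integral01 f) (integral01 df) (fun a => (t, a))) => //.
    by move=> z _; apply: cont_pair; [exact: cvg_cst|exact: cvg_id].
  move=> z b _.
  apply: (@derive_integral01 R _ (cylinder (cylinder pos_time)) oD3 f df (fun a => (t, a, b))) => //.
    by move=> z' _; apply: cont_pair; [apply: cont_pair; [exact: cvg_cst|exact: cvg_id]|exact: cvg_cst].
  by move=> z' c _; exact: has_partial0.
- have cf3 := cont_integral01 oD3 cf; have cdf3 := cont_integral01 oD3 cdf.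
  apply: integral01_0 => a.
  transitivity (integral01 f (t, a, 1) - integral01 f (t, a, 0)); last first.
    rewrite (_ : integral01 _ (t, a, 1) = integral01 f (t, a, 0)) ?subrr//.
    by apply: eq_integ => c _; rewrite -[in LHS](add0r 1) periodic1.
  apply: (@integral01_derive _ _ (cylinder pos_time) (integral01 f) _ (t, a) cdf3 t0) => b.
  apply: (@derive_integral01 R _ (cylinder (cylinder pos_time)) oD3 f df (fun b => (t, a, b))) => //.
    by move=> z' _; apply: cont_pair; [exact: cvg_cst|exact: cvg_id].
  by move=> z' c _; exact: has_partial1.
- apply: integral01_0 => a; apply: integral01_0 => b.
  transitivity (f (t, a, b, 1) - f (t, a, b, 0)); last first.
    by rewrite -{1}(add0r 1) periodic2// subrr.
  apply: (@integral01_derive _ _ (cylinder (cylinder pos_time)) f _ (t, a, b) cdf t0) => c.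
  exact: has_partial2.
Qed.

Lemma derive_torus_integral f df t : cont_on pos_points f -> cont_on pos_points df ->
  (forall t a b c, 0 < t -> is_derive (t : R) (1 : R) (fun t => f (t, a, b, c)) (df (t, a, b, c))) ->
  0 < t -> is_derive t (1 : R) (torus_integral f) (torus_integral df t).
Proof.
move=> cf cdf hf t0.
have cf3 := cont_integral01 oD3 cf; have cdf3 := cont_integral01 oD3 cdf.
have cf2 := cont_integral01 oD2 cf3; have cdf2 := cont_integral01 oD2 cdf3.
apply: (derive_integral01 oD1 (s := fun t => t) cf2 cdf2 _ t0); first by move=> z _; exact: cvg_id.
move=> z a z0.
apply: (derive_integral01 oD2 (s := fun t => (t, a)) cf3 cdf3 _ z0).
  by move=> z' _; apply: cont_pair; [exact: cvg_id|exact: cvg_cst].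
move=> z' b z'0.
apply: (derive_integral01 oD3 (s := fun t => (t, a, b)) cf cdf _ z'0).
  by move=> y _; apply: cont_pair; [apply: cont_pair; [exact: cvg_id|exact: cvg_cst]|exact: cvg_cst].
Qed.

Lemma cont_onM f g : cont_on pos_points f -> cont_on pos_points g ->
  cont_on pos_points (fun X => f X * g X).
Proof. by move=> cf cg X X0; apply: cvgM; [exact: cf|exact: cg]. Qed.

Lemma cont_onD f g : cont_on pos_points f -> cont_on pos_points g ->
  cont_on pos_points (fun X => f X + g X).
Proof. by move=> cf cg X X0; apply: cvgD; [exact: cf|exact: cg]. Qed.

Lemma shift_point0 j X : shift_point j 0 X = X.
Proof. by case: X => [[[t a] b] c]; rewrite /shift_point /= !mul0rn !addr0. Qed.

Lemma torus_integral_by_parts j f df g dg t :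
  cont_on pos_points f -> cont_on pos_points df ->
  cont_on pos_points g -> cont_on pos_points dg ->
  has_partial j f df -> has_partial j g dg -> space_periodic f -> space_periodic g -> 0 < t ->
  torus_integral (fun X => f X * dg X) t + torus_integral (fun X => g X * df X) t = 0.
Proof.
move=> cf cdf cg cdg hf hg pf pg t0.
rewrite -torus_integralD//; [|exact: cont_onM|exact: cont_onM].
apply: (@torus_integral_partial j (fun X => f X * g X)) => //.
- exact: cont_onM.
- by apply: cont_onD; exact: cont_onM.
- move=> X X0; have D := is_deriveM (hf X X0) (hg X X0).
  by apply: is_derive_eq D _; rewrite /GRing.scale /= !shift_point0.
- by move=> k X X0; rewrite pf// pg.
Qed.

End torus_integral.

(** The cyclic successor: [i], [succ3 i], [succ3 (succ3 i)] is always a positively oriented triple,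
    so curls need no case distinction on i. *)
Definition succ3 (i : 'I_3) : 'I_3 :=
  match val i with 0 => o1 | 1 => o2 | _ => o0 end.

Lemma succ3K i : succ3 (succ3 (succ3 i)) = i.
Proof. by move: i; apply: ord3_ind. Qed.

Section reduced.
Context {R : realType}.
Local Notation point := (R * R * R * R)%type.
Implicit Types (X : point) (t : R).

Lemma cont_powR (q t : R) : 0 < t -> {for t, continuous (fun t => t `^ q)}.
Proof. by move=> t0; apply: is_derive_cont (is_derive1_powR q t0). Qed.

Lemma cont_time (k : R -> R) : (forall t, 0 < t -> {for t, continuous k}) ->
  cont_on (@pos_points R) (fun X => k X.1.1.1).
Proof.
move=> ck X X0; apply: (@continuous_comp _ _ _ (fun X : point => X.1.1.1) k); last exact: ck.
apply: (@continuous_comp _ _ _ (fun X : point => X.1.1) fst); last exact: cvg_fst.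
by apply: (@continuous_comp _ _ _ (fun X : point => X.1) fst); exact: cvg_fst.
Qed.

Definition square_sum (M : Type) (F : M -> point -> R) (L : seq M) X : R :=
  \sum_(m <- L) F m X ^+ 2.

Lemma cont_square_sum (M : Type) (F : M -> point -> R) (L : seq M) :
  (forall m, cont_on (@pos_points R) (F m)) -> cont_on (@pos_points R) (square_sum F L).
Proof.
move=> cF; elim: L => [|m L IH].
  rewrite /square_sum (_ : (fun X => _) = fun=> 0); last by apply/funext => X; rewrite big_nil.
  by move=> X _; exact: cvg_cst.
rewrite /square_sum (_ : (fun X => _) = fun X => F m X * F m X + square_sum F L X).
  by apply: cont_onD => //; exact: cont_onM.
by apply/funext => X; rewrite big_cons.
Qed.

Section sobolev.
Variables (f : seq 'I_3 -> point -> R).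
Hypothesis cf : forall l, cont_on (@pos_points R) (f l).
Hypothesis df : forall j l, has_partial j (f l) (f (j :: l)).
Hypothesis pf : forall l, space_periodic (f l).

Definition with_partial (j : 'I_3) (L : seq (seq 'I_3)) := L ++ map (cons j) L.

(** [sobolev1] is applied to each member of L. Its derivative term is also given the factor 2, so
    that the right-hand side is again twice a sum of squares and the step can be iterated. *)
Lemma sobolev_step (F : seq 'I_3 -> R -> R) j L x :
  (forall l (y : R), is_derive y (1 : R) (F l) (F (j :: l) y)) -> (forall l y, F l (y + 1) = F l y) ->
  \sum_(l <- L) F l x ^+ 2 <= integ 0 1 (fun y => 2 * \sum_(l <- with_partial j L) F l y ^+ 2).
Proof.
move=> dF pF; have cF l (y : R) : {for y, continuous (F l)} by exact: is_derive_cont (dF l y).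
have cF2 (L' : seq (seq 'I_3)) (y : R) : {for y, continuous (fun y => \sum_(l <- L') F l y ^+ 2)}.
  elim: L' => [|l L' IH].
    rewrite (_ : (fun y => _) = fun=> 0); first exact: cvg_cst.
    by apply/funext => z; rewrite big_nil.
  rewrite (_ : (fun y => _) = fun z => F l z * F l z + \sum_(l0 <- L') F l0 z ^+ 2).
    by apply: cvgD => //; apply: cvgM; exact: cF.
  by apply/funext => z; rewrite big_cons.
have c2F (L' : seq (seq 'I_3)) (y : R) : {for y, continuous (fun y => 2 * \sum_(l <- L') F l y ^+ 2)}.
  by apply: cvgM; [exact: cvg_cst|exact: cF2].
elim: L => [|l L IH].
  rewrite big_nil -[leLHS](mul0r (1 - 0)) -(@integ_cst R 0 1 ltr01).
  apply: le_integ => [y _|y _|y _]; [exact: cvg_cst|exact: c2F|].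
  by rewrite mulr_ge0// sumr_ge0// => ? _; rewrite sqr_ge0.
rewrite big_cons; have H := @sobolev1 R (F l) (F (j :: l)) x (dF l) (cF (j :: l)) (pF l).
have c1 y : {for y, continuous (fun y => 2 * F l y ^+ 2 + F (j :: l) y ^+ 2)}.
  apply: cvgD; last by apply: cvgM; exact: cF.
  by apply: cvgM; [exact: cvg_cst|apply: cvgM; exact: cF].
apply: le_trans (lerD H IH) _.
rewrite -integD//.
apply: le_integ => [y _|y _|y _]; [by apply: cvgD; [exact: c1|exact: c2F]|exact: c2F|].
rewrite /with_partial !big_cat /= !big_cons.
have := sqr_ge0 (F (j :: l) y); lra.
Qed.

(** The eight ways of differentiating further, at most once in each direction: third order suffices,
    but only in mixed form. *)
Definition sobolev_indices (l : seq 'I_3) : seq (seq 'I_3) :=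
  with_partial o2 (with_partial o1 (with_partial o0 [:: l])).

(** [sobolev_step] is applied once in each direction, and its three factors 2 make up the 8. *)
Lemma sobolev3 l X : pos_points X ->
  f l X ^+ 2 <= 8 * \sum_(m <- sobolev_indices l) torus_integral (fun X => f m X ^+ 2) X.1.1.1.
Proof.
case: X => [[[t a] b] c] /= t0; rewrite /pos_points /cylinder /= in t0.
set L0 := [:: l]; set L1 := with_partial o0 L0; set L2 := with_partial o1 L1.
set L3 := sobolev_indices l.
have oD1 := @open_pos_time R; have oD2 := @open_cylinder R _ _ oD1; have oD3 := @open_cylinder R _ _ oD2.
have cS L := @cont_square_sum _ f L cf.
have c2S L : cont_on (@pos_points R) (fun X => 2 * square_sum f L X).
  by move=> Y Y0; apply: cvgM; [exact: cvg_cst|exact: cS].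
have -> : \sum_(m <- L3) torus_integral (fun X => f m X ^+ 2) t = torus_integral (square_sum f L3) t.
  elim: L3 => [|m L IH].
    rewrite big_nil (_ : square_sum f [::] = fun=> 0) ?torus_integral_cst//.
    by apply/funext => Y; rewrite /square_sum big_nil.
  rewrite big_cons IH (_ : square_sum f (m :: L) = (fun X => f m X ^+ 2) \+ square_sum f L).
    by rewrite torus_integralD//; exact: cont_onM.
  by apply/funext => Y; rewrite /square_sum big_cons.
have step0 : square_sum f L0 (t, a, b, c) <= integ 0 1 (fun a => 2 * square_sum f L1 (t, a, b, c)).
  apply: (@sobolev_step (fun l a => f l (t, a, b, c)) o0) => [l' y|l' y]; first exact: has_partial0.
  exact: periodic0.
have step1 a' : square_sum f L1 (t, a', b, c) <= integ 0 1 (fun b => 2 * square_sum f L2 (t, a', b, c)).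
  apply: (@sobolev_step (fun l b => f l (t, a', b, c)) o1) => [l' y|l' y]; first exact: has_partial1.
  exact: periodic1.
have step2 a' b' : square_sum f L2 (t, a', b', c) <= integ 0 1 (fun c => 2 * square_sum f L3 (t, a', b', c)).
  apply: (@sobolev_step (fun l c => f l (t, a', b', c)) o2) => [l' y|l' y]; first exact: has_partial2.
  exact: periodic2.
have -> : f l (t, a, b, c) ^+ 2 = square_sum f L0 (t, a, b, c) by rewrite /square_sum big_seq1.
apply: le_trans step0 _.
have c3 : cont_on (cylinder (cylinder pos_time)) (integral01 (fun X => 2 * square_sum f L3 X)).
  exact: cont_integral01.
have c3' : cont_on (cylinder (cylinder pos_time)) (fun z => 2 * integral01 (fun X => 2 * square_sum f L3 X) z).
  by move=> Y Y0; apply: cvgM; [exact: cvg_cst|exact: c3].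
have c2 := cont_integral01 oD2 c3'.
have c2' : cont_on (cylinder pos_time) (fun z => 2 * integral01 (fun z => 2 * integral01 (fun X => 2 * square_sum f L3 X) z) z).
  by move=> Y Y0; apply: cvgM; [exact: cvg_cst|exact: c2].
have cb (L : seq (seq 'I_3)) a' (b' : R) : {for b', continuous (fun b => 2 * square_sum f L (t, a', b, c))}.
  apply: (@continuous_comp _ _ _ (fun b => (t, a', b, c)) (fun X => 2 * square_sum f L X)); last exact: c2S.
  by apply: cont_pair; [apply: cont_pair; [exact: cvg_cst|exact: cvg_id]|exact: cvg_cst].
apply: (@le_trans _ _ (integral01 (fun z => 2 * integral01 (fun z => 2 * integral01 (fun X => 2 * square_sum f L3 X) z) z) t)).
  apply: le_integ => [a' _|a' _|a' _].
  - apply: (@continuous_comp _ _ _ (fun a => (t, a, b, c)) (fun X => 2 * square_sum f L1 X)); last exact: c2S.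
    by apply: cont_pair; [apply: cont_pair; [apply: cont_pair; [exact: cvg_cst|exact: cvg_id]|exact: cvg_cst]|exact: cvg_cst].
  - exact: (cont_section (c2' (t, a') t0)).
  - rewrite ler_pM2l//; apply: le_trans (step1 a') _.
    apply: le_integ => [b' _|b' _|b' _].
    + exact: cb.
    + exact: (cont_section (c3' (t, a', b') t0)).
    + by rewrite ler_pM2l//; exact: step2.
rewrite /torus_integral.
have cS3 := cont_integral01 oD3 (cS L3); have cS2 := cont_integral01 oD2 cS3.
rewrite (_ : (8 : R) = 2 * 2 * 2); last by ring.
have Z3 z : cylinder (cylinder pos_time) z -> integral01 (fun X => 2 * square_sum f L3 X) z = 2 * integral01 (square_sum f L3) z.
  by move=> z0; exact: (integral01Z 2 (cS L3) z0).
have Z2 z : cylinder pos_time z -> integral01 (fun z => 2 * integral01 (fun X => 2 * square_sum f L3 X) z) z = 2 * 2 * integral01 (integral01 (square_sum f L3)) z.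
  move=> z0; rewrite -(integral01Z (2 * 2) cS3 z0).
  by apply: eq_integ => b' _; rewrite Z3// mulrA.
rewrite le_eqVlt; apply/orP; left; apply/eqP.
rewrite -(integral01Z (2 * 2 * 2) cS2 t0).
by apply: eq_integ => a' _; rewrite Z2// !mulrA.
Qed.

End sobolev.

End reduced.

(** * The reduced evolution system and its weighted energy *)

Section reduced.
Context {R : realType}.
Local Notation point := (R * R * R * R)%type.
Local Notation field := (bool -> 'I_3 -> seq 'I_3 -> point -> R).
Implicit Types (X : point) (t : R) (u : field).

(** The right-hand sides of both evolution equations in one formula: the boolean s, read as 0 or 1,
    supplies the minus sign in the equation for e, and [~~ s] exchanges the two fields. *)
Definition curl_weighted (p : 'I_3 -> R) u (s : bool) (i : 'I_3) (l : seq 'I_3) X : R :=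
  let t := X.1.1.1 in let j := succ3 i in let k := succ3 j in
  (-1) ^+ s * (t `^ (2 * p k - 1) * u (~~ s) k (j :: l) X
               - t `^ (2 * p j - 1) * u (~~ s) j (k :: l) X).

(* [u true i l] and [u false i l] stand for the iterated derivatives [l] of e_i and B_i, where
   i is the index of the paper minus one. *)
Record reduced (p : 'I_3 -> R) u : Prop := Reduced {
  reduced_cont : forall s i l, cont_on (@pos_points R) (u s i l);
  reduced_partial : forall s i l j, has_partial j (u s i l) (u s i (j :: l));
  reduced_periodic : forall s i l, space_periodic (u s i l);
  reduced_time : forall s i l t a b c, 0 < t ->
    is_derive (t : R) (1 : R) (fun t => u s i l (t, a, b, c)) (curl_weighted p u s i l (t, a, b, c)) }.

Variables (p : 'I_3 -> R) (u : field).
Hypothesis ru : reduced p u.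
Hypothesis p_min : forall i, p o0 <= p i.

Let norm2 (i : 'I_3) (l : seq 'I_3) t : R :=
  torus_integral (fun X => u true i l X ^+ 2) t + torus_integral (fun X => u false i l X ^+ 2) t.

(** The curl terms cancel for the weights w_i times any common function of t. The factor t^(1 - 2
    p_1) is the power of least exponent for which all weights are nondecreasing, and it gives the
    components with i = 1 the weight 1. *)
Definition energy (l : seq 'I_3) t : R := \sum_i t `^ (2 * (p i - p o0)) * norm2 i l t.

Let cu s i l : cont_on (@pos_points R) (u s i l). Proof. exact: (reduced_cont ru). Qed.

Let cw s i l : cont_on (@pos_points R) (curl_weighted p u s i l).
Proof.
have c q := cont_time (@cont_powR R q).
have c1 := cont_onM (c (2 * p (succ3 (succ3 i)) - 1)) (@cu (~~ s) (succ3 (succ3 i)) (succ3 i :: l)).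
have c2 := cont_onM (c (2 * p (succ3 i) - 1)) (@cu (~~ s) (succ3 i) (succ3 (succ3 i) :: l)).
by move=> X X0; apply: cvgM; [exact: cvg_cst|exact: cvgB (c1 X X0) (c2 X X0)].
Qed.

Let cross (i j k : 'I_3) (l : seq 'I_3) t : R :=
  torus_integral (fun X => u true i l X * u false k (j :: l) X) t.

Lemma derive_torus_square s i l t : 0 < t ->
  is_derive (t : R) (1 : R) (torus_integral (fun X => u s i l X ^+ 2))
    (2 * (-1) ^+ s * (t `^ (2 * p (succ3 (succ3 i)) - 1) *
        torus_integral (fun X => u s i l X * u (~~ s) (succ3 (succ3 i)) (succ3 i :: l) X) t
     - t `^ (2 * p (succ3 i) - 1) *
        torus_integral (fun X => u s i l X * u (~~ s) (succ3 i) (succ3 (succ3 i) :: l) X) t)).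
Proof.
move=> t0; set j := succ3 i; set k := succ3 j.
have cM m n : cont_on (@pos_points R) (fun X => u s i l X * u (~~ s) m n X) by exact: cont_onM.
have -> : 2 * (-1) ^+ s * (t `^ (2 * p k - 1) *
        torus_integral (fun X => u s i l X * u (~~ s) k (j :: l) X) t
     - t `^ (2 * p j - 1) *
        torus_integral (fun X => u s i l X * u (~~ s) j (k :: l) X) t) =
    torus_integral (fun X => 2 * u s i l X * curl_weighted p u s i l X) t.
  pose A := 2 * (-1) ^+ s * t `^ (2 * p k - 1); pose B := - 2 * (-1) ^+ s * t `^ (2 * p j - 1).
  transitivity (torus_integral (fun X => A * (u s i l X * u (~~ s) k (j :: l) X) + B * (u s i l X * u (~~ s) j (k :: l) X)) t).
    have cA m n C : cont_on (@pos_points R) (fun X => C * (u s i l X * u (~~ s) m n X)).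
      by apply: cont_onM => // X _; exact: cvg_cst.
    rewrite (torus_integralD (cA k (j :: l) A) (cA j (k :: l) B) t0).
    rewrite (torus_integralZ A (cM k (j :: l)) t0) (torus_integralZ B (cM j (k :: l)) t0).
    suff E (I J : R) : 2 * (-1) ^+ s * (t `^ (2 * p k - 1) * I - t `^ (2 * p j - 1) * J) = A * I + B * J.
      exact: E.
    by rewrite /A /B; ring.
  rewrite /torus_integral; apply: eq_integ => a _; apply: eq_integ => b _; apply: eq_integ => c _.
  by rewrite /curl_weighted /A /B /= -/j -/k; ring.
apply: derive_torus_integral => //.
- exact: cont_onM.
- apply: cont_onM => //; apply: cont_onM => //.
  by move=> X _; exact: cvg_cst.
move=> z a b c z0; have D := reduced_time ru s i l a b c z0; have D2 := is_deriveM D D.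
by apply: is_derive_eq D2 _; rewrite /GRing.scale /=; ring.
Qed.

(* Since t^(2 (p_i - p_1)) = t^(1 - 2 p_1) w_i, the terms e_i d_j B_k and B_k d_j e_i carry the same
   weight w_i w_k and cancel after integration by parts. *)
Lemma derive_energy l t : 0 < t ->
  is_derive (t : R) (1 : R) (energy l) (\sum_i 2 * (p i - p o0) * t `^ (2 * (p i - p o0) - 1) * norm2 i l t).
Proof.
move=> t0; rewrite /energy.
pose dn i :=
  2 * (-1) ^+ true * (t `^ (2 * p (succ3 (succ3 i)) - 1) * cross i (succ3 i) (succ3 (succ3 i)) l t
     - t `^ (2 * p (succ3 i) - 1) * cross i (succ3 (succ3 i)) (succ3 i) l t) +
  2 * (-1) ^+ false * (t `^ (2 * p (succ3 (succ3 i)) - 1) *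
        torus_integral (fun X => u false i l X * u true (succ3 (succ3 i)) (succ3 i :: l) X) t
     - t `^ (2 * p (succ3 i) - 1) *
        torus_integral (fun X => u false i l X * u true (succ3 i) (succ3 (succ3 i) :: l) X) t).
have dN i : is_derive (t : R) (1 : R) (norm2 i l) (dn i).
  exact: is_deriveD (derive_torus_square true i l t0) (derive_torus_square false i l t0).
have dT i := is_deriveM (is_derive1_powR (2 * (p i - p o0)) t0) (dN i).
have D := is_derive_sum (fun i => dT i).
rewrite (_ : (fun t => _) = \sum_(i < 3) (fun t => t `^ (2 * (p i - p o0)) * norm2 i l t)).
  apply: is_derive_eq D _.
  have N i j k : torus_integral (fun X => u false i l X * u true k (j :: l) X) t = - cross k j i l t.
    apply/eqP; rewrite -addr_eq0; apply/eqP; rewrite /cross.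
    by apply: (@torus_integral_by_parts _ j) => //; (exact: (reduced_partial ru) || exact: (reduced_periodic ru)).
  have W i : t `^ (2 * (p i - p o0)) = t `^ (1 - 2 * p o0) * t `^ (2 * p i - 1).
    by rewrite -powRD ?(gt_eqF t0) ?implybT//; congr (_ `^ _); ring.
  rewrite /dn; under eq_bigr do rewrite !N.
  rewrite /= !big_ord_recr !big_ord0 /=.
  rewrite (_ : widen_ord _ _ = o0); last exact: val_inj.
  rewrite (_ : widen_ord _ _ = o1); last exact: val_inj.
  rewrite (_ : ord_max = o2); last exact: val_inj.
  rewrite /GRing.scale /= (W o0) (W o1) (W o2) /succ3 /= !expr1 !expr0.
  move: (t `^ (1 - _)) (t `^ (2 * p o0 - 1)) (t `^ (2 * p o1 - 1)) (t `^ (2 * p o2 - 1)) => E w0 w1 w2.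
  move: (t `^ (2 * (p o0 - p o0) - 1)) (t `^ (2 * (p o1 - p o0) - 1)) (t `^ (2 * (p o2 - p o0) - 1)) => z0 z1 z2.
  move: (norm2 o0 l t) (norm2 o1 l t) (norm2 o2 l t) => n0 n1 n2.
  move: (cross o0 o1 o2 l t) (cross o0 o2 o1 l t) (cross o1 o0 o2 l t) (cross o1 o2 o0 l t)
    (cross o2 o0 o1 l t) (cross o2 o1 o0 l t) => c0 c1 c2 c3 c4 c5.
  by ring.
by apply/funext => z; rewrite fct_sumE.
Qed.

Lemma norm2_ge0 i l t : 0 < t -> 0 <= norm2 i l t.
Proof.
move=> t0; apply: addr_ge0; apply: torus_integral_ge0 => //;
  by [apply: cont_onM|move=> X; exact: sqr_ge0].
Qed.

Lemma energy_le l t : 0 < t -> t <= 1 -> energy l t <= energy l 1.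
Proof.
move=> t0 t1; apply: (@derive_ge0_le R (energy l) _ t 1 t1) => x /andP[tx x1].
  by apply: derive_energy; exact: lt_le_trans tx.
have x0 := lt_le_trans t0 tx.
apply: sumr_ge0 => i _; rewrite mulr_ge0 ?norm2_ge0// mulr_ge0 ?powR_ge0// mulr_ge0// subr_ge0.
exact: p_min.
Qed.

(** The Sobolev inequality leaves eight square integrals; each is at most the energy at time t
    divided by the weight of i, and that energy is at most the one at time 1. *)
Lemma field_bound s i l X : 0 < X.1.1.1 -> X.1.1.1 <= 1 ->
  u s i l X ^+ 2 <= X.1.1.1 `^ (2 * (p o0 - p i)) * (8 * \sum_(m <- sobolev_indices l) energy m 1).
Proof.
move=> t0 t1; set t := X.1.1.1.
have H := @sobolev3 R (u s i) (@cu s i) (fun j l => reduced_partial ru s i l j) (reduced_periodic ru s i) l X t0.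
apply: le_trans H _.
rewrite -/t mulrCA ler_pM2l// mulr_sumr; apply: ler_sum => m _.
have wp : 0 < t `^ (2 * (p i - p o0)) by rewrite powR_gt0.
rewrite (_ : 2 * (p o0 - p i) = - (2 * (p i - p o0))) ?powRN; last by ring.
rewrite mulrC ler_pdivlMr// mulrC.
apply: le_trans (energy_le m t0 t1).
rewrite /energy (bigD1 i)//= -[leLHS]addr0 lerD//.
  rewrite ler_pM2l// /norm2.
  have P s' : 0 <= torus_integral (fun X => u s' i m X ^+ 2) t.
    by apply: torus_integral_ge0 => //; [apply: cont_onM|move=> Y; exact: sqr_ge0].
  by case: s; [rewrite lerDl P|rewrite lerDr P].
by apply: sumr_ge0 => k _; rewrite mulr_ge0 ?powR_ge0// norm2_ge0.
Qed.

(** All weights equal 1 at t = 1, and three components of two fields account for the 6. *)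
Lemma energy_le_data l e : 0 <= e -> (forall s i a b c, `|u s i l (1, a, b, c)| <= e) ->
  energy l 1 <= 6 * e ^+ 2.
Proof.
move=> e0 ue; rewrite /energy.
have I s i : torus_integral (fun X => u s i l X ^+ 2) 1 <= e ^+ 2.
  rewrite -(torus_integral_cst (e ^+ 2) 1); apply: le_torus_integral => //.
  - by apply: cont_onM.
  - by move=> X _; exact: cvg_cst.
  - by move=> a b c; rewrite -[leLHS]real_normK ?num_real// lerXn2r ?nnegrE.
apply: (@le_trans _ _ (\sum_(i < 3) 2 * e ^+ 2)).
  apply: ler_sum => i _; rewrite powR1 mul1r /norm2.
  by rewrite mulr_natl mulr2n lerD.
by rewrite sumr_const card_ord -mulr_natl mulrA; lra.
Qed.

End reduced.

(** * Asymptotics of the reduced fields *)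

Section taylor.
Context {R : realType}.

Definition dist1 (a b c a' b' c' : R) : R := `|a' - a| + `|b' - b| + `|c' - c|.

Lemma mvt_abs (F dF : R -> R) (x y : R) : (forall z : R, is_derive z (1 : R) F (dF z)) ->
  exists2 z, `|z - x| <= `|y - x| & F y - F x = dF z * (y - x).
Proof.
move=> D; have [xy|/ltW yx] := leP x y.
  have [z /andP[xz zy] ->] := @mvt R F dF x y xy (fun z _ => D z).
  by exists z => //; rewrite !ger0_norm; lra.
have [z /andP[xz zy] E] := @mvt R F dF y x yx (fun z _ => D z).
exists z; first by rewrite !ler0_norm; lra.
by rewrite -opprB E; ring.
Qed.

Variables (f f0 f1 f2 : R -> R -> R -> R).
Hypothesis d0 : forall a b c : R, is_derive a (1 : R) (fun a => f a b c) (f0 a b c).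
Hypothesis d1 : forall a b c : R, is_derive b (1 : R) (fun b => f a b c) (f1 a b c).
Hypothesis d2 : forall a b c : R, is_derive c (1 : R) (fun c => f a b c) (f2 a b c).

Lemma mvt3 a b c a' b' c' : exists x y z,
  [/\ `|x - a| <= `|a' - a|, `|y - b| <= `|b' - b|, `|z - c| <= `|c' - c| &
   f a' b' c' - f a b c = f0 x b' c' * (a' - a) + f1 a y c' * (b' - b) + f2 a b z * (c' - c)].
Proof.
have [x xa Ex] := mvt_abs a a' (fun a => d0 a b' c').
have [y yb Ey] := mvt_abs b b' (fun b => d1 a b c').
have [z zc Ez] := mvt_abs c c' (fun c => d2 a b c).
exists x, y, z; split => //; rewrite -Ex -Ey -Ez; ring.
Qed.

Lemma lipschitz3 M a b c a' b' c' : (forall a b c, `|f0 a b c| <= M) ->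
  (forall a b c, `|f1 a b c| <= M) -> (forall a b c, `|f2 a b c| <= M) ->
  `|f a' b' c' - f a b c| <= M * dist1 a b c a' b' c'.
Proof.
move=> M0 M1 M2; have [x [y [z [_ _ _ ->]]]] := mvt3 a b c a' b' c'.
apply: le_trans (ler_normD _ _) _; apply: le_trans (lerD (ler_normD _ _) (lexx _)) _.
by rewrite !normrM /dist1 !mulrDr !lerD// ler_wpM2r.
Qed.

(** [mvt3] changes one coordinate at a time, so each partial derivative is evaluated at an
    intermediate point no farther from (a, b, c) than the end point. Replacing it by its value at
    (a, b, c) costs one more factor of the distance. *)
Lemma taylor3 K a b c a' b' c' : 0 <= K ->
  (forall a b c a' b' c', `|f0 a' b' c' - f0 a b c| <= K * dist1 a b c a' b' c') ->
  (forall a b c a' b' c', `|f1 a' b' c' - f1 a b c| <= K * dist1 a b c a' b' c') ->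
  (forall a b c a' b' c', `|f2 a' b' c' - f2 a b c| <= K * dist1 a b c a' b' c') ->
  `|f a' b' c' - f a b c - (f0 a b c * (a' - a) + f1 a b c * (b' - b) + f2 a b c * (c' - c))|
    <= K * dist1 a b c a' b' c' ^+ 2.
Proof.
move=> K0 L0 L1 L2; have [x [y [z [xa yb zc ->]]]] := mvt3 a b c a' b' c'.
have -> : f0 x b' c' * (a' - a) + f1 a y c' * (b' - b) + f2 a b z * (c' - c) -
  (f0 a b c * (a' - a) + f1 a b c * (b' - b) + f2 a b c * (c' - c)) =
  (f0 x b' c' - f0 a b c) * (a' - a) + (f1 a y c' - f1 a b c) * (b' - b) + (f2 a b z - f2 a b c) * (c' - c).
  by ring.
apply: le_trans (ler_normD _ _) _; apply: le_trans (lerD (ler_normD _ _) (lexx _)) _.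
set d := dist1 a b c a' b' c'.
have -> : K * d ^+ 2 = K * d * `|a' - a| + K * d * `|b' - b| + K * d * `|c' - c|.
  by rewrite expr2 mulrA {2}/d /dist1 !mulrDr.
rewrite !normrM; apply: lerD; first apply: lerD; apply: ler_wpM2r => //.
- apply: le_trans (L0 _ _ _ _ _ _) _; rewrite ler_wpM2l// /d /dist1.
  by rewrite !lerD.
- apply: le_trans (L1 _ _ _ _ _ _) _; rewrite ler_wpM2l// /d /dist1 subrr normr0.
  by rewrite !lerD.
- apply: le_trans (L2 _ _ _ _ _ _) _; rewrite ler_wpM2l// /d /dist1 !subrr normr0.
  by rewrite !lerD// addr_ge0.
Qed.

End taylor.

Section small.
Context {R : realType}.

(** This lets t tend to 0 in an inequality whose error is a positive power of t. Estimates for the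
    fields at positive times are transferred to their limits in this way. *)
Lemma le_of_powR_vanish (A B K q : R) : 0 < q ->
  (forall t, 0 < t <= 1 -> A <= B + K * t `^ q) -> A <= B.
Proof.
move=> q0 H; apply/ler_addgt0Pr => e e0.
have [K0|K0] := leP K 0.
  have := H 1; rewrite ltr01 lexx powR1 mulr1 => /(_ isT) /le_trans; apply.
  by rewrite lerD2l (le_trans K0)// ltW.
(* The second entry solves K * t^q = e. *)
pose t := Num.min 1 ((e / K) `^ q^-1).
have t0 : 0 < t by rewrite lt_min ltr01 powR_gt0// divr_gt0.
have t1 : t <= 1 by rewrite ge_min lexx.
apply: le_trans (H t _) _; first by rewrite t0.
rewrite lerD2l mulrC -ler_pdivlMr//.
have -> : e / K = ((e / K) `^ q^-1) `^ q.
  by rewrite -powRrM mulVf ?gt_eqF// powRr1// divr_ge0// ltW.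
by apply: ge0_ler_powR; rewrite ?nnegrE ?powR_ge0 ?(ltW q0) ?(ltW t0)// ge_min lexx orbT.
Qed.

Lemma powR_le1 (t q r : R) : 0 < t <= 1 -> q <= r -> t `^ r <= t `^ q.
Proof. by move=> t01 qr; exact: ger_powR. Qed.

End small.

(** * Sup bounds on (0, 1] and the limits at t = 0 *)

Section kasner_exponents.
Context {R : realType}.
Variables (p : 'I_3 -> R) (u : bool -> 'I_3 -> seq 'I_3 -> R * R * R * R -> R).
Hypothesis ru : reduced p u.
Hypothesis p01 : p o0 <= p o1.
Hypothesis p12 : p o1 <= p o2.
Hypothesis psum : p o0 + p o1 + p o2 = 1.
Hypothesis p0_lt0 : p o0 < 0.
Hypothesis p2_lt1 : p o2 < 1.

Let p_min i : p o0 <= p i.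
Proof. by move: i; apply: ord3_ind => //; exact: le_trans p12. Qed.

Definition field_const (l : seq 'I_3) : R :=
  Num.sqrt (8 * \sum_(m <- sobolev_indices l) energy p u m 1).

Lemma field_const_ge0 l : 0 <= field_const l. Proof. exact: sqrtr_ge0. Qed.

Lemma field_le s i l t a b c : 0 < t -> t <= 1 ->
  `|u s i l (t, a, b, c)| <= field_const l * t `^ (p o0 - p i).
Proof.
move=> t0 t1; have := field_bound ru p_min s i l (X := (t, a, b, c)) t0 t1; rewrite /= => H.
rewrite -(ler_sqr (x := `|_|)) ?nnegrE ?mulr_ge0 ?powR_ge0 ?field_const_ge0//.
rewrite real_normK ?num_real//; apply: le_trans H _.
rewrite exprMn sqr_sqrtr; last first.
  rewrite mulr_ge0// sumr_ge0// => m _; rewrite sumr_ge0// => k _.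
  by rewrite mulr_ge0 ?powR_ge0//; exact: (norm2_ge0 ru k m ltr01).
have -> : t `^ (2 * (p o0 - p i)) = (t `^ (p o0 - p i)) ^+ 2.
  by rewrite -powR_mulrn ?powR_ge0// -powRrM mulrC.
by rewrite mulrC.
Qed.

(** Eight indices contribute an energy of at most 6 e^2 each, and sqrt (8 * 8 * 6) < 20. *)
Lemma field_const_le_data l e : 0 <= e ->
  (forall m, m \in sobolev_indices l -> forall s i a b c, `|u s i m (1, a, b, c)| <= e) ->
  field_const l <= 20 * e.
Proof.
move=> e0 ue; rewrite /field_const -(@ger0_norm _ (20 * e)) ?mulr_ge0// -sqrtr_sqr.
apply: ler_wsqrtr.
apply: (@le_trans _ _ (8 * \sum_(m <- sobolev_indices l) 6 * e ^+ 2)).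
  rewrite ler_pM2l// big_seq [leRHS]big_seq; apply: ler_sum => m ml.
  by apply: (energy_le_data ru) => //; exact: ue.
rewrite /sobolev_indices /with_partial /= !big_cons big_nil.
have := sqr_ge0 e; rewrite exprMn; lra.
Qed.

Let d_o0 l : R := field_const (o1 :: l) + field_const (o2 :: l).

(** With exponents summing to 1, the two curl terms are O(t^(p_1 + p_3 - 1)) = O(t^(- p_2)) and
    O(t^(p_1 + p_2 - 1)) = O(t^(- p_3)); the second one dominates on (0, 1]. *)
Lemma time_derivative_le0 s l t a b c : 0 < t -> t <= 1 ->
  `|curl_weighted p u s o0 l (t, a, b, c)| <= d_o0 l * t `^ (- p o2).
Proof.
move=> t0 t1; rewrite /curl_weighted /= normrM normrX normrN1 expr1n mul1r.
apply: le_trans (ler_normB _ _) _; rewrite !normrM !(ger0_norm (powR_ge0 _ _)) /d_o0 [leRHS]mulrDl.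
have t01 : 0 < t <= 1 by rewrite t0.
have tn0 : t != 0 by rewrite gt_eqF.
apply: lerD.
- have := field_le (~~ s) o2 (o1 :: l) a b c t0 t1 => H.
  apply: le_trans (ler_wpM2l (powR_ge0 _ _) H) _.
  rewrite mulrCA -powRD ?tn0 ?implybT// ler_wpM2l ?field_const_ge0//.
  by apply: powR_le1 => //; move: psum p12; lra.
- have := field_le (~~ s) o1 (o2 :: l) a b c t0 t1 => H.
  apply: le_trans (ler_wpM2l (powR_ge0 _ _) H) _.
  rewrite mulrCA -powRD ?tn0 ?implybT// ler_wpM2l ?field_const_ge0//.
  by apply: powR_le1 => //; move: psum p12; lra.
Qed.

Lemma limit_o0 s l a b c : exists L, forall t, 0 < t <= 1 ->
  `|u s o0 l (t, a, b, c) - L| <= d_o0 l / (1 - p o2) * t `^ (1 - p o2).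
Proof.
apply: (@powR_limit R (fun t => u s o0 l (t, a, b, c)) (fun t => curl_weighted p u s o0 l (t, a, b, c))) => //.
- by rewrite subr_gt0.
- by move=> t /andP[t0 _]; exact: (reduced_time ru).
- move=> t /andP[t0 t1]; apply: le_trans (time_derivative_le0 s l a b c t0 t1) _.
  by rewrite (_ : 1 - p o2 - 1 = - p o2)//; ring.
Qed.

(** The limit is chosen separately for every point and every list. The values for one-element lists
    are related to those for the empty list by [asymptote_taylor]. *)
Definition asymptote s l a b c : R := projT1 (cid (limit_o0 s l a b c)).

Definition asymptote_rate l : R := d_o0 l / (1 - p o2).

Lemma asymptoteP s l a b c t : 0 < t <= 1 ->
  `|u s o0 l (t, a, b, c) - asymptote s l a b c| <= asymptote_rate l * t `^ (1 - p o2).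
Proof. by rewrite /asymptote; case: cid => L /= H t01; exact: H. Qed.

Definition lip_const l : R := field_const (o0 :: l) + field_const (o1 :: l) + field_const (o2 :: l).

Lemma lip_const_ge0 l : 0 <= lip_const l.
Proof. by rewrite !addr_ge0// field_const_ge0. Qed.

Let ub_o0 s l t a b c : 0 < t -> t <= 1 -> `|u s o0 l (t, a, b, c)| <= field_const l.
Proof.
by move=> t0 t1; have := field_le s o0 l a b c t0 t1; rewrite subrr powRr0 mulr1.
Qed.

(** For i = 1 the sup bound carries no power of t, so the Lipschitz constant is uniform in t and
    passes to the limit. *)
Lemma field_lipschitz s l t a b c a' b' c' : 0 < t -> t <= 1 ->
  `|u s o0 l (t, a', b', c') - u s o0 l (t, a, b, c)| <= lip_const l * dist1 a b c a' b' c'.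
Proof.
move=> t0 t1.
have := field_const_ge0 (o0 :: l); have := field_const_ge0 (o1 :: l); have := field_const_ge0 (o2 :: l) => F2 F1 F0.
apply: (@lipschitz3 R (fun a b c => u s o0 l (t, a, b, c)) (fun a b c => u s o0 (o0 :: l) (t, a, b, c))
  (fun a b c => u s o0 (o1 :: l) (t, a, b, c)) (fun a b c => u s o0 (o2 :: l) (t, a, b, c))).
- by move=> *; exact: (has_partial0 _ _ _ (reduced_partial ru _ _ _ _)).
- by move=> *; exact: (has_partial1 _ _ _ (reduced_partial ru _ _ _ _)).
- by move=> *; exact: (has_partial2 _ _ _ (reduced_partial ru _ _ _ _)).
- by move=> x y z; apply: le_trans (ub_o0 s (o0 :: l) x y z t0 t1) _; rewrite /lip_const; lra.
- by move=> x y z; apply: le_trans (ub_o0 s (o1 :: l) x y z t0 t1) _; rewrite /lip_const; lra.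
- by move=> x y z; apply: le_trans (ub_o0 s (o2 :: l) x y z t0 t1) _; rewrite /lip_const; lra.
Qed.

Lemma asymptote_lipschitz s l a b c a' b' c' :
  `|asymptote s l a' b' c' - asymptote s l a b c| <= lip_const l * dist1 a b c a' b' c'.
Proof.
have q0 : 0 < 1 - p o2 by rewrite subr_gt0.
apply: (@le_of_powR_vanish R _ _ (2 * asymptote_rate l) (1 - p o2) q0) => t t01.
have := asymptoteP s l a b c t01; have := asymptoteP s l a' b' c' t01.
case/andP: t01 => t0 t1; have := field_lipschitz s l a b c a' b' c' t0 t1.
rewrite !ler_norml => /andP[? ?] /andP[? ?] /andP[? ?]; apply/andP; split; lra.
Qed.

Definition taylor_const : R := lip_const [:: o0] + lip_const [:: o1] + lip_const [:: o2].

Lemma taylor_const_ge0 : 0 <= taylor_const.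
Proof. by apply: addr_ge0; [apply: addr_ge0|]; exact: lip_const_ge0. Qed.

Lemma dist1_ge0 (a b c a' b' c' : R) : 0 <= dist1 a b c a' b' c'.
Proof. by rewrite !addr_ge0. Qed.

Lemma asymptote_taylor s a b c a' b' c' :
  `|asymptote s [::] a' b' c' - asymptote s [::] a b c -
    (asymptote s [:: o0] a b c * (a' - a) + asymptote s [:: o1] a b c * (b' - b) +
     asymptote s [:: o2] a b c * (c' - c))| <= taylor_const * dist1 a b c a' b' c' ^+ 2.
Proof.
have q0 : 0 < 1 - p o2 by rewrite subr_gt0.
(* The convergence errors: two from the values at the end points, and one from each first
   derivative, multiplied by its displacement. *)
pose K := 2 * asymptote_rate [::] + asymptote_rate [:: o0] * `|a' - a| +
  asymptote_rate [:: o1] * `|b' - b| + asymptote_rate [:: o2] * `|c' - c|.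
apply: (@le_of_powR_vanish R _ _ K (1 - p o2) q0) => t t01.
have H0 := asymptoteP s [::] a b c t01; have H1 := asymptoteP s [::] a' b' c' t01.
have A0 := asymptoteP s [:: o0] a b c t01; have A1 := asymptoteP s [:: o1] a b c t01.
have A2 := asymptoteP s [:: o2] a b c t01.
case/andP: t01 => t0 t1.
have L0 := lip_const_ge0 [:: o0]; have L1 := lip_const_ge0 [:: o1]; have L2 := lip_const_ge0 [:: o2].
have T : `|u s o0 [::] (t, a', b', c') - u s o0 [::] (t, a, b, c) -
    (u s o0 [:: o0] (t, a, b, c) * (a' - a) + u s o0 [:: o1] (t, a, b, c) * (b' - b) +
     u s o0 [:: o2] (t, a, b, c) * (c' - c))| <= taylor_const * dist1 a b c a' b' c' ^+ 2.
  apply: (@taylor3 R (fun a b c => u s o0 [::] (t, a, b, c)) (fun a b c => u s o0 [:: o0] (t, a, b, c))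
    (fun a b c => u s o0 [:: o1] (t, a, b, c)) (fun a b c => u s o0 [:: o2] (t, a, b, c))).
  - by move=> *; exact: (has_partial0 _ _ _ (reduced_partial ru _ _ _ _)).
  - by move=> *; exact: (has_partial1 _ _ _ (reduced_partial ru _ _ _ _)).
  - by move=> *; exact: (has_partial2 _ _ _ (reduced_partial ru _ _ _ _)).
  - exact: taylor_const_ge0.
  - move=> x y z x' y' z'; apply: le_trans (field_lipschitz s [:: o0] x y z x' y' z' t0 t1) _.
    by rewrite ler_wpM2r ?dist1_ge0// /taylor_const; lra.
  - move=> x y z x' y' z'; apply: le_trans (field_lipschitz s [:: o1] x y z x' y' z' t0 t1) _.
    by rewrite ler_wpM2r ?dist1_ge0// /taylor_const; lra.
  - move=> x y z x' y' z'; apply: le_trans (field_lipschitz s [:: o2] x y z x' y' z' t0 t1) _.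
    by rewrite ler_wpM2r ?dist1_ge0// /taylor_const; lra.
have {}A0 := ler_wpM2r (normr_ge0 (a' - a)) A0; rewrite -normrM in A0.
have {}A1 := ler_wpM2r (normr_ge0 (b' - b)) A1; rewrite -normrM in A1.
have {}A2 := ler_wpM2r (normr_ge0 (c' - c)) A2; rewrite -normrM in A2.
move: T H0 H1 A0 A1 A2; rewrite /K !mulrBl !mulrDl !(mulrAC _ (`|_|)).
rewrite !ler_norml => /andP[? ?] /andP[? ?] /andP[? ?] /andP[? ?] /andP[? ?] /andP[? ?].
by apply/andP; split; lra.
Qed.

(** After insertion of the sup bounds, the worst curl term contains the component 1 and is O(t^(2
    p_1 - 1)); integrating from t = 1 down gives t^(2 p_1). This improves on t^(p_1 - p_i) because
    p_1 + p_i > 0. *)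
Lemma field_growth s i l : i != o0 -> exists2 C, 0 <= C & forall t a b c, 0 < t <= 1 ->
  `|u s i l (t, a, b, c)| <= C * t `^ (2 * p o0).
Proof.
move=> i0.
have H : exists2 K, 0 <= K & forall t a b c, 0 < t <= 1 ->
    `|curl_weighted p u s i l (t, a, b, c)| <= K * t `^ (2 * p o0 - 1).
  exists (field_const (succ3 i :: l) + field_const (succ3 (succ3 i) :: l)).
    by rewrite addr_ge0// field_const_ge0.
  move=> t a b c /[dup] t01 /andP[t0 t1].
  have tn0 : t != 0 by rewrite gt_eqF.
  rewrite /curl_weighted /= normrM normrX normrN1 expr1n mul1r.
  apply: le_trans (ler_normB _ _) _; rewrite !normrM !(ger0_norm (powR_ge0 _ _)) [leRHS]mulrDl.
  apply: lerD.
  - have := field_le (~~ s) (succ3 (succ3 i)) (succ3 i :: l) a b c t0 t1 => H.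
    apply: le_trans (ler_wpM2l (powR_ge0 _ _) H) _.
    rewrite mulrCA -powRD ?tn0 ?implybT// ler_wpM2l ?field_const_ge0//.
    by apply: powR_le1 => //; move: i0; move: i {H}; apply: ord3_ind => //= _; move: psum p12 p01 p0_lt0 p2_lt1; lra.
  - have := field_le (~~ s) (succ3 i) (succ3 (succ3 i) :: l) a b c t0 t1 => H.
    apply: le_trans (ler_wpM2l (powR_ge0 _ _) H) _.
    rewrite mulrCA -powRD ?tn0 ?implybT// ler_wpM2l ?field_const_ge0//.
    by apply: powR_le1 => //; move: i0; move: i {H}; apply: ord3_ind => //= _; move: psum p12 p01 p0_lt0 p2_lt1; lra.
case: H => K K0 H.
have q0 : 0 < - (2 * p o0) by move: p0_lt0; lra.
exists (field_const l + K / - (2 * p o0)).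
  by rewrite addr_ge0 ?field_const_ge0// divr_ge0// ltW.
move=> t a b c /andP[t0 t1].
(* As p_1 < 0, the coefficient K / (2 p_1) is at most 0, and the comparison function is a
   nondecreasing primitive of K * t^(2 p_1 - 1). *)
have B : `|u s i l (1, a, b, c) - u s i l (t, a, b, c)| <=
    K / (2 * p o0) * 1 `^ (2 * p o0) - K / (2 * p o0) * t `^ (2 * p o0).
  apply: (@derive_bound_le R (fun t => u s i l (t, a, b, c)) (fun t => curl_weighted p u s i l (t, a, b, c))
    (fun t => K / (2 * p o0) * t `^ (2 * p o0)) (fun t => K / (2 * p o0) * (2 * p o0 * t `^ (2 * p o0 - 1))) t 1 t1).
  - by move=> x /andP[tx _]; apply: (reduced_time ru); exact: lt_le_trans tx.
  - move=> x /andP[tx _]; have D := is_derive1_powR (2 * p o0) (lt_le_trans t0 tx).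
    exact: (@is_deriveZ _ _ _ (fun t => t `^ (2 * p o0)) (K / (2 * p o0))).
  - move=> x /andP[tx x1]; rewrite mulrA divfK; first by apply: H; rewrite x1 (lt_le_trans t0 tx).
    by rewrite lt_eqF//; move: p0_lt0; lra.
have U1 := field_le s i l a b c ltr01 (lexx 1); rewrite powR1 mulr1 in U1.
(* This absorbs the bound on the data at t = 1 into the power of t. *)
have P1 : 1 <= t `^ (2 * p o0).
  by rewrite -[leLHS](powRr0 t); apply: powR_le1; rewrite ?t0//; move: p0_lt0; lra.
have F0 := field_const_ge0 l.
have N : `|u s i l (t, a, b, c)| <= `|u s i l (1, a, b, c)| + `|u s i l (1, a, b, c) - u s i l (t, a, b, c)|.
  have -> : u s i l (t, a, b, c) = u s i l (1, a, b, c) - (u s i l (1, a, b, c) - u s i l (t, a, b, c)) by ring.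
  apply: le_trans (ler_normB _ _) _; rewrite lerD// le_eqVlt; apply/orP; left; apply/eqP; congr `|_|; ring.
apply: le_trans N _; apply: le_trans (lerD U1 B) _.
rewrite powR1 mulr1 [leRHS]mulrDl; apply: lerD; first by rewrite ler_peMr.
rewrite invrN mulrN mulNr.
have : K / (2 * p o0) <= 0 by rewrite mulr_ge0_le0// invr_le0; move: p0_lt0; lra.
lra.
Qed.

End kasner_exponents.

(** * Profiles and their genericity *)

Section profiles.
Context {R : realType}.
Local Notation field := (bool -> 'I_3 -> seq 'I_3 -> R * R * R * R -> R).
Local Notation profile := (bool -> seq 'I_3 -> R -> R -> R -> R).
Implicit Types (u v : field) (E F : profile).

(* [E true l] and [E false l] are the limits as t -> 0 of the derivatives [l] of e_1 and B_1. *)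
Record is_profile (q : R) u E : Prop := IsProfile {
  profile_cvg : forall s l, exists K, forall t a b c, 0 < t <= 1 ->
    `|u s o0 l (t, a, b, c) - E s l a b c| <= K * t `^ q;
  profile_lipschitz : forall s l, exists2 K, 0 <= K & forall a b c a' b' c',
    `|E s l a' b' c' - E s l a b c| <= K * dist1 a b c a' b' c';
  profile_taylor : exists2 K, 0 <= K & forall s a b c a' b' c',
    `|E s [::] a' b' c' - E s [::] a b c -
      (E s [:: o0] a b c * (a' - a) + E s [:: o1] a b c * (b' - b) +
       E s [:: o2] a b c * (c' - c))| <= K * dist1 a b c a' b' c' ^+ 2 }.

Section exponents.
Variable p : 'I_3 -> R.
Hypothesis p01 : p o0 <= p o1.
Hypothesis p12 : p o1 <= p o2.
Hypothesis psum : p o0 + p o1 + p o2 = 1.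
Hypothesis p0_lt0 : p o0 < 0.
Hypothesis p2_lt1 : p o2 < 1.

Lemma exists_profile u : reduced p u -> exists E, is_profile (1 - p o2) u E.
Proof.
move=> ru; exists (asymptote ru p01 p12 psum p2_lt1); split.
- move=> s l; exists (asymptote_rate p u l) => t a b c; exact: asymptoteP.
- move=> s l; exists (lip_const p u l); first exact: lip_const_ge0.
  by move=> *; exact: asymptote_lipschitz.
- exists (taylor_const p u); first exact: taylor_const_ge0.
  by move=> *; exact: asymptote_taylor.
Qed.

Definition uniform_shift (k : bool -> R) (s : bool) (i : 'I_3) (l : seq 'I_3) : R :=
  if (i == o0) && nilp l then k s else 0.

(** The system is linear, and its right-hand side involves nonempty lists only, on which
    [uniform_shift] vanishes: a constant in the component 1 is an exact solution. *)
Lemma reduced_sub_shift u v k : reduced p u -> reduced p v ->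
  reduced p (fun s i l X => u s i l X - v s i l X - uniform_shift k s i l).
Proof.
move=> ru rv; split.
- move=> s i l X X0; apply: cvgB; last exact: cvg_cst.
  by apply: cvgB; [exact: (reduced_cont ru)|exact: (reduced_cont rv)].
- move=> s i l j X X0.
  have D := is_deriveB (is_deriveB (reduced_partial ru s i l j X0) (reduced_partial rv s i l j X0))
    (is_derive_cst (uniform_shift k s i l) (0 : R) (1 : R)).
  by apply: is_derive_eq D _; rewrite /uniform_shift /= andbF.
- move=> s i l j X X0 /=; by rewrite (reduced_periodic ru) // (reduced_periodic rv).
- move=> s i l t a b c t0.
  have D := is_deriveB (is_deriveB (reduced_time ru s i l a b c t0) (reduced_time rv s i l a b c t0))
    (is_derive_cst (uniform_shift k s i l) (t : R) (1 : R)).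
  apply: is_derive_eq D _; rewrite /curl_weighted /uniform_shift /= !andbF.
  by move: (t `^ _) (t `^ _) ((-1) ^+ s) => *; ring.
Qed.

(** The difference of the two fields and the constant is again a reduced solution, so the sup bound
    for i = 1 carries its smallness from t = 1 to every t in (0, 1], and then to the limit. *)
Lemma profile_close u v E F k e l : reduced p u -> reduced p v ->
  is_profile (1 - p o2) u E -> is_profile (1 - p o2) v F -> 0 <= e ->
  (forall m, m \in sobolev_indices l -> forall s i a b c,
    `|u s i m (1, a, b, c) - v s i m (1, a, b, c) - uniform_shift k s i m| <= e) ->
  forall s a b c, `|E s l a b c - F s l a b c - uniform_shift k s o0 l| <= 20 * e.
Proof.
move=> ru rv hE hF e0 close s a b c.
have [K1 HE] := profile_cvg hE s l; have [K2 HF] := profile_cvg hF s l.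
have q0 : 0 < 1 - p o2 by rewrite subr_gt0.
apply: (@le_of_powR_vanish R _ _ (K1 + K2) _ q0) => t t01.
have := HE t a b c t01; have := HF t a b c t01.
have rw := reduced_sub_shift k ru rv.
case/andP: t01 => t0 t1.
have H : `|u s o0 l (t, a, b, c) - v s o0 l (t, a, b, c) - uniform_shift k s o0 l| <= 20 * e.
  have := field_le rw p01 p12 s o0 l a b c t0 t1; rewrite subrr powRr0 mulr1 => /le_trans; apply.
  exact: field_const_le_data.
move: H; rewrite !ler_norml => /andP[? ?] /andP[? ?] /andP[? ?]; apply/andP; split; lra.
Qed.

Lemma profile_shift u E s l a b c n0 n1 n2 : reduced p u -> is_profile (1 - p o2) u E ->
  (n0 <= 1)%N -> (n1 <= 1)%N -> (n2 <= 1)%N ->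
  E s l (a + n0%:R) (b + n1%:R) (c + n2%:R) = E s l a b c.
Proof.
move=> ru hE n01 n11 n21; apply/eqP; rewrite -subr_eq0 -normr_le0.
have [K HK] := profile_cvg hE s l.
have q0 : 0 < 1 - p o2 by rewrite subr_gt0.
apply: (@le_of_powR_vanish R _ _ (2 * K) _ q0) => t t01.
have := HK t a b c t01; have := HK t (a + n0%:R) (b + n1%:R) (c + n2%:R) t01.
have -> : u s o0 l (t, a + n0%:R, b + n1%:R, c + n2%:R) = u s o0 l (t, a, b, c).
  case/andP: t01 => t0 _; have P := reduced_periodic ru s o0 l.
  case: n0 n01 => [|[|//]] _; case: n1 n11 => [|[|//]] _; case: n2 n21 => [|[|//]] _;
    by rewrite ?addr0 ?(periodic0 _ _ _ P t0) ?(periodic1 _ _ _ P t0) ?(periodic2 _ _ _ P t0).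
rewrite !ler_norml => /andP[? ?] /andP[? ?]; apply/andP; split; lra.
Qed.

End exponents.

(** * Constants that move the profiles away from degenerate common zeros *)

Section generic_shift.
Variable E : profile.
Hypothesis lipE : forall s l, exists2 K, 0 <= K & forall a b c a' b' c',
    `|E s l a' b' c' - E s l a b c| <= K * dist1 a b c a' b' c'.
Hypothesis taylorE : exists2 K, 0 <= K & forall s a b c a' b' c',
    `|E s [::] a' b' c' - E s [::] a b c -
      (E s [:: o0] a b c * (a' - a) + E s [:: o1] a b c * (b' - b) +
       E s [:: o2] a b c * (c' - c))| <= K * dist1 a b c a' b' c' ^+ 2.
Hypothesis perE : forall s l a b c n0 n1 n2, (n0 <= 1)%N -> (n1 <= 1)%N -> (n2 <= 1)%N ->
  E s l (a + n0%:R) (b + n1%:R) (c + n2%:R) = E s l a b c.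

(** The six Lipschitz constants of first derivatives and the Taylor constant are nonnegative, so
    their sum dominates each; the added 1 makes the mesh-dependent threshold [r] of [generic_shift]
    positive. *)
Lemma common_const : exists2 K, 1 <= K &
  (forall s j a b c a' b' c', `|E s [:: j] a' b' c' - E s [:: j] a b c| <= K * dist1 a b c a' b' c') /\
  forall s a b c a' b' c',
    `|E s [::] a' b' c' - E s [::] a b c -
      (E s [:: o0] a b c * (a' - a) + E s [:: o1] a b c * (b' - b) +
       E s [:: o2] a b c * (c' - c))| <= K * dist1 a b c a' b' c' ^+ 2.
Proof.
have /choice[k kP] : forall x : bool * 'I_3, exists K, 0 <= K /\ forall a b c a' b' c',
    `|E x.1 [:: x.2] a' b' c' - E x.1 [:: x.2] a b c| <= K * dist1 a b c a' b' c'.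
  by move=> x; have [K K0 H] := lipE x.1 [:: x.2]; exists K.
have [K K0 HK] := taylorE.
have S0 : 0 <= \sum_x k x by apply: sumr_ge0 => x _; have [] := kP x.
exists (1 + K + \sum_x k x); first by rewrite -addrA lerDl addr_ge0.
split.
- move=> s j a b c a' b' c'; have [k0 H] := kP (s, j).
  apply: le_trans (H a b c a' b' c') _; rewrite ler_wpM2r ?dist1_ge0//.
  rewrite (bigD1 (s, j))//= addrCA lerDl addr_ge0 ?addr_ge0//.
  by apply: sumr_ge0 => x _; have [] := kP x.
- move=> s a b c a' b' c'; apply: le_trans (HK s a b c a' b' c') _.
  by rewrite ler_wpM2r ?sqr_ge0//; lra.
Qed.

Lemma nearest_node (n : nat) (x : R) : (0 < n)%N -> 0 <= x <= 1 ->
  exists i : 'I_n, `|x - (val i)%:R / n%:R| <= n%:R^-1.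
Proof.
move=> n0 /andP[x0 x1]; have n0' : 0 < n%:R :> R by rewrite ltr0n.
have nx0 : 0 <= n%:R * x by rewrite mulr_ge0// ltW.
have /andP[m1 m2] := Num.Theory.truncn_itv nx0.
set m := Num.truncn (n%:R * x) in m1 m2.
have mn : (m <= n)%N.
  by rewrite -(ler_nat R); apply: le_trans m1 _; rewrite ler_piMr// ltW.
have key (k : nat) : `|n%:R * x - k%:R| <= 1 -> `|x - k%:R / n%:R| <= n%:R^-1.
  have -> : x - k%:R / n%:R = (n%:R * x - k%:R) / n%:R.
    by rewrite mulrBl mulrAC divff ?gt_eqF// mul1r.
  by rewrite normrM normfV (gtr0_norm n0') => H; rewrite ler_piMl// invr_ge0 ltW.
have m2' : n%:R * x < m%:R + 1 by rewrite natr1.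
move: mn; rewrite leq_eqVlt => /predU1P[mn|mn].
(* The nodes are i / n with i < n, so x = 1 is assigned to the node n - 1, at distance exactly 1 /
   n. *)
- have pn : (n.-1 < n)%N by rewrite prednK.
  exists (Ordinal pn); apply: key => /=.
  have E1 : n%:R = n.-1%:R + 1 :> R by rewrite natr1 prednK.
  have : n%:R * x <= n%:R by rewrite ler_piMr// ltW.
  rewrite mn in m1; rewrite ger0_norm; lra.
- exists (Ordinal mn); apply: key => /=; rewrite ger0_norm; lra.
Qed.

(* Replaces Sard's theorem by counting.  On the grid of mesh 1/n with n = N^2, at a point where all
   first derivatives are below r = K / n^2, both profiles lie within 28 r of their values at the nearest
   node.  There are n^3 = N^6 nodes but (N^3 + 1)^2 candidate shifts, pairwise 57 r apart and all of
   size O(1 / N), so that some shift avoids every node. *)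
Lemma generic_shift d : 0 < d -> exists k : bool -> R, (forall s, `|k s| < d) /\
  exists2 e, 0 < e & forall a b c,
    (exists s, e <= `|E s [::] a b c + k s|) \/ (exists s j, e <= `|E s [:: j] a b c|).
Proof.
move=> d0; have [K K1 [LK TK]] := common_const.
have K0 : 0 < K by lra.
(* 114 = 2 * 57: the largest shift is N^3 * 57 r = 57 K / N, which is then less than d / 2. *)
have [N N0 Nd] : exists2 N : nat, 0 < N%:R :> R & 114 * K < d * N%:R.
  exists (Num.truncn (114 * K / d)).+1; first by rewrite ltr0n.
  by rewrite [ltRHS]mulrC -ltr_pdivrMr//; exact: Num.Theory.truncnS_gt.
pose n := (N ^ 2)%N; pose m := (N ^ 3).+1.
have n0 : (0 < n)%N by rewrite expn_gt0 -(ltr0n R) N0.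
have n0' : 0 < n%:R :> R by rewrite ltr0n.
pose r : R := K / n%:R ^+ 2.
have r0 : 0 < r by rewrite divr_gt0// exprn_gt0.
pose sh (j : 'I_m) : R := (val j)%:R * (57 * r).
pose y (i : 'I_n) : R := (val i)%:R / n%:R.
have sh_lt j : `|sh j| < d.
  have s0 : 0 <= sh j by rewrite /sh mulr_ge0// mulr_ge0// ltW.
  rewrite ger0_norm// /sh.
  have jm : (val j)%:R <= N%:R ^+ 3 :> R by rewrite -natrX ler_nat -ltnS; exact: ltn_ord.
  apply: (@le_lt_trans _ _ (N%:R ^+ 3 * (57 * r))); first by rewrite ler_wpM2r// mulr_ge0// ltW.
  have -> : N%:R ^+ 3 * (57 * r) = 57 * K / N%:R.
    rewrite /r /n natrX; field; exact: lt0r_neq0.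
  rewrite ltr_pdivrMr//; lra.
have [js Hjs] : exists js : 'I_m * 'I_m, forall i0 i1 i2, exists s : bool,
    28 * r <= `|E s [::] (y i0) (y i1) (y i2) + sh (if s then js.1 else js.2)|.
  apply: contrapT => /forallNP H.
  have /choice[f fP] : forall js : 'I_m * 'I_m, exists i : 'I_n * 'I_n * 'I_n, forall s : bool,
      `|E s [::] (y i.1.1) (y i.1.2) (y i.2) + sh (if s then js.1 else js.2)| < 28 * r.
    move=> js; have := H js => /existsNP[i0 /existsNP[i1 /existsNP[i2 /forallNP Hs]]].
    by exists (i0, i1, i2) => s; rewrite ltNge; apply/negP; exact: Hs.
  (* Pigeonhole: [f] picks a node at which the shift fails. Two shifts failing at the same node for
     the same s are less than 56 r apart, while distinct ones differ by at least 57 r. *)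
  have finj : injective f.
    move=> [j0 j1] [k0 k1] fjk.
    have sinj (j k : 'I_m) (z : R) : `|z + sh j| < 28 * r -> `|z + sh k| < 28 * r -> j = k.
      move=> Hj Hk.
      have : `|sh j - sh k| < 57 * r.
        move: Hj Hk; rewrite !ltr_norml => /andP[? ?] /andP[? ?]; apply/andP; split; lra.
      have R57 : 0 < 57 * r by rewrite mulr_gt0.
      rewrite /sh -mulrBl normrM (gtr0_norm R57) -[ltRHS]mul1r ltr_pM2r// => L.
      apply: val_inj => /=; move: L; rewrite ltr_norml => /andP[L1 L2].
      have L1' : (val k < (val j).+1)%N by rewrite -(ltr_nat R) -natr1; lra.
      have L2' : (val j < (val k).+1)%N by rewrite -(ltr_nat R) -natr1; lra.
      by apply/eqP; rewrite eqn_leq -ltnS L2' -ltnS L1'.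
    have F1 := fP (j0, j1); have F2 := fP (k0, k1); rewrite fjk in F1.
    have E1 := sinj _ _ _ (F1 true) (F2 true); have E2 := sinj _ _ _ (F1 false) (F2 false).
    by rewrite /= in E1 E2; rewrite E1 E2.
  have := leq_card f finj; rewrite !card_prod !card_ord /m /n leqNgt => /negP; apply.
  by rewrite -!expnD mulSn mulnS addnS -expnD; lia.
exists (fun s => sh (if s then js.1 else js.2)); split => [s|]; first exact: sh_lt.
exists r => // a b c.
have [a' a'01 Ea] := periodic_floor a; have [b' b'01 Eb] := periodic_floor b.
have [c' c'01 Ec] := periodic_floor c.
have red s l : E s l a b c = E s l a' b' c'.
  rewrite -(Ea (fun a => E s l a b c)); last first.
    by move=> z; have := perE s l z b c (n0 := 1) (n1 := 0) (n2 := 0) isT isT isT; rewrite !addr0.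
  rewrite -(Eb (fun b => E s l a' b c)); last first.
    by move=> z; have := perE s l a' z c (n0 := 0) (n1 := 1) (n2 := 0) isT isT isT; rewrite !addr0.
  rewrite -(Ec (fun c => E s l a' b' c))//.
    by move=> z; have := perE s l a' b' z (n0 := 0) (n1 := 0) (n2 := 1) isT isT isT; rewrite !addr0.
have [i0 Hi0] := nearest_node n0 a'01; have [i1 Hi1] := nearest_node n0 b'01.
have [i2 Hi2] := nearest_node n0 c'01.
rewrite -/(y i0) in Hi0; rewrite -/(y i1) in Hi1; rewrite -/(y i2) in Hi2.
have n1 : n%:R^-1 <= 1 :> R by rewrite invf_le1// ler1n.
have dD : dist1 (y i0) (y i1) (y i2) a' b' c' <= 3 * n%:R^-1 by rewrite /dist1; lra.
have d0' := dist1_ge0 (y i0) (y i1) (y i2) a' b' c'.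
have rE : r = K * n%:R^-1 * n%:R^-1 by rewrite /r expr2 invfM; ring.
have ni0 : 0 < n%:R^-1 :> R by rewrite invr_gt0.
have Kn0 : 0 < K * n%:R^-1 by rewrite mulr_gt0.
have rKn : r <= K * n%:R^-1 by rewrite rE ler_piMr// ltW.
(* The nearest node is at distance at most 3 / n. A derivative above 6 K / n there stays above 3 K /
   n >= r at the point. Otherwise the linear terms are at most 3 * 6 r and the Taylor remainder at
   most 9 r, so that of the 28 r at the node at least r remains. *)
have [good|bad] := pselect (exists s j, 6 * (K * n%:R^-1) < `|E s [:: j] (y i0) (y i1) (y i2)|).
- right; case: good => s [j Hj]; exists s, j; rewrite red.
  have L := LK s j (y i0) (y i1) (y i2) a' b' c'.
  have L2 : K * dist1 (y i0) (y i1) (y i2) a' b' c' <= 3 * (K * n%:R^-1).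
    by rewrite mulrCA ler_pM2l.
  have := ler_dist_dist (E s [:: j] a' b' c') (E s [:: j] (y i0) (y i1) (y i2)).
  rewrite ler_norml => /andP[? ?]; lra.
- left; have [s Hs] := Hjs i0 i1 i2; exists s; rewrite red.
  set x := sh _ in Hs *.
  have G j : `|E s [:: j] (y i0) (y i1) (y i2)| <= 6 * (K * n%:R^-1).
    by rewrite leNgt; apply/negP => L; apply: bad; exists s, j.
  have T := TK s (y i0) (y i1) (y i2) a' b' c'.
  have T2 : K * dist1 (y i0) (y i1) (y i2) a' b' c' ^+ 2 <= 9 * r.
    have -> : 9 * r = K * (3 * n%:R^-1) ^+ 2 by rewrite rE; ring.
    by rewrite ler_pM2l// lerXn2r ?nnegrE// mulr_ge0// ltW.
  have P (g h : R) : `|g| <= 6 * (K * n%:R^-1) -> `|h| <= n%:R^-1 -> `|g * h| <= 6 * r.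
    by move=> Hg Hh; rewrite normrM rE mulrA ler_pM.
  have P0 := P _ _ (G o0) Hi0; have P1 := P _ _ (G o1) Hi1; have P2 := P _ _ (G o2) Hi2.
  move: T P0 P1 P2.
  set g0 := _ * (a' - _); set g1 := _ * (b' - _); set g2 := _ * (c' - _).
  set e1 := E s [::] a' b' c'; set e0 := E s [::] (y i0) (y i1) (y i2).
  move=> T P0 P1 P2.
  have := ler_dist_dist (e1 + x) (e0 + x).
  have : `|(e1 + x) - (e0 + x)| <= 27 * r.
    move: T P0 P1 P2; rewrite !ler_norml => /andP[? ?] /andP[? ?] /andP[? ?] /andP[? ?].
    apply/andP; split; lra.
  rewrite -/e0 in Hs; rewrite ler_norml => U V.
  move: V; rewrite ler_norml => /andP[? ?].
  have U' : `|(e1 + x) - (e0 + x)| <= 27 * r by rewrite ler_norml.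
  lra.
Qed.

End generic_shift.
End profiles.

(** * Partial derivatives *)

Section partial_calculus.
Context {R : realType} {n : nat}.
Implicit Types (f g : 'rV[R]_n -> R) (U : set 'rV[R]_n) (X v : 'rV[R]_n).

Lemma line_quotientE f X v :
  (fun h : R => h^-1 *: (((fun s : R => f (s *: v + X)) \o shift (0 : R)) (h *: (1 : R)) - f (0 *: v + X)))
  = (fun h : R => h^-1 *: ((f \o shift X) (h *: v) - f X)).
Proof.
by apply/funext => h /=; rewrite addr0 [h *: 1]mulr1 scale0r add0r.
Qed.

Lemma line_deriveE f X v : 'D_1 (fun s : R => f (s *: v + X)) 0 = 'D_v f X.
Proof. by rewrite /derive line_quotientE. Qed.

Lemma line_derivable f X v :
  derivable (fun s : R => f (s *: v + X)) 0 1 <-> derivable f X v.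
Proof. by rewrite /derivable line_quotientE. Qed.

Lemma is_derive_line f X v l :
  is_derive (0 : R) (1 : R) (fun s : R => f (s *: v + X)) l <-> is_derive X v f l.
Proof.
split=> -[D E]; apply: DeriveDef.
- exact/line_derivable.
- by rewrite -line_deriveE.
- exact/line_derivable.
- by rewrite line_deriveE.
Qed.

Lemma is_derive_line_at f X v (s l : R) : is_derive (s *: v + X) v f l ->
  is_derive s (1 : R) (fun s : R => f (s *: v + X)) l.
Proof.
move=> /is_derive_line D.
have -> : (fun s : R => f (s *: v + X)) =
  (fun h : R => f (h *: v + (s *: v + X))) \o (fun y => y - s).
  by apply/funext => y /=; rewrite addrA -scalerDl subrK.
have D2 : is_derive s (1 : R) (fun y => y - s) 1.
  by rewrite -[X in is_derive _ _ _ X]subr0; exact: is_deriveB.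
rewrite -[X in is_derive _ _ _ X]mulr1; apply: is_derive1_comp.
by rewrite subrr.
Qed.

Lemma near_eq_partial U f g i X : open U -> (forall Y, U Y -> f Y = g Y) -> U X ->
  partial i f X = partial i g X.
Proof.
move=> oU fg UX; apply: near_eq_derive.
by apply: filterS fg _; exact: open_nbhs_nbhs.
Qed.

Lemma near_eq_iter_partial U f g l X : open U -> (forall Y, U Y -> f Y = g Y) -> U X ->
  iter_partial l f X = iter_partial l g X.
Proof.
move=> oU fg; elim: l X => [|i l IH] X UX /=; first exact: fg.
exact: (near_eq_partial _ oU IH).
Qed.

Lemma iter_partial_cat l1 l2 f : iter_partial (l1 ++ l2) f = iter_partial l1 (iter_partial l2 f).
Proof. by rewrite /iter_partial foldr_cat. Qed.

Lemma smooth_iter_partial U f l : smooth_on U f -> smooth_on U (iter_partial l f).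
Proof. by move=> sf l' X UX; rewrite -!iter_partial_cat; exact: sf. Qed.

Lemma smooth_is_derive U f l i X : smooth_on U f -> U X ->
  is_derive X (delta_mx 0 i) (iter_partial l f) (iter_partial (i :: l) f X).
Proof. by move=> sf UX; have [_ D] := sf l X UX; apply: DeriveDef; [exact: D|]. Qed.

Lemma near_plane U X v w : open U -> U X ->
  exists2 d : R, 0 < d & forall x y, `|x| <= d -> `|y| <= d -> U (x *: v + (y *: w + X)).
Proof.
move=> oU UX.
have C : {for (0, 0), continuous (fun z : R * R => z.1 *: v + (z.2 *: w + X))}.
  apply: (@cvgD _ 'rV[R]_n).
    by apply: cvgZ; [exact: cvg_fst|exact: cvg_cst].
  apply: (@cvgD _ 'rV[R]_n); last exact: cvg_cst.
  by apply: cvgZ; [exact: cvg_snd|exact: cvg_cst].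
have : nbhs ((0 : R), (0 : R)) [set z | U (z.1 *: v + (z.2 *: w + X))].
  by apply: C; rewrite /= !scale0r !add0r; exact: open_nbhs_nbhs.
case=> [[A B] [/= /nbhs_ballP[a a0 aA] /nbhs_ballP[b b0 bB]] AB].
exists (Num.min a b / 2); first by rewrite divr_gt0// lt_min a0.
have m0 : 0 < Num.min a b by rewrite lt_min a0.
have [ma mb] : Num.min a b <= a /\ Num.min a b <= b by rewrite !ge_min !lexx orbT.
move=> x y xd yd; apply: (AB (x, y)); split => /=.
  by apply: aA; rewrite /ball /= sub0r normrN; lra.
by apply: bB; rewrite /ball /= sub0r normrN; lra.
Qed.

Lemma double_mvt U f i j X (d : R) : smooth_on U f -> 0 < d ->
  (forall x y, `|x| <= d -> `|y| <= d -> U (x *: delta_mx 0 i + (y *: delta_mx 0 j + X))) ->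
  exists x y, [/\ `|x| <= d, `|y| <= d &
    f (d *: delta_mx 0 i + (d *: delta_mx 0 j + X)) - f (d *: delta_mx 0 i + X)
    - f (d *: delta_mx 0 j + X) + f X
    = iter_partial [:: j; i] f (x *: delta_mx 0 i + (y *: delta_mx 0 j + X)) * d * d].
Proof.
move=> sf d0 UP; set v := delta_mx 0 i in UP *; set w := delta_mx 0 j in UP *.
pose g x := f (x *: v + (d *: w + X)) - f (x *: v + X).
pose dg x := iter_partial [:: i] f (x *: v + (d *: w + X)) - iter_partial [:: i] f (x *: v + X).
have dd : `|d| <= d by rewrite gtr0_norm.
have z0 : `|0 : R| <= d by rewrite normr0 ltW.
have [x /andP[x0 xd] Ex] := @mvt R g dg 0 d (ltW d0) (ltac:(
  move=> x /andP[x0 xd]; apply: is_deriveB; apply: is_derive_line_at; apply: (smooth_is_derive [::] i sf);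
  [by apply: UP => //; rewrite ger0_norm|by have := UP x 0; rewrite scale0r add0r; apply => //; rewrite ger0_norm])).
have xx : `|x| <= d by rewrite ger0_norm.
pose G y := iter_partial [:: i] f (y *: w + (x *: v + X)).
have [y /andP[y0 yd] Ey] := @mvt R G (fun y => iter_partial [:: j; i] f (y *: w + (x *: v + X))) 0 d (ltW d0) (ltac:(
  move=> y /andP[y0 yd]; apply: is_derive_line_at; apply: (smooth_is_derive [:: i] j sf);
  by rewrite addrCA; apply: UP => //; rewrite ger0_norm)).
exists x, y; split => //; first by rewrite ger0_norm.
rewrite [x *: v + (_ + _)]addrCA; move: Ey; rewrite subr0 => <-; rewrite /G.
move: Ex; rewrite subr0 /dg /g !scale0r !add0r [x *: v + (_ + _)]addrCA => <-.
ring.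
Qed.

(** The second difference of f over a square of side d is d^2 times either mixed derivative, each at
    some point of the square ([double_mvt] in both orders). On a square where both are within e / 2
    of their values at X, these values differ by at most e. *)
Lemma schwarz U f i j X : open U -> smooth_on U f -> U X ->
  iter_partial [:: i; j] f X = iter_partial [:: j; i] f X.
Proof.
move=> oU sf UX; apply/eqP; rewrite -subr_eq0 -normr_le0; apply/ler_addgt0Pr => e e0.
rewrite add0r.
pose V := U `&` [set Y | (`|iter_partial [:: i; j] f X - iter_partial [:: i; j] f Y| <= e / 2) /\
                        (`|iter_partial [:: j; i] f X - iter_partial [:: j; i] f Y| <= e / 2)].
have e20 : 0 < e / 2 by rewrite divr_gt0.
have nV : nbhs X V.
  apply: filterI; first exact: open_nbhs_nbhs.
  apply: filterI.
    by have [/cvgrPdist_le C _] := sf [:: i; j] X UX; exact: C.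
  by have [/cvgrPdist_le C _] := sf [:: j; i] X UX; exact: C.
have oV : open (V°) by exact: open_interior.
have [d d0 dV] := near_plane (delta_mx 0 i) (delta_mx 0 j) oV nV.
have dU x y : `|x| <= d -> `|y| <= d -> U (x *: delta_mx 0 i + (y *: delta_mx 0 j + X)).
  by move=> xd yd; have /interior_subset [] := dV x y xd yd.
have dU' x y : `|x| <= d -> `|y| <= d -> U (x *: delta_mx 0 j + (y *: delta_mx 0 i + X)).
  by move=> xd yd; rewrite addrCA; exact: dU.
have [x [y [xd yd E1]]] := double_mvt sf d0 dU.
have [x' [y' [xd' yd' E2]]] := double_mvt sf d0 dU'.
have /interior_subset [_ [_ A1]] := dV x y xd yd.
have /interior_subset [_ [A2 _]] := dV y' x' yd' xd'.
rewrite [x' *: _ + (_ + _)]addrCA in E2.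
have E : iter_partial [:: j; i] f (x *: delta_mx 0 i + (y *: delta_mx 0 j + X)) =
    iter_partial [:: i; j] f (y' *: delta_mx 0 i + (x' *: delta_mx 0 j + X)).
  apply: (mulIf (lt0r_neq0 d0)); apply: (mulIf (lt0r_neq0 d0)).
  refine (etrans (esym E1) (etrans _ E2)); congr (_ + _); rewrite addrAC; congr (_ - _ - _); congr (f _); exact: addrCA.
rewrite E in A1; move: A1 A2; clear E E1 E2.
set C := iter_partial [:: i; j] f (_ + _); set B := iter_partial [:: j; i] f X.
set A := iter_partial [:: i; j] f X; move: A B C => A B C.
rewrite !ler_norml => /andP[? ?] /andP[? ?]; apply/andP; split; lra.
Qed.

(** The derivatives occurring in Maxwell's equations act first, below the list l; this brings them
    to its head. *)
Lemma iter_partial_comm U f i l X : open U -> smooth_on U f -> U X ->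
  iter_partial l (partial i f) X = iter_partial (i :: l) f X.
Proof.
move=> oU sf; elim: l X => [//|j l IH] X UX.
transitivity (iter_partial [:: j; i] (iter_partial l f) X).
  exact: (near_eq_partial j oU IH UX).
exact: (schwarz j i oU (smooth_iter_partial l sf) UX).
Qed.

End partial_calculus.

(** * Maxwell's equations on a Kasner spacetime *)

Definition q0 : 'I_4 := @Ordinal 4 0 isT.
Definition q1 : 'I_4 := @Ordinal 4 1 isT.
Definition q2 : 'I_4 := @Ordinal 4 2 isT.
Definition q3 : 'I_4 := @Ordinal 4 3 isT.

Lemma spatial_o0 : spatial o0 = q1. Proof. exact: val_inj. Qed.
Lemma spatial_o1 : spatial o1 = q2. Proof. exact: val_inj. Qed.
Lemma spatial_o2 : spatial o2 = q3. Proof. exact: val_inj. Qed.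

Lemma ord4_zero : 0%R = q0 :> 'I_4. Proof. exact: val_inj. Qed.

Lemma ord4_ind (P : 'I_4 -> Prop) : P q0 -> P q1 -> P q2 -> P q3 -> forall a, P a.
Proof.
move=> P0 P1 P2 P3 [[|[|[|[|//]]]] lti].
- by have -> : Ordinal lti = q0 by exact: val_inj.
- by have -> : Ordinal lti = q1 by exact: val_inj.
- by have -> : Ordinal lti = q2 by exact: val_inj.
- by have -> : Ordinal lti = q3 by exact: val_inj.
Qed.

Lemma sum4 (V : nmodType) (f : 'I_4 -> V) : \sum_i f i = f q0 + f q1 + f q2 + f q3.
Proof.
rewrite !big_ord_recr big_ord0 /= add0r.
by congr (f _ + f _ + f _ + f _); exact: val_inj.
Qed.

Lemma sum3 (V : nmodType) (f : 'I_3 -> V) : \sum_i f i = f o0 + f o1 + f o2.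
Proof.
rewrite !big_ord_recr big_ord0 /= add0r.
by congr (f _ + f _ + f _); exact: val_inj.
Qed.

Section kasner_metric.
Context {R : realType}.
Variables p1 p2 p3 : R.
Implicit Types (X : 'rV[R]_4) (t : R).

Definition exponent (i : 'I_3) : R := nth 0 [:: p1; p2; p3] i.

Definition metric_diag (t : R) (a : 'I_4) : R :=
  nth 0 [:: -1; t `^ (2 * p1); t `^ (2 * p2); t `^ (2 * p3)] a.

Definition metric_diag' (t : R) (a : 'I_4) : R :=
  nth 0 [:: 0; 2 * p1 * t `^ (2 * p1 - 1); 2 * p2 * t `^ (2 * p2 - 1); 2 * p3 * t `^ (2 * p3 - 1)] a.

Lemma kasnerE X a b : kasner p1 p2 p3 X a b = metric_diag (time X) a *+ (a == b).
Proof. by rewrite /kasner !mxE. Qed.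

Lemma metric_diag_neq0 t a : 0 < t -> metric_diag t a != 0.
Proof.
move=> t0; move: a; apply: ord4_ind; rewrite /metric_diag /= ?oppr_eq0 ?oner_neq0//;
  by rewrite gt_eqF// powR_gt0.
Qed.

Lemma invmx_kasner X a b : spacetime X ->
  invmx (kasner p1 p2 p3 X) a b = (metric_diag (time X) a)^-1 *+ (a == b).
Proof.
move=> X0; pose N : 'M[R]_4 := diag_mx (\row_m (metric_diag (time X) m)^-1).
have KN : kasner p1 p2 p3 X *m N = 1%:M.
  apply/matrixP => i j; rewrite /N /kasner mul_mx_diag !mxE.
  have [<-|] := eqVneq i j; last by rewrite mul0r.
  by rewrite -/(metric_diag (time X) i) mulfV// metric_diag_neq0.
have U : kasner p1 p2 p3 X \in unitmx by case: (mulmx1_unit KN).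
have -> : invmx (kasner p1 p2 p3 X) = N by rewrite -[RHS](mulKmx U) KN mulmx1.
by rewrite /N !mxE.
Qed.

Lemma is_derive_metric_diag t a : 0 < t ->
  is_derive t (1 : R) (fun t => metric_diag t a) (metric_diag' t a).
Proof.
move=> t0; move: a; apply: ord4_ind; rewrite /metric_diag /metric_diag' /=;
  by [exact: is_derive_cst|exact: is_derive1_powR].
Qed.

Lemma time_line X m (s : R) : time (s *: delta_mx 0 m + X) = time X + s *+ (m == q0).
Proof.
rewrite /time !mxE eqxx /= addrC ord4_zero [q0 == m]eq_sym; case: eqP => _ //=.
  by rewrite mulr1 mulr1n.
by rewrite mulr0 mulr0n.
Qed.

Lemma partial_kasner X m a b : spacetime X ->
  partial m (component (kasner p1 p2 p3) a b) X = metric_diag' (time X) a *+ ((a == b) && (m == q0)).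
Proof.
move=> X0; apply: derive_val; apply/is_derive_line; rewrite /component.
rewrite (_ : (fun s : R => _) = fun s : R => metric_diag (time X + s *+ (m == q0)) a *+ (a == b)); last first.
  by apply/funext => s; rewrite kasnerE time_line.
have [_|_] := eqVneq a b; last first.
  rewrite (_ : (fun s : R => _) = cst 0); first exact: is_derive_cst.
  by apply/funext => s; rewrite mulr0n.
have [_|_] := eqVneq m q0; last first.
  rewrite (_ : (fun s : R => _) = cst (metric_diag (time X) a)); first exact: is_derive_cst.
  by apply/funext => s; rewrite mulr0n addr0.
rewrite (_ : (fun s : R => _) = (fun t => metric_diag t a) \o (fun s : R => time X + s)); last first.
  by apply/funext.
have D2 : is_derive (0 : R) (1 : R) (fun s : R => time X + s) 1.
  rewrite -[X in is_derive _ _ _ X]add0r; exact: is_deriveD.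
rewrite -[X in is_derive _ _ _ X]mulr1; apply: is_derive1_comp.
by rewrite addr0; exact: is_derive_metric_diag.
Qed.

Definition kasner_christoffel t (l m n : 'I_4) : R :=
  2^-1 * ((metric_diag t l)^-1 * (metric_diag' t l *+ ((l == n) && (m == q0))
    + metric_diag' t l *+ ((l == m) && (n == q0)) - metric_diag' t m *+ ((m == n) && (l == q0)))).

Lemma christoffelE X l m n : spacetime X ->
  christoffel (kasner p1 p2 p3) X l m n = kasner_christoffel (time X) l m n.
Proof.
move=> X0; rewrite /christoffel (bigD1 l)//= big1 ?addr0; last first.
  by move=> s sl; rewrite invmx_kasner// eq_sym (negbTE sl) mulr0n mul0r.
by rewrite invmx_kasner// eqxx mulr1n !partial_kasner.
Qed.

(** Expressing the derivative through the metric leaves t and the three powers t^(2 p_i) as the only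
    atoms for [field]. *)
Lemma metric_diag'E t a : 0 < t ->
  metric_diag' t a = 2 * nth 0 [:: 0; p1; p2; p3] a * metric_diag t a / t.
Proof.
move=> t0; have tn0 : t != 0 by rewrite gt_eqF.
have E q : t `^ (q - 1) = t `^ q / t by rewrite powRB ?tn0 ?implybT// powRr1// ltW.
by move: a; apply: ord4_ind; rewrite /metric_diag' /metric_diag /= ?mulr0 ?mul0r// E; field.
Qed.

End kasner_metric.

Lemma eq_opp0 (R : realType) (x : R) : x = - x -> x = 0.
Proof. by move=> ?; lra. Qed.

(** * The evolution equations in components *)

Section maxwell.
Context {R : realType}.
Variables p1 p2 p3 : R.
Hypothesis psum : p1 + p2 + p3 = 1.
Variable F : 'rV[R]_4 -> 'M[R]_4.
Hypothesis mF : maxwell_solution (kasner p1 p2 p3) F.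
Local Notation p := (exponent p1 p2 p3).

Lemma open_spacetime : open (@spacetime R).
Proof.
rewrite (_ : spacetime = (fun X : 'rV[R]_4 => X 0 0) @^-1` [set t | 0 < t])//.
by apply: open_comp => [X _|]; [exact: coord_continuous|exact: open_gt].
Qed.

Lemma field_antisym X a b : spacetime X -> F X a b = - F X b a.
Proof.
case: mF => H _ _ _ _ X0; have := congr1 (fun M : 'M[R]_4 => M b a) (H X X0).
by rewrite !mxE.
Qed.

Lemma smooth_field a b : smooth_on (@spacetime R) (component F a b).
Proof. by case: mF. Qed.

Lemma partial_antisym X m a b : spacetime X ->
  partial m (component F a b) X = - partial m (component F b a) X.
Proof.
move=> X0; have -> : partial m (component F a b) X = partial m (- component F b a) X.
  apply: (near_eq_partial m open_spacetime _ X0) => Y Y0; exact: field_antisym.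
rewrite /partial deriveN//; have [_] := smooth_field b a [::] X0; exact.
Qed.

Lemma divergenceE X b : spacetime X -> divergence (kasner p1 p2 p3) F X b =
  \sum_a (metric_diag p1 p2 p3 (time X) a)^-1 * nabla (kasner p1 p2 p3) F X a a b.
Proof.
move=> X0; apply: eq_bigr => a _; rewrite (bigD1 a)//= big1 ?addr0; last first.
  by move=> m ma; rewrite invmx_kasner// eq_sym (negbTE ma) mulr0n mul0r.
by rewrite invmx_kasner// eqxx mulr1n.
Qed.

(** The i-th component of div F = 0, solved for the time derivative. The trace of the Christoffel
    symbols is (p_1 + p_2 + p_3) / t = 1 / t, whence the coefficient (2 p_i - 1) / t. *)
Lemma electric_evolution X i : spacetime X ->
  let t := time X in let j := succ3 i in let k := succ3 j in
  partial q0 (component F q0 (spatial i)) X =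
    (2 * p i - 1) / t * F X q0 (spatial i)
    - t `^ (- (2 * p j)) * partial (spatial j) (component F (spatial i) (spatial j)) X
    + t `^ (- (2 * p k)) * partial (spatial k) (component F (spatial k) (spatial i)) X.
Proof.
move=> X0 t j k.
have t0 : 0 < t by exact: X0.
have tn0 : t != 0 by rewrite gt_eqF.
have [_ _ _ /(_ X (spatial i) X0) + _] := mF.
have := metric_diag_neq0 p1 p2 p3 q1 t0; have := metric_diag_neq0 p1 p2 p3 q2 t0.
have := metric_diag_neq0 p1 p2 p3 q3 t0.
rewrite (partial_antisym (spatial j) (spatial i) (spatial j) X0) divergenceE// /nabla !sum4 !christoffelE// /kasner_christoffel !metric_diag'E// -/t.
rewrite !powRN.
have F0 a : F X a a = 0 by apply: eq_opp0; exact: field_antisym.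
have D0 m a : partial m (component F a a) X = 0 by apply: eq_opp0; exact: partial_antisym.
rewrite /k /j {k j}; move: i; apply: ord3_ind; rewrite /succ3 /= ?spatial_o0 ?spatial_o1 ?spatial_o2.
all: rewrite !mulr0n !mulr1n ?(F0, D0, mulr0, mul0r, addr0, add0r, subr0, sub0r, oppr0, invr0).
all: rewrite /metric_diag /exponent /=.
all: rewrite ?(field_antisym q1 q0 X0) ?(field_antisym q2 q0 X0) ?(field_antisym q3 q0 X0).
(* p_3 is eliminated from the coefficients only after the powers of t have been generalized, so that
   the powers remain atoms. *)
all: have p3E : p3 = 1 - p1 - p2 by rewrite -psum; ring.
all: move: (t `^ (2 * p1)) (t `^ (2 * p2)) (t `^ (2 * p3)) => m1 m2 m3; rewrite p3E {p3E}.
all: match goal with |- context [partial q0 (component ?G q0 ?a) ?Y] =>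
  move: (partial q0 (component G q0 a) Y) (G Y q0 a) => P0 f end.
all: repeat match goal with |- context [partial ?m (component ?G ?a ?b) ?Y] =>
  move: (partial m (component G a b) Y) => ? end.
all: move=> m30 m20 m10 H; apply: subr0_eq; transitivity (- (0 : R)); last exact: oppr0.
all: by rewrite -[X in _ = - X]H; field; rewrite tn0 m30 m20 m10.
Qed.

Lemma magnetic_evolution X j k : spacetime X ->
  partial q0 (component F (spatial j) (spatial k)) X =
    partial (spatial j) (component F q0 (spatial k)) X - partial (spatial k) (component F q0 (spatial j)) X.
Proof.
move=> X0; have [_ _ _ _ /(_ X q0 (spatial j) (spatial k) X0)] := mF.
rewrite /ext_deriv (partial_antisym (spatial j) (spatial k) q0 X0).
by move: (partial _ _ _) (partial _ _ _) (partial _ _ _) => x y z ?; lra.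
Qed.

End maxwell.

(** * From Maxwell's equations to the reduced system *)

Section fields.
Context {R : realType}.
Local Notation point := (R * R * R * R)%type.
Implicit Types (Y : 'rV[R]_4) (X : point).

Definition to_event X : 'rV[R]_4 := event X.1.1.1 (vec3 X.1.1.2 X.1.2 X.2).

Lemma to_event_entry X a : to_event X 0 a = nth 0 [:: X.1.1.1; X.1.1.2; X.1.2; X.2] a.
Proof.
have S (i : 'I_3) : to_event X 0 (spatial i) = vec3 X.1.1.2 X.1.2 X.2 0 i by exact: (row_mxEr (m := 1) (n1 := 1) X.1.1.1%:M (vec3 X.1.1.2 X.1.2 X.2) 0 i).
have T : to_event X 0 (lshift 3 (0 : 'I_1)) = X.1.1.1.
  etransitivity; first exact: (row_mxEl (m := 1) (n2 := 3) X.1.1.1%:M (vec3 X.1.1.2 X.1.2 X.2) 0 (0 : 'I_1)).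
  by rewrite mxE.
move: a; apply: ord4_ind.
- by rewrite -T; congr (to_event X 0 _); exact: val_inj.
- by have := S o0; rewrite spatial_o0 => ->; rewrite mxE.
- by have := S o1; rewrite spatial_o1 => ->; rewrite mxE.
- by have := S o2; rewrite spatial_o2 => ->; rewrite mxE.
Qed.

Lemma to_eventE X : to_event X = X.1.1.1 *: delta_mx 0 q0 + X.1.1.2 *: delta_mx 0 q1
  + X.1.2 *: delta_mx 0 q2 + X.2 *: delta_mx 0 q3.
Proof.
apply/rowP => a; rewrite to_event_entry !mxE; move: a; apply: ord4_ind; rewrite -!val_eqE /=;
  by rewrite !mulr1 !mulr0 ?addr0 ?add0r.
Qed.

Lemma time_to_event X : time (to_event X) = X.1.1.1.
Proof.
by rewrite /time to_event_entry.
Qed.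

Lemma to_event_shift j h X : to_event (shift_point j h X) = h *: delta_mx 0 (spatial j) + to_event X.
Proof.
rewrite !to_eventE; move: j; apply: ord3_ind; rewrite /shift_point /= ?spatial_o0 ?spatial_o1 ?spatial_o2
  !mulr0n !mulr1n !addr0 scalerDl; apply/rowP => a; rewrite !mxE; ring.
Qed.

Lemma to_event_time t h a b c : to_event (t + h, a, b, c) = h *: delta_mx 0 q0 + to_event (t, a, b, c).
Proof. by rewrite !to_eventE /= scalerDl; apply/rowP => i; rewrite !mxE; ring. Qed.

Lemma continuous_to_event : continuous to_event.
Proof.
move=> X; rewrite (_ : to_event = fun X => X.1.1.1 *: delta_mx 0 q0 + X.1.1.2 *: delta_mx 0 q1
  + X.1.2 *: delta_mx 0 q2 + X.2 *: delta_mx 0 q3); last by apply/funext => Y; exact: to_eventE.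
have c2 : {for X, continuous (fun X : point => X.2)} by exact: cvg_snd.
have c1 : {for X, continuous (fun X : point => X.1)} by exact: cvg_fst.
have c12 : {for X, continuous (fun X : point => X.1.2)}.
  by apply: (@continuous_comp _ _ _ (fun X : point => X.1) snd); [exact: c1|exact: cvg_snd].
have c11 : {for X, continuous (fun X : point => X.1.1)}.
  by apply: (@continuous_comp _ _ _ (fun X : point => X.1) fst); [exact: c1|exact: cvg_fst].
have c112 : {for X, continuous (fun X : point => X.1.1.2)}.
  by apply: (@continuous_comp _ _ _ (fun X : point => X.1.1) snd); [exact: c11|exact: cvg_snd].
have c111 : {for X, continuous (fun X : point => X.1.1.1)}.
  by apply: (@continuous_comp _ _ _ (fun X : point => X.1.1) fst); [exact: c11|exact: cvg_fst].
have cz (k : point -> R) (v : 'rV[R]_4) : {for X, continuous k} -> {for X, continuous (fun X => k X *: v)}.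
  by move=> ck; apply: cvgZ; [exact: ck|exact: cvg_cst].
apply: (@cvgD _ 'rV[R]_4); last exact: cz c2.
apply: (@cvgD _ 'rV[R]_4); last exact: cz c12.
by apply: (@cvgD _ 'rV[R]_4); [exact: cz c111|exact: cz c112].
Qed.

Lemma time_spatial_line j (s : R) Y : time (s *: delta_mx 0 (spatial j) + Y) = time Y.
Proof.
by rewrite time_line; case: eqP => [/(congr1 val)//|_]; rewrite mulr0n addr0.
Qed.

(** Functions of t are constant along spatial lines. Three summands are what the electric equation
    has. *)
Lemma iter_partial_time_combination (c1 c2 c3 : R -> R) (f1 f2 f3 : 'rV[R]_4 -> R) l Y :
  smooth_on spacetime f1 -> smooth_on spacetime f2 -> smooth_on spacetime f3 -> spacetime Y ->
  iter_partial (map spatial l) (fun Y => c1 (time Y) * f1 Y + c2 (time Y) * f2 Y + c3 (time Y) * f3 Y) Y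
  = c1 (time Y) * iter_partial (map spatial l) f1 Y + c2 (time Y) * iter_partial (map spatial l) f2 Y
    + c3 (time Y) * iter_partial (map spatial l) f3 Y.
Proof.
move=> s1 s2 s3; elim: l Y => [//|j l IH] Y Y0.
rewrite [LHS](near_eq_partial (spatial j) open_spacetime IH Y0).
apply: derive_val; apply/is_derive_line.
rewrite (_ : (fun s : R => _) = fun s : R =>
  c1 (time Y) * iter_partial (map spatial l) f1 (s *: delta_mx 0 (spatial j) + Y) +
  c2 (time Y) * iter_partial (map spatial l) f2 (s *: delta_mx 0 (spatial j) + Y) +
  c3 (time Y) * iter_partial (map spatial l) f3 (s *: delta_mx 0 (spatial j) + Y)); last first.
  by apply/funext => s; rewrite time_spatial_line.
have D f : smooth_on spacetime f -> is_derive (0 : R) (1 : R)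
    (fun s : R => iter_partial (map spatial l) f (s *: delta_mx 0 (spatial j) + Y))
    (iter_partial (map spatial (j :: l)) f Y).
  by move=> sf; apply/is_derive_line; exact: (smooth_is_derive (map spatial l) (spatial j) sf Y0).
exact: is_deriveD (is_deriveD (is_deriveZ (c1 (time Y)) (D _ s1)) (is_deriveZ (c2 (time Y)) (D _ s2)))
  (is_deriveZ (c3 (time Y)) (D _ s3)).
Qed.

Lemma iter_partial_periodic (f : 'rV[R]_4 -> R) i l Y :
  (forall Y, spacetime Y -> f (Y + delta_mx 0 (spatial i)) = f Y) -> spacetime Y ->
  iter_partial l f (Y + delta_mx 0 (spatial i)) = iter_partial l f Y.
Proof.
move=> per; elim: l Y => [|j l IH] Y Y0 /=; first exact: per.
transitivity (partial j (fun Y => iter_partial l f (Y + delta_mx 0 (spatial i))) Y).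
  refine (etrans (esym (line_deriveE _ _ _)) (etrans _ (line_deriveE _ _ _))).
  suff -> : (fun s : R => iter_partial l f (s *: delta_mx 0 j + (Y + delta_mx 0 (spatial i)))) =
    (fun s : R => iter_partial l f (s *: delta_mx 0 j + Y + delta_mx 0 (spatial i))) by [].
  by apply/funext => s; rewrite addrA.
exact: (near_eq_partial j open_spacetime IH Y0).
Qed.

Variables p1 p2 p3 : R.
Hypothesis psum : p1 + p2 + p3 = 1.
Local Notation p := (exponent p1 p2 p3).

Definition base_component (F : 'rV[R]_4 -> 'M[R]_4) (s : bool) (i : 'I_3) : 'rV[R]_4 -> R :=
  if s then component F q0 (spatial i)
  else component F (spatial (succ3 i)) (spatial (succ3 (succ3 i))).

(** The factor t^(1 - 2 p_i) absorbs the term (2 p_i - 1) / t * F_(ti). Since the volume density is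
    t, the resulting e_i is, up to sign, the density t F^(ti). *)
Definition flux_weight (s : bool) (i : 'I_3) : R := if s then 1 - 2 * p i else 0.

Definition flux (F : 'rV[R]_4 -> 'M[R]_4) s i l X : R :=
  X.1.1.1 `^ flux_weight s i * iter_partial (map spatial l) (base_component F s i) (to_event X).

Lemma exponent_sum3 i : p i + p (succ3 i) + p (succ3 (succ3 i)) = 1.
Proof. by move: i; apply: ord3_ind; rewrite /exponent /= -psum; ring. Qed.

Lemma flux_reduced F : maxwell_solution (kasner p1 p2 p3) F -> reduced p (flux F).
Proof.
move=> mF.
have sb s i : smooth_on spacetime (base_component F s i) by case: s; exact: (smooth_field mF).
have ev0 X : pos_points X -> spacetime (to_event X) by rewrite /spacetime /= time_to_event.
split.
- move=> s i l X X0; apply: cvgM.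
    exact: (cont_time (@cont_powR R (flux_weight s i))).
  apply: (@continuous_comp _ _ _ to_event); first exact: continuous_to_event.
  by have [C _] := sb s i (map spatial l) _ (ev0 X X0).
- move=> s i l j X X0; rewrite /flux.
  rewrite (_ : (fun h : R => _) = fun h : R => X.1.1.1 `^ flux_weight s i *
    iter_partial (map spatial l) (base_component F s i) (h *: delta_mx 0 (spatial j) + to_event X)); last first.
    by apply/funext => h; rewrite to_event_shift.
  apply: (is_deriveZ (X.1.1.1 `^ flux_weight s i)); apply/is_derive_line.
  exact: (smooth_is_derive _ _ (sb s i) (ev0 X X0)).
- move=> s i l j X X0; rewrite /flux to_event_shift scale1r addrC iter_partial_periodic//; last exact: ev0.
  move=> Y Y0; have [_ per _ _ _] := mF.
  by case: s; rewrite /base_component /component per.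
- move=> s i l t a b c t0.
  have X0 := ev0 (t, a, b, c) t0; set Y := to_event (t, a, b, c) in X0.
  have tY : time Y = t by rewrite /Y time_to_event.
  have Dt : is_derive (t : R) (1 : R) (fun t => iter_partial (map spatial l) (base_component F s i) (to_event (t, a, b, c)))
      (iter_partial (map spatial l) (partial q0 (base_component F s i)) Y).
    rewrite (iter_partial_comm _ _ open_spacetime (sb s i) X0).
    apply: is_derive_shift0.
    rewrite (_ : (fun h : R => _) = fun h : R =>
      iter_partial (map spatial l) (base_component F s i) (h *: delta_mx 0 q0 + Y)); last first.
      by apply/funext => h; rewrite to_event_time.
    by apply/is_derive_line; exact: (smooth_is_derive (map spatial l) q0 (sb s i) X0).
  have D := is_deriveM (is_derive1_powR (flux_weight s i) t0) Dt.
  apply: is_derive_eq D _; rewrite /GRing.scale /=.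
  have tn0 : t != 0 by rewrite gt_eqF.
  have PB x : t `^ (x - 1) = t `^ x / t by rewrite powRB ?tn0 ?implybT// powRr1// ltW.
  have comm j G : smooth_on spacetime G -> iter_partial (map spatial l) (partial (spatial j) G) Y =
      iter_partial (map spatial (j :: l)) G Y.
    by move=> sG; rewrite (iter_partial_comm _ _ open_spacetime sG X0).
  have sp m G : smooth_on spacetime G -> smooth_on spacetime (partial m G).
    by move=> sG; exact: (smooth_iter_partial [:: m] sG).
  case: s {Dt} => /=.
  + pose G1 := base_component F true i.
    pose G2 := base_component F false (succ3 (succ3 i)); pose G3 := base_component F false (succ3 i).
    have E Z : spacetime Z -> partial q0 (component F q0 (spatial i)) Z =
      (2 * p i - 1) / time Z * G1 Z + - (time Z `^ (- (2 * p (succ3 i)))) * partial (spatial (succ3 i)) G2 Z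
      + time Z `^ (- (2 * p (succ3 (succ3 i)))) * partial (spatial (succ3 (succ3 i))) G3 Z.
      by move=> Z0; rewrite (electric_evolution psum mF i Z0) /G1 /G2 /G3 /base_component succ3K mulNr.
    rewrite (near_eq_iter_partial _ open_spacetime E X0).
    rewrite (@iter_partial_time_combination (fun t => (2 * p i - 1) / t) (fun t => - (t `^ (- (2 * p (succ3 i)))))
       (fun t => t `^ (- (2 * p (succ3 (succ3 i))))))//; [|exact: (sb true)|by apply: sp; exact: (sb false)|by apply: sp; exact: (sb false)].
    rewrite !comm; [|exact: (sb false)|exact: (sb false)].
    rewrite tY /curl_weighted /flux /flux_weight /= -/Y -/G1 -/G2 -/G3 !powRr0 !mul1r.
    have S := exponent_sum3 i.
    (* Here 1 - 2 p_i - 2 p_j = 2 p_k - 1 for distinct i, j, k, again from the sum of the exponents;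
       this is how the weights w arise. *)
    have E1 : t `^ (2 * p (succ3 (succ3 i)) - 1) = t `^ (1 - 2 * p i) * t `^ (- (2 * p (succ3 i))).
      by rewrite -powRD ?tn0 ?implybT//; congr (_ `^ _); lra.
    have E2 : t `^ (2 * p (succ3 i) - 1) = t `^ (1 - 2 * p i) * t `^ (- (2 * p (succ3 (succ3 i)))).
      by rewrite -powRD ?tn0 ?implybT//; congr (_ `^ _); lra.
    rewrite E1 E2 PB.
    move: (t `^ (1 - 2 * p i)) (t `^ (- (2 * p (succ3 i)))) (t `^ (- (2 * p (succ3 (succ3 i))))).
    move: (iter_partial _ G1 Y) (partial _ _ Y) (partial _ _ Y) (p i) => *; field; exact: tn0.
  + pose G2 := base_component F true (succ3 (succ3 i)); pose G3 := base_component F true (succ3 i).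
    (* The summand with coefficient 0 pads the equation to the form of
       [iter_partial_time_combination]. *)
    have E Z : spacetime Z -> partial q0 (component F (spatial (succ3 i)) (spatial (succ3 (succ3 i)))) Z =
      1 * partial (spatial (succ3 i)) G2 Z + (- 1) * partial (spatial (succ3 (succ3 i))) G3 Z + 0 * G2 Z.
      by move=> Z0; rewrite (magnetic_evolution mF _ _ Z0) mul1r mulN1r mul0r addr0.
    rewrite (near_eq_iter_partial _ open_spacetime E X0).
    rewrite (@iter_partial_time_combination (fun=> 1) (fun=> -1) (fun=> 0))//;
      [|by apply: sp; exact: (sb true)|by apply: sp; exact: (sb true)|exact: (sb true)].
    rewrite !comm; [|exact: (sb true)|exact: (sb true)].
    rewrite /curl_weighted /flux /flux_weight /= -/Y -/G2 -/G3 !powRr0 expr0 !mul0r !mul1r addr0 mulr0 addr0.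
    have E1 x : t `^ (2 * x - 1) * t `^ (1 - 2 * x) = 1.
      by rewrite -powRD ?tn0 ?implybT// addrA subrK subrr powRr0.
    by rewrite !mulrA !E1 !mul1r mulN1r.
Qed.

End fields.

(** * Timelike geodesics *)

Section geodesics.
Context {R : realType}.
Variables p1 p2 p3 : R.
Local Notation p := (exponent p1 p2 p3).
Local Notation g := (kasner p1 p2 p3).
Implicit Types (c : 'I_3 -> R) (t : R) (gam : R -> 'rV[R]_4) (I : set R).

(* The unit vector with conserved momenta [c] has t-component [- lapse c t], and dx^i / dt = - drift. *)
Definition lapse c t : R := Num.sqrt (1 + \sum_i c i ^+ 2 * t `^ (- (2 * p i))).

Definition drift c (i : 'I_3) t : R := c i * t `^ (- (2 * p i)) / lapse c t.

Lemma lapse_arg_ge1 c t : 1 <= 1 + \sum_i c i ^+ 2 * t `^ (- (2 * p i)).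
Proof. by rewrite lerDl; apply: sumr_ge0 => i _; rewrite mulr_ge0 ?sqr_ge0 ?powR_ge0. Qed.

Lemma lapse_sqr c t : lapse c t ^+ 2 = 1 + \sum_i c i ^+ 2 * t `^ (- (2 * p i)).
Proof. by rewrite sqr_sqrtr// (le_trans ler01)// lapse_arg_ge1. Qed.

Lemma lapse_gt0 c t : 0 < lapse c t.
Proof. by rewrite sqrtr_gt0 (lt_le_trans ltr01)// lapse_arg_ge1. Qed.

(** The lapse is at least |c_i| t^(- p_i). The bound is independent of the momenta, and integrable
    at 0 when p_i < 1. *)
Lemma drift_le c i t : 0 < t -> `|drift c i t| <= t `^ (- p i).
Proof.
move=> t0; have N0 := lapse_gt0 c t.
rewrite /drift normrM normrM normfV (gtr0_norm N0) (ger0_norm (powR_ge0 _ _)).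
rewrite ler_pdivrMr//.
have E : t `^ (- (2 * p i)) = t `^ (- p i) * t `^ (- p i).
  by rewrite -powRD ?(gt_eqF t0) ?implybT//; congr (_ `^ _); ring.
rewrite E mulrA mulrC ler_wpM2l ?powR_ge0//.
rewrite -(ler_sqr (x := _ * _)) ?nnegrE ?mulr_ge0 ?powR_ge0// ?(ltW N0)//.
rewrite lapse_sqr exprMn real_normK ?num_real// [(t `^ _) ^+ 2]expr2 -E (bigD1 i)//=.
have := powR_ge0 t (- (2 * p i)); have := sqr_ge0 (c i).
have : 0 <= \sum_(j < 3 | j != i) c j ^+ 2 * t `^ (- (2 * p j)).
  by apply: sumr_ge0 => j _; rewrite mulr_ge0 ?sqr_ge0 ?powR_ge0.
lra.
Qed.

Lemma is_derive_powRN (q t : R) : 0 < t ->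
  is_derive t (1 : R) (fun t => t `^ (- q)) (- (q * t `^ (- q) / t)).
Proof.
move=> t0; have tn0 : t != 0 by rewrite gt_eqF.
have D := is_derive1_powR (- q) t0; apply: is_derive_eq D _.
by rewrite powRB ?tn0 ?implybT// powRr1 ?ltW// mulNr mulrA.
Qed.

Lemma is_derive_lapse c t : 0 < t ->
  is_derive t (1 : R) (lapse c) (- (\sum_i p i * c i ^+ 2 * t `^ (- (2 * p i)) / t) / lapse c t).
Proof.
move=> t0.
have D i : is_derive t (1 : R) (fun t => c i ^+ 2 * t `^ (- (2 * p i)))
    (c i ^+ 2 * - (2 * p i * t `^ (- (2 * p i)) / t)).
  exact: (@is_deriveZ _ _ _ (fun t => t `^ (- (2 * p i))) (c i ^+ 2) _ _ _ (is_derive_powRN (2 * p i) t0)).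
have DS : is_derive t (1 : R) (fun t => 1 + \sum_i c i ^+ 2 * t `^ (- (2 * p i)))
    (\sum_i c i ^+ 2 * - (2 * p i * t `^ (- (2 * p i)) / t)).
  have D1 := is_derive_sum D; have D2 := is_deriveD (is_derive_cst (1 : R) t (1 : R)) D1.
  rewrite (_ : (fun t => 1 + \sum_i c i ^+ 2 * t `^ (- (2 * p i))) =
    cst 1 + \sum_i (fun t => c i ^+ 2 * t `^ (- (2 * p i)))).
    by apply: is_derive_eq D2 _; rewrite add0r.
  by apply/funext => x; rewrite /GRing.add /= fct_sumE.
have A0 : 0 < 1 + \sum_i c i ^+ 2 * t `^ (- (2 * p i)) by rewrite (lt_le_trans ltr01)// lapse_arg_ge1.
have DD := @is_derive1_comp R Num.sqrt (fun t => 1 + \sum_i c i ^+ 2 * t `^ (- (2 * p i))) t _ _ (is_derive1_sqrt A0) DS.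
apply: is_derive_eq DD _; rewrite -/(lapse c t).
have N0 := lt0r_neq0 (lapse_gt0 c t).
rewrite mulrC -sumrN !mulr_suml; apply: eq_bigr => i _.
field; rewrite N0 gt_eqF//.
Qed.

Lemma cont_lapse c t : 0 < t -> {for t, continuous (lapse c)}.
Proof. by move=> t0; exact: is_derive_cont (is_derive_lapse c t0). Qed.

Lemma cont_drift c i t : 0 < t -> {for t, continuous (drift c i)}.
Proof.
move=> t0; apply: cvgM.
  by apply: cvgM; [exact: cvg_cst|exact: is_derive_cont (is_derive_powRN _ t0)].
by apply: cvgV; [exact: lt0r_neq0 (lapse_gt0 c t)|exact: cont_lapse].
Qed.

Lemma christoffel_sum0 X (v : 'I_4 -> R) : spacetime X -> let t := time X in
  \sum_a \sum_b christoffel g X q0 a b * v a * v b =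
  \sum_i p i * t `^ (2 * p i) / t * v (spatial i) ^+ 2.
Proof.
move=> X0 t; have t0 : 0 < t by exact: X0.
rewrite !sum4 sum3 !christoffelE// /kasner_christoffel !metric_diag'E// -/t /=.
rewrite !mulr0n !mulr1n ?(mulr0, mul0r, addr0, add0r, subr0, sub0r, oppr0, invr0).
rewrite spatial_o0 spatial_o1 spatial_o2 /metric_diag /exponent /=.
move: (t `^ _) (t `^ _) (t `^ _) => m1 m2 m3; move: (v q0) (v q1) (v q2) (v q3) => *.
by field; rewrite gt_eqF.
Qed.

Lemma christoffel_sum_spatial X (v : 'I_4 -> R) i : spacetime X -> let t := time X in
  \sum_a \sum_b christoffel g X (spatial i) a b * v a * v b = 2 * p i / t * v q0 * v (spatial i).
Proof.
move=> X0 t; have t0 : 0 < t by exact: X0.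
have := metric_diag_neq0 p1 p2 p3 q1 t0; have := metric_diag_neq0 p1 p2 p3 q2 t0.
have := metric_diag_neq0 p1 p2 p3 q3 t0.
rewrite !sum4 !christoffelE// /kasner_christoffel !metric_diag'E// -/t.
move: i; apply: ord3_ind; rewrite ?spatial_o0 ?spatial_o1 ?spatial_o2 /=;
rewrite !mulr0n !mulr1n ?(mulr0, mul0r, addr0, add0r, subr0, sub0r, oppr0, invr0);
rewrite /metric_diag /exponent /=;
move: (t `^ (2 * p1)) (t `^ (2 * p2)) (t `^ (2 * p3)) => m1 m2 m3; move: (v q0) (v q1) (v q2) (v q3) => v0 v1 v2 v3 m30 m20 m10;
  by field; rewrite ?m30 ?m20 ?m10 ?(gt_eqF t0).
Qed.

Lemma metric_sum X (v : 'I_4 -> R) : let t := time X in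
  \sum_a \sum_b g X a b * v a * v b = - v q0 ^+ 2 + \sum_i t `^ (2 * p i) * v (spatial i) ^+ 2.
Proof.
move=> t; rewrite !sum4 sum3 !kasnerE -/t /= !mulr0n !mulr1n ?(mulr0, mul0r, addr0, add0r).
rewrite spatial_o0 spatial_o1 spatial_o2 /metric_diag /exponent /=; ring.
Qed.

End geodesics.

(** * Constants of motion, with t as the parameter *)

Section dynamics.
Context {R : realType}.
Variables p1 p2 p3 : R.
Local Notation p := (exponent p1 p2 p3).
Local Notation g := (kasner p1 p2 p3).
Local Notation lapse := (lapse p1 p2 p3).
Local Notation drift := (drift p1 p2 p3).
Implicit Types (c : 'I_3 -> R) (t : R).

Lemma interval_const (F : R -> R) (I : set R) a b : is_interval I ->
  (forall s : R, I s -> is_derive s (1 : R) F 0) -> I a -> I b -> F a = F b.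
Proof.
move=> iI dF Ia Ib.
wlog ab : a b Ia Ib / a <= b.
  by move=> H; case: (leP a b) => [/H|/ltW /H E]; [exact|rewrite E].
have [z _] := @mvt R F (fun=> 0) a b ab (fun x xab => dF x (iI a b Ia Ib x xab)).
by rewrite mul0r => /eqP; rewrite subr_eq0 => /eqP.
Qed.

Section geodesic.
Variables (gam : R -> 'rV[R]_4) (I : set R).
Hypothesis geo : past_timelike_geodesic g gam I.
Hypothesis I0 : I 0.
Local Notation t0 := (time (gam 0)).
Local Notation t_ s := (time (gam s)).

Let V (m : 'I_4) : R -> R := derive1 (coordinate gam m).

Let pos s : I s -> 0 < t_ s.
Proof. by case: geo => _ _ H /H []. Qed.

Let dX m (s : R) : I s -> is_derive s (1 : R) (coordinate gam m) (V m s).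
Proof.
case: geo => _ _ H /H [_ /(_ m) [D _] _ _ _].
by apply: DeriveDef => //; rewrite /V derive1E.
Qed.

Let dT (s : R) : I s -> is_derive s (1 : R) (fun s => t_ s) (V q0 s).
Proof. by move=> Is; have := dX q0 Is; rewrite /coordinate /time ord4_zero. Qed.

Let dV m (s : R) : I s -> is_derive s (1 : R) (V m)
  (- \sum_a \sum_b christoffel g (gam s) m a b * V a s * V b s).
Proof.
case: geo => _ _ H /H [_ /(_ m) [_ D] /(_ m) E _ _].
apply: DeriveDef => //; rewrite -derive1E.
have E2 : derive1n 2 (coordinate gam m) s = derive1 (V m) s by [].
rewrite E2 in E; apply/eqP; rewrite -subr_eq0 opprK -[X in _ == X]E; apply/eqP; congr (_ + _).
by apply: eq_bigr => a _; apply: eq_bigr => b _; rewrite !mxE.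
Qed.

Definition momentum (i : 'I_3) : R := t0 `^ (2 * p i) * velocity gam 0 0 (spatial i).

(** [momentum i] is the conserved quantity of the Killing field d / dx^i: the geodesic equation says
    that the derivative of t^(2 p_i) x_i' is zero. *)
Lemma momentum_conserved s i : I s -> velocity gam s 0 (spatial i) = momentum i * t_ s `^ (- (2 * p i)).
Proof.
move=> Is; rewrite /momentum !mxE -!/(V _ _).
pose F s := t_ s `^ (2 * p i) * V (spatial i) s.
have E : F 0 = F s.
  have iI : is_interval I by case: geo.
  apply: (interval_const iI) I0 Is => {}s Is.
  have s0 := pos Is.
  have Dp : is_derive s (1 : R) (fun s => t_ s `^ (2 * p i)) (2 * p i * t_ s `^ (2 * p i - 1) * V q0 s).
    exact: (@is_derive1_comp R (fun t => t `^ (2 * p i)) (fun s => t_ s) s _ _ (is_derive1_powR _ s0) (dT Is)).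
  have D := is_deriveM Dp (dV (spatial i) Is).
  apply: is_derive_eq D _; rewrite christoffel_sum_spatial; last exact: s0.
  have tn0 : t_ s != 0 by rewrite gt_eqF.
  rewrite powRB ?tn0 ?implybT// powRr1 ?ltW// /GRing.scale /=.
  move: (_ `^ _) => m; move: (V q0 s) (V (spatial i) s) (p i) => v0 vi q.
  by field.
rewrite -[X in X * _]/(F 0) E /F powRN mulrC mulrA mulVf ?mul1r//.
by rewrite gt_eqF// powR_gt0// pos.
Qed.

(** The unit normalization determines the square, and past direction the sign. *)
Lemma time_velocity s : I s -> velocity gam s 0 q0 = - lapse momentum (t_ s).
Proof.
move=> Is; case: geo => _ _ /(_ s Is) [s0 _ _ Hn Hneg].
have v0 : velocity gam s 0 q0 < 0 by rewrite -ord4_zero.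
have H := @metric_sum R p1 p2 p3 (gam s) (fun m => velocity gam s 0 m); rewrite /= Hn in H.
have E : \sum_i t_ s `^ (2 * p i) * velocity gam s 0 (spatial i) ^+ 2 =
    \sum_i momentum i ^+ 2 * t_ s `^ (- (2 * p i)).
  apply: eq_bigr => i _; rewrite momentum_conserved// exprMn [in RHS]powRN powRN.
  have : t_ s `^ (2 * p i) != 0 by rewrite gt_eqF// powR_gt0.
  by move: (_ `^ _) => m; move: (momentum i) => q m0; field.
rewrite E in H; have L := lapse_sqr p1 p2 p3 momentum (t_ s).
apply: oppr_inj; rewrite opprK.
apply/eqP; rewrite -(@eqrXn2 _ 2)//; last 2 first.
- by rewrite oppr_ge0 ltW.
- exact: ltW (lapse_gt0 _ _ _ _ _).
rewrite L sqrrN; apply/eqP; move: H; move: (\sum_i _) (velocity _ _ _ _ ^+ 2) => ? ?; lra.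
Qed.

Variables (S : R -> R) (Xi : 'I_3 -> R -> R).
Hypothesis dS : forall t : R, 0 < t -> is_derive t (1 : R) S (- (lapse momentum t)^-1).
Hypothesis S0 : S t0 = 0.
Hypothesis dXi : forall i (t : R), 0 < t -> is_derive t (1 : R) (Xi i) (- drift momentum i t).

(** S(t(s)) - s has zero derivative and vanishes at s = 0. The parameter is thus a function of t
    alone, which makes geodesics with the same initial data comparable. *)
Lemma proper_time s : I s -> S (t_ s) = s.
Proof.
move=> Is; have iI : is_interval I by case: geo.
suff E : S (t_ 0) - 0 = S (t_ s) - s.
  by apply/eqP; rewrite -subr_eq0 -E S0 subr0.
apply: (interval_const (F := fun s => S (t_ s) - s) iI) I0 Is => {}s Is.
have s0 := pos Is.
have D := @is_derive1_comp R S (fun s => t_ s) s _ _ (dS s0) (dT Is).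
have D2 := is_deriveB D (is_derive_id s (1 : R)).
apply: is_derive_eq D2 _.
have := time_velocity Is; rewrite mxE -/(V _ _) => ->.
by rewrite mulrNN mulVf ?subrr// gt_eqF// lapse_gt0.
Qed.

Lemma position s i : I s ->
  gam s 0 (spatial i) = gam 0 0 (spatial i) + (Xi i (t_ s) - Xi i t0).
Proof.
move=> Is; have iI : is_interval I by case: geo.
suff E : gam 0 0 (spatial i) - Xi i (t_ 0) = gam s 0 (spatial i) - Xi i (t_ s).
  by rewrite -[LHS](subrK (Xi i (t_ s))) -E addrAC addrA.
apply: (interval_const (F := fun s => gam s 0 (spatial i) - Xi i (t_ s)) iI) I0 Is => {}s Is.
have s0 := pos Is.
have D := @is_derive1_comp R (Xi i) (fun s => t_ s) s _ _ (dXi i s0) (dT Is).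
have D2 := is_deriveB (dX (spatial i) Is) D.
apply: is_derive_eq D2 _.
have := time_velocity Is; rewrite mxE -/(V _ _) => ->.
have := momentum_conserved i Is; rewrite mxE -/(V _ _) => ->.
by rewrite mulrNN /drift divfK ?subrr// gt_eqF// lapse_gt0.
Qed.

End geodesic.
End dynamics.

(** * Explicit geodesics and inextendibility *)

Section maximal_geodesic.
Context {R : realType}.
Variables p1 p2 p3 : R.
Local Notation p := (exponent p1 p2 p3).
Local Notation g := (kasner p1 p2 p3).
Local Notation lapse := (lapse p1 p2 p3).
Local Notation drift := (drift p1 p2 p3).

Section explicit.
Variables (c x0 : 'I_3 -> R) (S : R -> R) (Y : 'I_3 -> R -> R).
Hypothesis dS : forall t : R, 0 < t -> is_derive t (1 : R) S (- (lapse c t)^-1).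
Hypothesis dY : forall i (t : R), 0 < t -> is_derive t (1 : R) (Y i) (- drift c i t).

Definition clock_domain : set R := [set s | exists2 t, 0 < t & S t = s].

Definition clock (s : R) : R := xget 1 [set t | 0 < t /\ S t = s].

(* [S] is proper time as a function of t, counted from t_0; it is decreasing and [clock] inverts it. *)
Definition explicit_geodesic (s : R) : 'rV[R]_4 :=
  let t := clock s in to_event (t, Y o0 t, Y o1 t, Y o2 t).

Let S_decr a b : 0 < a -> a < b -> S b < S a.
Proof.
move=> a0 ab.
have [z /andP[az zb] E] := @mvt R S (fun t => - (lapse c t)^-1) a b (ltW ab)
  (fun x xab => dS (lt_le_trans a0 (proj1 (andP xab)))).
rewrite -subr_lt0 E mulNr oppr_lt0 mulr_gt0 ?subr_gt0// invr_gt0.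
exact: lapse_gt0.
Qed.

Lemma clockK t : 0 < t -> clock (S t) = t.
Proof.
move=> t0.
have [u0 Su] : [set u | 0 < u /\ S u = S t] (clock (S t)).
  by apply: (@xgetPex _ 1); exists t.
by case: (ltgtP (clock (S t)) t) => // [/(S_decr u0)|/(S_decr t0)]; rewrite Su ltxx.
Qed.

Lemma clock_gt0 s : clock_domain s -> 0 < clock s.
Proof. by case=> t t0 <-; rewrite clockK. Qed.

Lemma clock_domain_between t1 t2 s : 0 < t1 -> 0 < t2 -> S t1 <= s <= S t2 -> clock_domain s.
Proof.
move=> t10 t20 /andP[s1 s2].
have t21 : t2 <= t1.
  by rewrite leNgt; apply/negP => /(S_decr t10); rewrite ltNge (le_trans s1 s2).
have [||z] := @IVT R S t2 t1 s t21.
- by apply: cont_within => x /andP[x2 _]; exact: is_derive_cont (dS (lt_le_trans t20 x2)).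
- by rewrite ge_min le_max s1 s2 !orbT.
rewrite in_itv /= => /andP[z2 _] <-; exists z => //; exact: lt_le_trans z2.
Qed.

Lemma is_interval_clock_domain : is_interval clock_domain.
Proof. by move=> _ _ [t1 t10 <-] [t2 t20 <-] s; exact: clock_domain_between. Qed.

Lemma open_clock_domain : open clock_domain.
Proof.
rewrite openE => _ [t t0 <-].
have A : S (2 * t) < S t by apply: S_decr => //; lra.
have B : S t < S (t / 2) by apply: S_decr; lra.
have h0 : 0 < t / 2 by lra.
have h1 : 0 < 2 * t by lra.
apply: (@filterS _ _ _ [set s | S (2 * t) < s /\ s < S (t / 2)]).
  by move=> s [s1 s2]; apply: (@clock_domain_between (2 * t) (t / 2)) => //; rewrite !ltW.
by apply: filterI; [exact: lt_nbhsr|exact: lt_nbhsl].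
Qed.

Lemma is_derive_clock (s : R) : clock_domain s -> is_derive s (1 : R) clock (- lapse c (clock s)).
Proof.
case=> t t0 <-; rewrite clockK//.
have N0 := lt0r_neq0 (lapse_gt0 p1 p2 p3 c t).
have := @is_derive_inverse R S clock (- (lapse c t)^-1) t.
rewrite invrN invrK; apply.
- have : \forall u \near t, 0 < u by exact: lt_nbhsr.
  by apply: filterS => u; exact: clockK.
- have : \forall u \near t, 0 < u by exact: lt_nbhsr.
  by apply: filterS => u u0; exact: is_derive_cont (dS u0).
- exact: dS.
- by rewrite oppr_eq0 invr_eq0.
Qed.

Let time_explicit s : time (explicit_geodesic s) = clock s.
Proof. by rewrite /explicit_geodesic time_to_event. Qed.

Let coordinate_q0 : coordinate explicit_geodesic q0 = clock.
Proof. by apply/funext => s; rewrite /coordinate /explicit_geodesic to_event_entry. Qed.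

Let coordinate_spatial i : coordinate explicit_geodesic (spatial i) = fun s => Y i (clock s).
Proof.
apply/funext => s; rewrite /coordinate /explicit_geodesic to_event_entry; move: i.
by apply: ord3_ind; rewrite ?spatial_o0 ?spatial_o1 ?spatial_o2.
Qed.

Let is_derive_Y i (s : R) : clock_domain s ->
  is_derive s (1 : R) (fun s => Y i (clock s)) (c i * clock s `^ (- (2 * p i))).
Proof.
move=> Js; have s0 := clock_gt0 Js.
have D := @is_derive1_comp R (Y i) clock s _ _ (dY i s0) (is_derive_clock Js).
apply: is_derive_eq D _.
by rewrite mulrNN /drift divfK// gt_eqF// lapse_gt0.
Qed.

(** A second derivative requires a formula for the first one on a whole neighbourhood, which the
    openness of [clock_domain] provides. *)
Let derive1_near (f df : R -> R) (s l : R) : (forall s : R, clock_domain s -> is_derive s (1 : R) f (df s)) ->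
  clock_domain s -> is_derive s (1 : R) df l -> is_derive s (1 : R) (derive1 f) l.
Proof.
move=> fdf Js; apply: near_eq_is_derive.
have : \forall u \near s, clock_domain u by exact: open_nbhs_nbhs (conj open_clock_domain Js).
by apply: filterS => u Ju; rewrite derive1E; apply/esym/derive_val; exact: fdf.
Qed.

Lemma explicit_geodesicP : past_timelike_geodesic g explicit_geodesic clock_domain.
Proof.
split; [exact: open_clock_domain|exact: is_interval_clock_domain|] => s Js.
have s0 := clock_gt0 Js; set t := clock s in s0.
have N0 := lapse_gt0 p1 p2 p3 c t.
have X0 : spacetime (explicit_geodesic s) by rewrite /spacetime /= time_explicit.
have tE : time (explicit_geodesic s) = t by exact: time_explicit.
have v0 : velocity explicit_geodesic s 0 q0 = - lapse c t.
  by rewrite mxE coordinate_q0 derive1E; apply: derive_val; exact: is_derive_clock.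
have vi i : velocity explicit_geodesic s 0 (spatial i) = c i * t `^ (- (2 * p i)).
  by rewrite mxE coordinate_spatial derive1E; apply: derive_val; exact: is_derive_Y.
have D0 : is_derive s (1 : R) (derive1 clock) (- (\sum_i p i * c i ^+ 2 * t `^ (- (2 * p i)) / t)).
  apply: (derive1_near (df := fun s => - lapse c (clock s))) => //.
    exact: is_derive_clock.
  have D := @is_derive1_comp R (lapse c) clock s _ _ (is_derive_lapse p1 p2 p3 c s0) (is_derive_clock Js).
  have D2 := is_deriveN D; apply: is_derive_eq D2 _; rewrite -/t.
  by move: (\sum_i _) => A; rewrite mulrN opprK divfK// gt_eqF.
have Di i : is_derive s (1 : R) (derive1 (fun s => Y i (clock s)))
    (c i * (2 * p i * t `^ (- (2 * p i)) / t * lapse c t)).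
  apply: (derive1_near (df := fun s => c i * clock s `^ (- (2 * p i)))) => //.
    exact: is_derive_Y.
  have D := @is_derive1_comp R (fun t => t `^ (- (2 * p i))) clock s _ _ (is_derive_powRN (2 * p i) s0) (is_derive_clock Js).
  have D2 := @is_deriveZ _ _ _ (fun s => clock s `^ (- (2 * p i))) (c i) s 1 _ D.
  by apply: is_derive_eq D2 _; rewrite -/t mulrNN.
have all_m (P : 'I_4 -> Prop) : P q0 -> (forall i, P (spatial i)) -> forall m, P m.
  move=> P0 Pi; apply: ord4_ind => //.
  - by rewrite -spatial_o0.
  - by rewrite -spatial_o1.
  - by rewrite -spatial_o2.
split; first exact: X0.
- apply: all_m => [|i].
    rewrite coordinate_q0; split; first by case: (is_derive_clock Js).
    by case: D0.
  rewrite coordinate_spatial; split; first by case: (is_derive_Y i Js).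
  by case: (Di i).
- apply: all_m => [|i].
  + rewrite (christoffel_sum0 p1 p2 p3 (fun m => velocity explicit_geodesic s 0 m) X0) tE.
    rewrite coordinate_q0 (_ : derive1n 2 clock s = derive1 (derive1 clock) s)//.
    rewrite [X in X + _]derive1E (derive_val (is_derive := D0)) addrC; apply/eqP; rewrite subr_eq0; apply/eqP.
    apply: eq_bigr => i _; rewrite vi powRN.
    have : t `^ (2 * p i) != 0 by rewrite gt_eqF// powR_gt0.
    move: (_ `^ _) => m m0; move: (p i) (c i) => q k; field.
    by rewrite m0 gt_eqF.
  + rewrite (christoffel_sum_spatial p1 p2 p3 (fun m => velocity explicit_geodesic s 0 m) i X0) tE.
    rewrite coordinate_spatial (_ : derive1n 2 _ s = derive1 (derive1 (fun s => Y i (clock s))) s)//.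
    rewrite [X in X + _]derive1E (derive_val (is_derive := Di i)) v0 vi.
    by move: (_ `^ _) (lapse c t) => m N; ring.
- rewrite (metric_sum p1 p2 p3 _ (fun m => velocity explicit_geodesic s 0 m)) tE v0 sqrrN lapse_sqr.
  rewrite (_ : \sum_i t `^ (2 * p i) * _ = \sum_i c i ^+ 2 * t `^ (- (2 * p i))).
    by rewrite opprD subrK.
  apply: eq_bigr => i _; rewrite vi powRN; have : t `^ (2 * p i) != 0 by rewrite gt_eqF// powR_gt0.
  by move: (_ `^ _) => m m0; move: (c i) => k; field.
- by rewrite ord4_zero v0 oppr_lt0.
Qed.

End explicit.

Section inextendible.
Variables (gam : R -> 'rV[R]_4) (I : set R).
Hypothesis ig : inextendible_past_timelike_geodesic g gam I.
Hypothesis I0 : I 0.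
Local Notation t0 := (time (gam 0)).
Local Notation c := (momentum p1 p2 p3 gam).

Let geo : past_timelike_geodesic g gam I. Proof. by case: ig. Qed.

Let t0_gt0 : 0 < t0. Proof. by case: geo => _ _ /(_ 0 I0) []. Qed.

(* The explicit geodesic with the same initial data extends [gam], so its whole domain lies in [I]. *)
Lemma inextendible_reaches t : 0 < t -> exists2 s, I s & time (gam s) = t.
Proof.
have cN (u : R) : 0 < u -> {for u, continuous (fun u => - (lapse c u)^-1)}.
  move=> u0; apply: cvgN; apply: cvgV; first exact: lt0r_neq0 (lapse_gt0 _ _ _ _ _).
  exact: cont_lapse.
have [S' dS'] := antiderivative cN.
have cD i (u : R) : 0 < u -> {for u, continuous (fun u => - drift c i u)}.
  by move=> u0; apply: cvgN; exact: cont_drift.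
have /choice[Y' dY'] : forall i, exists Y : R -> R, forall u : R, 0 < u -> is_derive u (1 : R) Y (- drift c i u).
  by move=> i; exact: antiderivative (cD i).
(* The primitives are normalized so that the explicit geodesic passes through [gam 0] at parameter
   0. *)
pose S u := S' u - S' t0; pose Y i u := gam 0 0 (spatial i) + (Y' i u - Y' i t0).
have dS (u : R) : 0 < u -> is_derive u (1 : R) S (- (lapse c u)^-1).
  move=> u0; have D := is_deriveB (dS' u u0) (is_derive_cst (S' t0) (u : R) (1 : R)).
  by apply: is_derive_eq D _; rewrite subr0.
have dY i (u : R) : 0 < u -> is_derive u (1 : R) (Y i) (- drift c i u).
  move=> u0; have D := is_deriveD (is_derive_cst (gam 0 0 (spatial i)) u (1 : R))
    (is_deriveB (dY' i u u0) (is_derive_cst (Y' i t0) u (1 : R))).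
  by apply: is_derive_eq D _; rewrite subr0 add0r.
have S0 : S t0 = 0 by rewrite /S subrr.
have SI s : I s -> S (time (gam s)) = s by move=> Is; exact: (proper_time geo I0 dS S0 Is).
have pos s : I s -> 0 < time (gam s) by case: geo => _ _ H /H [].
have [_ ext] := ig.
have JI : clock_domain S `<=` I.
  apply: (ext (explicit_geodesic S Y)).
  - exact: explicit_geodesicP.
  - by move=> s Is; exists (time (gam s)); [exact: pos|exact: SI].
  - move=> s Is; have E : clock S s = time (gam s).
      by rewrite -[in LHS](SI s Is) (clockK dS)//; exact: pos.
    have P i : gam s 0 (spatial i) = Y i (time (gam s)) by exact: (position geo I0 dY').
    apply/rowP => m; rewrite /explicit_geodesic E to_event_entry /=; move: m; apply: ord4_ind => /=.
    + by rewrite -ord4_zero.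
    + by rewrite -spatial_o0 P.
    + by rewrite -spatial_o1 P.
    + by rewrite -spatial_o2 P.
move=> t_gt0; have Js : clock_domain S (S t) by exists t.
exists (S t); first exact: JI.
have := SI _ (JI _ Js) => E.
have := clockK dS t_gt0; rewrite -{1}E (clockK dS)//; exact: pos (JI _ Js).
Qed.

Lemma inextendible_position s i : I s -> time (gam s) < t0 ->
  gam s 0 (spatial i) = gam 0 0 (spatial i) + integ (time (gam s)) t0 (drift c i).
Proof.
move=> Is st.
have s0 : 0 < time (gam s) by case: geo => _ _ /(_ s Is) [].
have cD j (u : R) : 0 < u -> {for u, continuous (fun u => - drift c j u)}.
  by move=> u0; apply: cvgN; exact: cont_drift.
have /choice[Y dY] : forall j, exists Y : R -> R, forall u : R, 0 < u -> is_derive u (1 : R) Y (- drift c j u).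
  by move=> j; exact: antiderivative (cD j).
have -> : integ (time (gam s)) t0 (drift c i) = - Y i t0 - - Y i (time (gam s)).
  apply: (@integ_ftc R (time (gam s)) t0 st (fun u => - Y i u)).
  - move=> u /andP[su _]; have D := is_deriveN (dY i u (lt_le_trans s0 su)).
    by apply: is_derive_eq D _; rewrite opprK.
  - by move=> u /andP[su _]; apply: cont_drift; exact: lt_le_trans su.
by rewrite (position geo I0 dY i Is) opprK [- _ + _]addrC.
Qed.

End inextendible.
End maximal_geodesic.

(** * Energy density along a geodesic *)

Section stress_energy.
Context {R : realType}.
Variables p1 p2 p3 : R.
Hypothesis psum : p1 + p2 + p3 = 1.
Local Notation p := (exponent p1 p2 p3).
Local Notation g := (kasner p1 p2 p3).
Local Notation lapse := (lapse p1 p2 p3).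
Local Notation drift := (drift p1 p2 p3).
Variable F : 'rV[R]_4 -> 'M[R]_4.
Hypothesis mF : maxwell_solution g F.

(** The inverse metric is diagonal, so every index is raised by a factor [k]; g(v, v) = -1 turns the
    trace term into + 1 / 4. *)
Lemma stress_energy_contraction X (v : 'I_4 -> R) : spacetime X ->
  \sum_a \sum_b g X a b * v a * v b = -1 ->
  let k a := (metric_diag p1 p2 p3 (time X) a)^-1 in
  \sum_a \sum_b stress_energy g F X a b * v a * v b =
  (4 * pi)^-1 * (\sum_c k c * (\sum_a v a * F X a c) ^+ 2 +
     4^-1 * \sum_m \sum_n k m * k n * F X m n ^+ 2).
Proof.
move=> X0 gv k.
have inv1 (f : 'I_4 -> R) c : \sum_d invmx (g X) c d * f d = k c * f c.
  rewrite (bigD1 c)//= big1 ?addr0; last first.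
    by move=> d dc; rewrite invmx_kasner// eq_sym (negbTE dc) mulr0n mul0r.
  by rewrite invmx_kasner// eqxx mulr1n.
pose Q := \sum_m \sum_n k m * k n * F X m n ^+ 2.
have QE : \sum_m \sum_n F X m n * (\sum_r \sum_s invmx (g X) m r * invmx (g X) n s * F X r s) = Q.
  apply: eq_bigr => m _; apply: eq_bigr => n _.
  under eq_bigr => r _.
    under eq_bigr do rewrite -mulrA.
    rewrite -mulr_sumr inv1; over.
  by rewrite inv1; ring.
have TE a b : stress_energy g F X a b =
    (4 * pi)^-1 * (\sum_c k c * (F X a c * F X b c) - 4^-1 * Q * g X a b).
  rewrite mxE QE; congr (_ * (_ - _)); last by ring.
  by apply: eq_bigr => c _; rewrite inv1; ring.
rewrite -/Q; clearbody Q.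
transitivity ((4 * pi)^-1 * (\sum_a \sum_b (\sum_c k c * (F X a c * F X b c)) * v a * v b
   - 4^-1 * Q * \sum_a \sum_b g X a b * v a * v b)).
  rewrite mulrBr !mulr_sumr -sumrB; apply: eq_bigr => a _.
  rewrite !mulr_sumr -sumrB; apply: eq_bigr => b _; rewrite TE.
  by clear; move: (\sum_c _) (g X a b) ((4 * pi)^-1) => *; ring.
rewrite gv mulrN1 opprK; congr (_ * (_ + _)).
clear; move: k (F X) v => k M v; rewrite !sum4; ring.
Qed.

(* In the orthonormal frame: the first two terms are the Lorentzian square of F(v, .). *)
Lemma weighted_energy_density (c : 'I_3 -> R) (X : R * R * R * R) (v : 'I_4 -> R) :
  let t := X.1.1.1 in 0 < t ->
  let Y := to_event X in
  v q0 = - lapse c t -> (forall i, v (spatial i) = c i * t `^ (- (2 * p i))) ->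
  let e i := t `^ (p i - p1) * flux p1 p2 p3 F true i [::] X in
  let b i := t `^ (p i - p1) * flux p1 p2 p3 F false i [::] X in
  let nu i := c i * t `^ (p3 - p i) in
  let nu0 := lapse c t * t `^ p3 in
  t `^ (2 * p2 + 4 * p3) * (\sum_a \sum_b stress_energy g F Y a b * v a * v b) =
  (4 * pi)^-1 * (- (\sum_i nu i * e i) ^+ 2
     + \sum_i (nu0 * e i + nu (succ3 i) * b (succ3 (succ3 i)) - nu (succ3 (succ3 i)) * b (succ3 i)) ^+ 2
     + 2^-1 * (t `^ p3) ^+ 2 * \sum_i (b i ^+ 2 - e i ^+ 2)).
Proof.
move=> t t0 Y v0 vi e b nu nu0.
have Y0 : spacetime Y by rewrite /spacetime /= time_to_event.
have tY : time Y = t by rewrite time_to_event.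
have tn0 : t != 0 by rewrite gt_eqF.
have gv : \sum_a \sum_b g Y a b * v a * v b = -1.
  rewrite metric_sum tY v0 sqrrN lapse_sqr (_ : \sum_i t `^ (2 * p i) * _ = \sum_i c i ^+ 2 * t `^ (- (2 * p i))).
    by rewrite opprD subrK.
  apply: eq_bigr => i _; rewrite vi powRN; have : t `^ (2 * p i) != 0 by rewrite gt_eqF// powR_gt0.
  by move: (_ `^ _) => m m0; move: (c i) => k; field.
rewrite stress_energy_contraction// tY.
have PD x y : t `^ (x + y) = t `^ x * t `^ y by rewrite powRD ?tn0 ?implybT.
have A0 q : t `^ q != 0 by rewrite gt_eqF// powR_gt0.
(* Replacing t by this product leaves the three powers t^(p_i) as the only atoms for [field]. *)
have tA : t = t `^ p1 * t `^ p2 * t `^ p3 by rewrite -!PD psum powRr1// ltW.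
have sq q : t `^ (2 * q) = t `^ q ^+ 2 by rewrite (_ : 2 * q = q + q) ?PD ?expr2//; ring.
(* The exponent is 2 (p_2 + p_3) + 2 p_3: the orthonormal components of F times t^(1 - p_1) = t^(p_2
   + p_3) are [e] and [b], and those of the velocity times t^(p_3) are [nu] and [nu0], up to
   sign. *)
have aE : t `^ (2 * p2 + 4 * p3) = t `^ p2 ^+ 2 * t `^ p3 ^+ 4.
  by rewrite PD sq (_ : 4 * p3 = 2 * (2 * p3)) ?sq -?exprM//; ring.
have FE i : F Y q0 (spatial i) = t `^ p i ^+ 2 / t * flux p1 p2 p3 F true i [::] X.
  rewrite /flux /= /component -/t -/Y PD powRN sq powRr1; last exact: ltW.
  have := A0 (p i); move: (t `^ p i) (F Y q0 (spatial i)) => m f m0; field; rewrite ?m0 ?tn0//.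
have FB i : F Y (spatial (succ3 i)) (spatial (succ3 (succ3 i))) = flux p1 p2 p3 F false i [::] X.
  by rewrite /flux /= /component powRr0 mul1r.
have FD a : F Y a a = 0 by apply: eq_opp0; exact: (field_antisym mF).
have anti a d : F Y a d = - F Y d a by exact: (field_antisym mF).
have E0 := FE o0; have E1 := FE o1; have E2 := FE o2.
have B0 := FB o0; have B1 := FB o1; have B2 := FB o2.
have V0 := vi o0; have V1 := vi o1; have V2 := vi o2.
rewrite /succ3 /= ?spatial_o0 ?spatial_o1 ?spatial_o2 in E0 E1 E2 B0 B1 B2 V0 V1 V2.
rewrite !sum4 !sum3 !FD (anti q1 q0) (anti q2 q0) (anti q3 q0) (anti q2 q1) (anti q3 q2) (anti q1 q3).
rewrite E0 E1 E2 B0 B1 B2 V0 V1 V2 v0 aE /metric_diag /= !sq /nu0 /nu /e /b /succ3 /=.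
rewrite !powRN !sq !(fun x y => PD x (- y)) !powRN /exponent /=.
have tV : t^-1 = (t `^ p1 * t `^ p2 * t `^ p3)^-1 by rewrite -tA.
rewrite tV; have a1 := A0 p1; have a2 := A0 p2; have a3 := A0 p3.
move: ((4 * pi)^-1) (lapse c t) (c o0) (c o1) (c o2) => K N c0 c1 c2.
move: (flux _ _ _ _ true o0 _ _) (flux _ _ _ _ true o1 _ _) (flux _ _ _ _ true o2 _ _) => e0 e1 e2.
move: (flux _ _ _ _ false o0 _ _) (flux _ _ _ _ false o1 _ _) (flux _ _ _ _ false o2 _ _) => b0 b1 b2.
move: (t `^ p1) (t `^ p2) (t `^ p3) a1 a2 a3 => A1 A2 A3 a1 a2 a3; clear -a1 a2 a3.
by field; rewrite a1 a2 a3.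
Qed.

End stress_energy.

(** * The limit of the rescaled energy density *)

Section blow_up.
Context {R : realType}.
Variables p1 p2 p3 : R.
Hypothesis psum : p1 + p2 + p3 = 1.
Hypothesis p1_lt0 : p1 < 0.
Hypothesis p12 : p1 <= p2.
Hypothesis p23 : p2 <= p3.
Hypothesis p3_lt1 : p3 < 1.
Local Notation p := (exponent p1 p2 p3).
Local Notation g := (kasner p1 p2 p3).
Local Notation lapse := (lapse p1 p2 p3).
Local Notation drift := (drift p1 p2 p3).

Lemma exponent_lt1 i : p i < 1.
Proof. by move: i; apply: ord3_ind; rewrite /exponent /=; move: psum p1_lt0 p12 p23 p3_lt1; lra. Qed.

(** [powR_limit] applies to a primitive of the drift with constant 1 by [drift_le], so the rate does
    not depend on the momenta. *)
Lemma drift_integral_limit c i T : 0 < T -> exists Phi, forall t, 0 < t < T ->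
  `|integ t T (drift c i) - Phi| <= (1 - p i)^-1 * t `^ (1 - p i).
Proof.
move=> T0.
have cD (u : R) : 0 < u -> {for u, continuous (fun u => - drift c i u)}.
  by move=> u0; apply: cvgN; exact: cont_drift.
have [Y dY] := antiderivative cD.
have q0 : 0 < 1 - p i by rewrite subr_gt0 exponent_lt1.
have [L HL] : exists L, forall t, 0 < t <= T -> `|Y t - L| <= 1 / (1 - p i) * t `^ (1 - p i).
  apply: (@powR_limit R Y (fun u => - drift c i u)) => //.
    by move=> t /andP[t0 _]; exact: dY.
  move=> t /andP[t0 _]; rewrite normrN mul1r addrAC subrr add0r; exact: drift_le.
exists (L - Y T) => t /andP[t0 tT].
have -> : integ t T (drift c i) = - Y T - - Y t.
  apply: (@integ_ftc R t T tT (fun u => - Y u)).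
  - move=> u /andP[su _]; have D := is_deriveN (dY u (lt_le_trans t0 su)).
    by apply: is_derive_eq D _; rewrite opprK.
  - by move=> u /andP[su _]; apply: cont_drift; exact: lt_le_trans su.
have := HL t; rewrite t0 ltW// => /(_ isT); rewrite div1r.
by rewrite (_ : - Y T - - Y t - (L - Y T) = Y t - L)//; ring.
Qed.

Section along_geodesic.
Variables (F : 'rV[R]_4 -> 'M[R]_4) (E : bool -> seq 'I_3 -> R -> R -> R -> R).
Hypothesis mF : maxwell_solution g F.
Hypothesis hE : is_profile (1 - p3) (flux p1 p2 p3 F) E.
Variables (gam : R -> 'rV[R]_4) (I : set R) (Phi : 'I_3 -> R).
Hypothesis ig : inextendible_past_timelike_geodesic g gam I.
Hypothesis I0 : I 0.
Local Notation c := (momentum p1 p2 p3 gam).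
Local Notation T := (time (gam 0)).
Hypothesis hPhi : forall i t, 0 < t < T ->
  `|integ t T (drift c i) - Phi i| <= (1 - p i)^-1 * t `^ (1 - p i).
Hypothesis c2_neq0 : c o2 != 0.
Let xl i := gam 0 0 (spatial i) + Phi i.
Hypothesis regular : exists s, E s [::] (xl o0) (xl o1) (xl o2) != 0.

Let geo : past_timelike_geodesic g gam I. Proof. by case: ig. Qed.
Let pos s : I s -> 0 < time (gam s). Proof. by case: geo => _ _ H /H []. Qed.
Let T0 : 0 < T. Proof. exact: pos. Qed.

Local Notation Flt := (to_singularity gam I).

Lemma to_singularity_proper : ProperFilter Flt.
Proof.
apply: filter_from_proper; first apply: filter_from_filter.
- by exists 1 => /=.
- move=> e1 e2 /= e10 e20; exists (Num.min e1 e2); first by rewrite /= lt_min e10.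
  by move=> s /= [Is]; rewrite lt_min => /andP[].
- move=> e /= e0; have [s Is st] := inextendible_reaches ig I0 (t := e / 2) (ltac:(by rewrite divr_gt0)).
  by exists s; split => //; rewrite st; lra.
Qed.

#[local] Instance PF : ProperFilter Flt := to_singularity_proper.

Lemma near_singularity (P : R -> Prop) d : 0 < d ->
  (forall s, I s -> 0 < time (gam s) -> time (gam s) < d -> P s) -> \forall s \near Flt, P s.
Proof. by move=> d0 H; exists d => //= s [Is st]; apply: H => //; exact: pos. Qed.

Lemma time_powR_cvg0 q : 0 < q -> (time (gam s) `^ q) @[s --> Flt] --> (0 : R).
Proof.
move=> q0; apply: (@cvg_comp _ _ _ (fun s => time (gam s)) (fun t => t `^ q) _ (0^'+)); last exact: powR_cvg0.
move=> A [d /= d0 dA]; apply: (near_singularity d0) => s Is s0 sd; apply: dA => //.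
by rewrite /= sub0r normrN gtr0_norm.
Qed.

Lemma squeeze0 (f h : R -> R) l d : 0 < d ->
  (forall s, I s -> 0 < time (gam s) -> time (gam s) < d -> `|f s - l| <= h s) ->
  h s @[s --> Flt] --> (0 : R) -> f s @[s --> Flt] --> l.
Proof.
move=> d0 H /cvgrPdist_le h0; apply/cvgrPdist_le => e e0.
have N := h0 e e0; have N2 := near_singularity d0 H.
near=> s.
have hs : `|f s - l| <= h s by near: s.
have he : `|0 - h s| <= e by near: s.
rewrite distrC (le_trans hs)// (le_trans _ he)// sub0r normrN ler_norm//.
Unshelve. all: by end_near. Qed.

Lemma squeeze_powR (f : R -> R) l K q d : 0 < d -> 0 < q ->
  (forall s, I s -> 0 < time (gam s) -> time (gam s) < d -> `|f s - l| <= K * time (gam s) `^ q) ->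
  f s @[s --> Flt] --> l.
Proof.
move=> d0 q0 H; apply: (squeeze0 d0 H); rewrite -[X in _ --> X](mulr0 K).
by apply: cvgM; [exact: cvg_cst|exact: time_powR_cvg0].
Qed.

Let pt s : R * R * R * R :=
  (time (gam s), gam s 0 (spatial o0), gam s 0 (spatial o1), gam s 0 (spatial o2)).

Lemma position_cvg i : gam s 0 (spatial i) @[s --> Flt] --> xl i.
Proof.
apply: (@squeeze_powR _ _ (1 - p i)^-1 (1 - p i) T) => //.
  by rewrite subr_gt0 exponent_lt1.
move=> s Is s0 sT; rewrite (inextendible_position ig I0 i Is sT) /xl opprD addrACA subrr add0r.
by apply: hPhi; rewrite s0.
Qed.

(** Two errors are added: the uniform distance from field to profile at the moving point, and the
    Lipschitz error between this point and its limit. *)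
Lemma flux_cvg b : flux p1 p2 p3 F b o0 [::] (pt s) @[s --> Flt] --> E b [::] (xl o0) (xl o1) (xl o2).
Proof.
have [K1 H1] := profile_cvg hE b [::]; have [K2 K20 H2] := profile_lipschitz hE b [::].
have q0 : 0 < 1 - p3 by rewrite subr_gt0.
apply: (@squeeze0 _ (fun s => K1 * time (gam s) `^ (1 - p3) +
  K2 * dist1 (xl o0) (xl o1) (xl o2) (gam s 0 (spatial o0)) (gam s 0 (spatial o1)) (gam s 0 (spatial o2))) _ 1) => //.
  move=> s Is s0 s1.
  have := H1 (time (gam s)) (gam s 0 (spatial o0)) (gam s 0 (spatial o1)) (gam s 0 (spatial o2)).
  rewrite s0 ltW// => /(_ isT) A.
  have B := H2 (xl o0) (xl o1) (xl o2) (gam s 0 (spatial o0)) (gam s 0 (spatial o1)) (gam s 0 (spatial o2)).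
  apply: le_trans (lerD A B); apply: le_trans (ler_normD _ _).
  by rewrite /pt le_eqVlt; apply/orP; left; apply/eqP; congr `|_|; rewrite addrA subrK.
rewrite -[X in _ --> X](addr0 0); apply: cvgD.
  by rewrite -[X in _ --> X](mulr0 K1); apply: cvgM; [exact: cvg_cst|exact: time_powR_cvg0].
rewrite -[X in _ --> X](mulr0 K2); apply: cvgM; first exact: cvg_cst.
have D i : `|gam s 0 (spatial i) - xl i| @[s --> Flt] --> (0 : R).
  rewrite -[X in _ --> X](@normr0 _ R) -(subrr (xl i)).
  apply: cvg_norm; apply: cvgB; [exact: position_cvg|exact: cvg_cst].
have := cvgD (cvgD (D o0) (D o1)) (D o2); rewrite !addr0; exact.
Qed.

Let w b i s := time (gam s) `^ (p i - p1) * flux p1 p2 p3 F b i [::] (pt s).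

(** For i > 1, [field_growth] gives O(t^(p_i - p_1 + 2 p_1)) = O(t^(p_i + p_1)), with positive
    exponent. *)
Lemma weighted_flux_cvg b i :
  w b i s @[s --> Flt] --> (if i == o0 then E b [::] (xl o0) (xl o1) (xl o2) else 0).
Proof.
case: eqP => [->|/eqP i0].
  rewrite (_ : (fun s => w b o0 s) = fun s => flux p1 p2 p3 F b o0 [::] (pt s)); first exact: flux_cvg.
  by apply/funext => s; rewrite /w /exponent /= subrr powRr0 mul1r.
have [C C0 HC] := @field_growth R p _ (flux_reduced psum mF) p12 p23 psum p1_lt0 p3_lt1 b i [::] i0.
have q0 : 0 < p i + p1.
  by move: i0; move: i {HC}; apply: ord3_ind => // _; rewrite /exponent /=; move: psum p3_lt1 p23 p12; lra.
apply: (@squeeze_powR _ _ C (p i + p1) 1) => // s Is s0 s1.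
rewrite subr0 /w normrM (ger0_norm (powR_ge0 _ _)).
have H := HC (time (gam s)) (gam s 0 (spatial o0)) (gam s 0 (spatial o1)) (gam s 0 (spatial o2)).
rewrite s0 ltW// in H; apply: le_trans (ler_wpM2l (powR_ge0 _ _) (H isT)) _.
rewrite mulrCA -powRD; last by rewrite (gt_eqF s0) implybT.
by rewrite (_ : p i - p1 + 2 * p o0 = p i + p1)// /exponent /=; ring.
Qed.

Let nu i s := c i * time (gam s) `^ (p3 - p i).
(** Only momenta in directions of largest exponent survive the rescaling; the test on exponents
    includes the case p_2 = p_3, where two of them do. *)
Let nul i : R := if p i == p3 then c i else 0.

Lemma nu_cvg i : nu i s @[s --> Flt] --> nul i.
Proof.
rewrite /nul; case: eqP => [pe|/eqP pe].
  rewrite (_ : (fun s => nu i s) = fun=> c i); first exact: cvg_cst.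
  by apply/funext => s; rewrite /nu pe subrr powRr0 mulr1.
have q0 : 0 < p3 - p i.
  rewrite subr_gt0 lt_neqAle pe /=; move: i {pe}; apply: ord3_ind; rewrite /exponent //=.
  exact: le_trans p23.
rewrite -[X in _ --> X](mulr0 (c i)); apply: cvgM; [exact: cvg_cst|exact: time_powR_cvg0].
Qed.

Let p3_gt0 : 0 < p3. Proof. by move: psum p1_lt0 p23; lra. Qed.

Let nu0 s := lapse c (time (gam s)) * time (gam s) `^ p3.
Let nu0l : R := Num.sqrt (\sum_i nul i ^+ 2).

Lemma sum_nul_gt0 : 0 < \sum_i nul i ^+ 2.
Proof.
rewrite sum3 /nul /exponent /= eqxx ltr_wpDl//; first by rewrite addr_ge0// sqr_ge0.
by rewrite lt_neqAle sqr_ge0 eq_sym sqrf_eq0 c2_neq0.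
Qed.

(** The square of [nu0] is t^(2 p_3) plus the sum of the squares of the [nu i]. Its limit is
    positive as c_3 is nonzero, and there the square root is continuous. *)
Lemma nu0_cvg : nu0 s @[s --> Flt] --> nu0l.
Proof.
have L : ((time (gam s) `^ p3) ^+ 2 + (nu o0 s ^+ 2 + nu o1 s ^+ 2 + nu o2 s ^+ 2)) @[s --> Flt] --> \sum_i nul i ^+ 2.
  rewrite sum3 -[X in _ --> X]add0r -(mulr0 (0 : R)).
  have sq (f : R -> R) (l : R) : f s @[s --> Flt] --> l -> f s ^+ 2 @[s --> Flt] --> l ^+ 2.
    by move=> fl; apply: cvgM.
  apply: cvgD; first by apply: (@cvgM R R) => //; exact: time_powR_cvg0.
  by apply: cvgD; [apply: cvgD|]; apply: sq; exact: nu_cvg.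
have C : {for \sum_i nul i ^+ 2, continuous (@Num.sqrt R)}.
  exact: is_derive_cont (is_derive1_sqrt sum_nul_gt0).
have := @cvg_comp _ _ _ _ (@Num.sqrt R) _ _ _ L C; apply: cvg_trans; apply: near_eq_cvg.
apply: (near_singularity ltr01) => s Is s0 _ /=.
have A0 := powR_ge0 (time (gam s)) p3; have N0 := ltW (lapse_gt0 p1 p2 p3 c (time (gam s))).
rewrite /nu0 -[RHS]ger0_norm ?mulr_ge0// -sqrtr_sqr.
congr Num.sqrt; rewrite [RHS]exprMn lapse_sqr [RHS]mulrDl mul1r sum3; congr (_ + _).
have X i : nu i s ^+ 2 = c i ^+ 2 * time (gam s) `^ (- (2 * p i)) * (time (gam s) `^ p3) ^+ 2.
  rewrite /nu exprMn -mulrA; congr (_ * _).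
  have PD x y : time (gam s) `^ (x + y) = time (gam s) `^ x * time (gam s) `^ y.
    by rewrite powRD ?(gt_eqF s0) ?implybT.
  by rewrite !expr2 -!PD; congr (_ `^ _); ring.
by rewrite !X -!mulrDl.
Qed.

(** In the limit only e_1 and B_1 remain of the fields, while nu_1 tends to 0. Hence the negative
    square vanishes, as does the last term with its factor t^(2 p_3). What is left is a sum of
    squares, positive because c_3 is nonzero and one profile does not vanish at the limiting
    position. *)
Lemma energy_density_blows_up : blows_up_like g F (2 * p2 + 4 * p3) gam I.
Proof.
split; first exact: PF.
pose Ea := E true [::] (xl o0) (xl o1) (xl o2); pose Ba := E false [::] (xl o0) (xl o1) (xl o2).
have K0 : 0 < (4 * pi)^-1 :> R by rewrite invr_gt0 mulr_gt0// pi_gt0.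
exists ((4 * pi)^-1 * (nu0l ^+ 2 * Ea ^+ 2 + (nul o2 ^+ 2 + nul o1 ^+ 2) * Ba ^+ 2)).
  have n2 : 0 < nul o2 ^+ 2.
    by rewrite /nul /exponent /= eqxx lt_neqAle sqr_ge0 eq_sym sqrf_eq0 c2_neq0.
  have n0 : 0 < nu0l ^+ 2 by rewrite exprn_gt0// sqrtr_gt0 sum_nul_gt0.
  have n1 := sqr_ge0 (nul o1); have E2 := sqr_ge0 Ea; have B2 := sqr_ge0 Ba.
  apply: mulr_gt0 => //; case: regular => -[] H.
  - apply: ltr_pwDl; last by rewrite mulr_ge0// addr_ge0// ltW.
    by rewrite mulr_gt0// lt_neqAle E2 eq_sym sqrf_eq0 H.
  - apply: ltr_wpDl; first by rewrite mulr_ge0// ltW.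
    by rewrite mulr_gt0 ?ltr_pwDl// lt_neqAle B2 eq_sym sqrf_eq0 H.
have W0 b : w b o0 s @[s --> Flt] --> E b [::] (xl o0) (xl o1) (xl o2) by exact: weighted_flux_cvg.
have W1 b : w b o1 s @[s --> Flt] --> (0 : R) by have := @weighted_flux_cvg b o1.
have W2 b : w b o2 s @[s --> Flt] --> (0 : R) by have := @weighted_flux_cvg b o2.
have N0 : nu o0 s @[s --> Flt] --> (0 : R).
  have := @nu_cvg o0; rewrite /nul (_ : (p o0 == p3) = false)//.
  by rewrite lt_eqF// /exponent /=; move: p1_lt0 p3_gt0; lra.
have N1 := @nu_cvg o1; have N2 := @nu_cvg o2; have NN := nu0_cvg.
have Tp := time_powR_cvg0 p3_gt0.
have sq (f : R -> R) (l : R) : f s @[s --> Flt] --> l -> f s ^+ 2 @[s --> Flt] --> l ^+ 2.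
  by move=> fl; apply: cvgM.
have M (f h : R -> R) (l m : R) : f s @[s --> Flt] --> l -> h s @[s --> Flt] --> m -> f s * h s @[s --> Flt] --> l * m.
  by move=> fl hm; apply: cvgM.
have A (f h : R -> R) (l m : R) : f s @[s --> Flt] --> l -> h s @[s --> Flt] --> m -> f s + h s @[s --> Flt] --> l + m.
  by move=> fl hm; apply: cvgD.
have O (f : R -> R) (l : R) : f s @[s --> Flt] --> l -> - f s @[s --> Flt] --> - l.
  by move=> fl; apply: cvgN.
have S1 := O _ _ (sq _ _ (A _ _ _ _ (A _ _ _ _ (M _ _ _ _ N0 (W0 true)) (M _ _ _ _ N1 (W1 true))) (M _ _ _ _ N2 (W2 true)))).
have Q0 := sq _ _ (A _ _ _ _ (A _ _ _ _ (M _ _ _ _ NN (W0 true)) (M _ _ _ _ N1 (W2 false))) (O _ _ (M _ _ _ _ N2 (W1 false)))).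
have Q1 := sq _ _ (A _ _ _ _ (A _ _ _ _ (M _ _ _ _ NN (W1 true)) (M _ _ _ _ N2 (W0 false))) (O _ _ (M _ _ _ _ N0 (W2 false)))).
have Q2 := sq _ _ (A _ _ _ _ (A _ _ _ _ (M _ _ _ _ NN (W2 true)) (M _ _ _ _ N0 (W1 false))) (O _ _ (M _ _ _ _ N1 (W0 false)))).
have D b : w b o0 s ^+ 2 + w b o1 s ^+ 2 + w b o2 s ^+ 2 @[s --> Flt] --> E b [::] (xl o0) (xl o1) (xl o2) ^+ 2 + 0 ^+ 2 + 0 ^+ 2.
  exact: A (A _ _ _ _ (sq _ _ (W0 b)) (sq _ _ (W1 b))) (sq _ _ (W2 b)).
have C (k : R) : (fun s : R => k) s @[s --> Flt] --> k by exact: cvg_cst.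
have Q3 := M _ _ _ _ (M _ _ _ _ (C 2^-1) (sq _ _ Tp)) (A _ _ _ _ (D false) (O _ _ (D true))).
have := M _ _ _ _ (C (4 * pi)^-1) (A _ _ _ _ (A _ _ _ _ S1 (A _ _ _ _ (A _ _ _ _ Q0 Q1) Q2)) Q3).
rewrite -/Ea -/Ba.
set l1 := (X in _ --> X -> _); set l2 := (X in _ -> _ --> X).
have -> : l1 = l2.
  by rewrite /l1 /l2; clear; clearbody Ea Ba nu0l nul; move: ((4 * pi)^-1) => K; ring.
apply: cvg_trans; apply: near_eq_cvg; apply: (near_singularity ltr01) => s Is s0 _.
have gE : gam s = to_event (pt s).
  apply/rowP => m; rewrite to_event_entry /pt; move: m; apply: ord4_ind => /=.
  - by rewrite -ord4_zero.
  - by rewrite -spatial_o0.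
  - by rewrite -spatial_o1.
  - by rewrite -spatial_o2.
have v0 := time_velocity geo I0 Is.
have vi i := momentum_conserved geo I0 i Is.
have := @weighted_energy_density R p1 p2 p3 psum F mF c (pt s) (fun m => velocity gam s 0 m) s0 v0 vi.
rewrite -gE /energy_density /= => ->.
rewrite !sum3 /succ3 /=; congr (_ * (_ + _)); congr (_ * _).
rewrite /w /pt /=; move: (flux _ _ _ _ _ _ _ _) (flux _ _ _ _ _ _ _ _) => *; ring.
Qed.

End along_geodesic.
End blow_up.

(** * Null sets of geodesics *)

Section product_sigma_finite.
Context d1 d2 (T1 : measurableType d1) (T2 : measurableType d2) (R : realType).
Variables (m1 : {sigma_finite_measure set T1 -> \bar R}) (m2 : {sigma_finite_measure set T2 -> \bar R}).

(** [lebesgue6] is an iterated product, and the section arguments require sigma-finiteness of each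
    partial product. *)
Lemma product_sigma_finite : sigma_finite setT (m1 \x m2)%E.
Proof.
have [F FT Ff] := sigma_finiteT m1; have [G GT Gf] := sigma_finiteT m2.
exists (fun n => if unpickle n is Some (i, j) then F i `*` G j else set0).
  apply/seteqP; split => // -[x y] _.
  have : [set: T1] x by []. rewrite FT => -[i _ Fx].
  have : [set: T2] y by []. rewrite GT => -[j _ Gy].
  by exists (pickle (i, j)) => //; rewrite pickleK.
move=> n; case: unpickle => [[i j]|]; last by split => //; rewrite measure0.
have [mF fF] := Ff i; have [mG fG] := Gf j; split; first exact: measurableX.
by rewrite product_measure1E// lte_mul_pinfty// ge0_fin_numE.
Qed.
Definition product_sf : {sigma_finite_measure set (T1 * T2)%type -> \bar R} :=
  HB.pack (m1 \x m2)%E (Measure_isSigmaFinite.Build _ _ _ (m1 \x m2)%E product_sigma_finite).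

End product_sigma_finite.

Section null_sets.
Context {R : realType}.
Local Notation mR := (measurableTypeR R).
Local Notation leb := (@lebesgue_measure R).

(** The product measure integrates the measures of x-sections; by uniqueness it equals the one that
    integrates y-sections, for which the claim is immediate. *)
Lemma product_null_ysection d1 d2 (T1 : measurableType d1) (T2 : measurableType d2)
    (m1 : {sigma_finite_measure set T1 -> \bar R}) (m2 : {sigma_finite_measure set T2 -> \bar R})
    (A : set (T1 * T2)) : measurable A ->
  (forall y, m1 (ysection A y) = 0%E) -> (m1 \x m2)%E A = 0%E.
Proof.
move=> mA A0.
rewrite (@product_measure_unique _ _ _ _ _ m1 m2 (m1 \x^ m2)%E)//; last first.
  by move=> B C mB mC; exact: product_measure2E.
by apply: integral0_eq => y _; exact: A0.
Qed.

Lemma product_null_xsection d1 d2 (T1 : measurableType d1) (T2 : measurableType d2)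
    (m1 : {sigma_finite_measure set T1 -> \bar R}) (m2 : {sigma_finite_measure set T2 -> \bar R})
    (A : set (T1 * T2)) :
  (forall x, m2 (xsection A x) = 0%E) -> (m1 \x m2)%E A = 0%E.
Proof. by move=> A0; apply: integral0_eq => x _; exact: A0. Qed.

(** f is the pointwise limit of the functions obtained by rounding y down to the grid of mesh 1 / (n
    + 1). These are measurable since the rounded y takes countably many values. *)
Lemma caratheodory_fun_measurable d (T : measurableType d) (f : T * mR -> R) :
  (forall y, measurable_fun setT (fun x => f (x, y))) ->
  (forall x, continuous (fun y : R => f (x, y))) -> measurable_fun setT f.
Proof.
move=> mf cf.
pose node (n : nat) (y : R) : R := (Num.floor (y * n.+1%:R))%:~R / n.+1%:R.
apply: (@measurable_realfun.measurable_fun_cvg _ _ _ _ (fun n (z : T * mR) => f (z.1, node n z.2))); last first.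
  move=> [x y] _ /=.
  apply: (@cvg_comp _ _ _ (fun n => node n y) (fun y => f (x, y)) _ (nbhs y)); last exact: cf.
  apply/cvgrPdist_le => e e0.
  near=> n; rewrite /node.
  have n0 : 0 < n.+1%:R :> R by rewrite ltr0n.
  have /andP[f1 f2] := Num.Theory.floor_itv (y * n.+1%:R); rewrite intrD in f2.
  have -> : y - (Num.floor (y * n.+1%:R))%:~R / n.+1%:R = (y * n.+1%:R - (Num.floor (y * n.+1%:R))%:~R) / n.+1%:R.
    by rewrite mulrBl mulfK// gt_eqF.
  rewrite normrM ger0_norm ?subr_ge0// normfV gtr0_norm// ler_pdivrMr//.
  have h1 : 1 <= e * n.+1%:R.
    rewrite mulrC -ler_pdivrMr// div1r.
    have := near (nbhs_infty_ge (Num.truncn e^-1)) n => /(_ _) H.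
    have : (Num.truncn e^-1 <= n)%N by apply: H.
    move=> H2; apply: ltW; apply: lt_le_trans (Num.Theory.truncnS_gt _) _.
    by rewrite ler_nat ltnS.
  lra.
move=> n _ Y mY; rewrite setTI.
have -> : (fun z : T * mR => f (z.1, node n z.2)) @^-1` Y =
  \bigcup_(k : int) ([set x | Y (f (x, k%:~R / n.+1%:R))] `*` [set y : R | Num.floor (y * n.+1%:R) = k]).
  apply/seteqP; split => [[x y] /= H|[x y] [k _ []] /= H E]; last by rewrite /node E.
  by exists (Num.floor (y * n.+1%:R)).
apply: countable_bigcupT_measurable; first exact: countableP.
move=> k; apply: measurableX.
  by have := mf (k%:~R / n.+1%:R) measurableT _ mY; rewrite setTI.
rewrite (_ : [set y | _] = `[(k%:~R / n.+1%:R : R), ((k + 1)%:~R / n.+1%:R : R)[%classic).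
  exact: measurable_itv.
have n0 : 0 < n.+1%:R :> R by rewrite ltr0n.
apply/seteqP; split => [y /= <-|y /=]; rewrite in_itv /=.
  by rewrite ler_pdivrMr// ltr_pdivlMr// Num.Theory.floor_itv.
by rewrite ler_pdivrMr// ltr_pdivlMr// => /andP[h1 h2]; apply: Num.Theory.floor_def; rewrite h1.
Unshelve. all: by end_near. Qed.

(** Two distinct zeros x, y satisfy |df x| <= K |y - x|. Zeros with |df x| > K / (n + 1) are
    therefore more than 1 / (n + 1) apart, and the floor of (n + 1) x is injective on them. *)
Lemma countable_simple_zeros (f df : R -> R) (K : R) : 0 <= K ->
  (forall x y, `|f y - f x - df x * (y - x)| <= K * `|y - x| ^+ 2) ->
  countable [set x | f x = 0 /\ df x != 0].
Proof.
move=> K0 H.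
pose S (n : nat) := [set x | f x = 0 /\ K / n.+1%:R < `|df x|].
apply: (@sub_countable _ _ _ (\bigcup_n S n)).
  apply: subset_card_le => x /= [fx dfx]; have d0 : 0 < `|df x| by rewrite normr_gt0.
  exists (Num.truncn (K / `|df x|)) => //; split => //.
  have n0 : 0 < (Num.truncn (K / `|df x|)).+1%:R :> R by rewrite ltr0n.
  rewrite ltr_pdivrMr// mulrC -ltr_pdivrMr//; exact: Num.Theory.truncnS_gt.
apply: bigcup_countable => [|n _]; first exact: countableP.
apply/countable_injP; exists (fun x => pickle (Num.floor (x * n.+1%:R))).
move=> x y; rewrite !inE /= => -[fx dx] [fy dy] /(pcan_inj pickleK) E.
apply/eqP; rewrite -subr_eq0; apply/negPn/negP => xy.
have n0 : 0 < n.+1%:R :> R by rewrite ltr0n.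
have /andP[x1 x2] := Num.Theory.floor_itv (x * n.+1%:R); rewrite intrD in x2.
have /andP[y1 y2] := Num.Theory.floor_itv (y * n.+1%:R); rewrite intrD in y2.
rewrite E in x1 x2.
have D : `|x - y| * n.+1%:R <= 1.
  rewrite -[X in _ * X](gtr0_norm n0) -normrM mulrBl ler_norml; apply/andP; split; lra.
have := H y x; rewrite fx fy subrr sub0r normrN normrM expr2 mulrA => H1.
have xy0 : 0 < `|x - y| by rewrite normr_gt0.
rewrite ler_pM2r// in H1.
have : K / n.+1%:R < K * `|x - y| by exact: lt_le_trans dy H1.
rewrite ltr_pdivrMr// -mulrA => H2.
have := ler_wpM2l K0 D; lra.
Qed.

Lemma lebesgue_simple_zeros (f df : R -> R) (K : R) : 0 <= K ->
  (forall x y, `|f y - f x - df x * (y - x)| <= K * `|y - x| ^+ 2) ->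
  leb [set x | f x = 0 /\ df x != 0] = 0%E.
Proof. by move=> K0 H; apply: countable_lebesgue_measure0; exact: countable_simple_zeros K0 H. Qed.

Local Notation mR6 := (mR * mR * mR * mR * mR * mR)%type.

Let leb2 : {sigma_finite_measure set (mR * mR)%type -> \bar R} := product_sf leb leb.
Let leb3 : {sigma_finite_measure set (mR * mR * mR)%type -> \bar R} := product_sf leb2 leb.
Let leb4 : {sigma_finite_measure set (mR * mR * mR * mR)%type -> \bar R} := product_sf leb3 leb.
Let leb5 : {sigma_finite_measure set (mR * mR * mR * mR * mR)%type -> \bar R} := product_sf leb4 leb.

(** The velocity is frozen, which leaves slices in the base point. *)
Let lebesgue6_null (A : set mR6) : measurable A ->
  (forall x y z, leb3 [set p | A (p, x, y, z)] = 0%E) -> lebesgue6 A = 0%E.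
Proof.
move=> mA H.
apply: (@product_null_ysection _ _ _ _ leb5 leb A mA) => z.
have {}mA := measurable_ysection z mA; apply: (@product_null_ysection _ _ _ _ leb4 leb _ mA) => y.
have {}mA := measurable_ysection y mA; apply: (@product_null_ysection _ _ _ _ leb3 leb _ mA) => x.
rewrite -(H x y z); congr (leb3 _).
by rewrite !ysectionE.
Qed.

Let measurable_slice (A : set mR6) x y z : measurable A -> measurable [set p | A (p, x, y, z)].
Proof.
move=> mA; have {}mA := measurable_ysection x (measurable_ysection y (measurable_ysection z mA)).
rewrite (_ : [set p | _] = ysection (ysection (ysection A z) y) x)//.
by rewrite !ysectionE.
Qed.

(** Fubini along lines parallel to the first axis of the base point; the two lemmas after it treat
    the other two axes. *)
Lemma lebesgue6_null0 (A : set mR6) : measurable A ->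
  (forall b c x y z, leb [set a | A (a, b, c, x, y, z)] = 0%E) -> lebesgue6 A = 0%E.
Proof.
move=> mA H; apply: lebesgue6_null => // x y z; have {}mA := measurable_slice x y z mA.
apply: (@product_null_ysection _ _ _ _ leb2 leb _ mA) => c.
have {}mA := measurable_ysection c mA; apply: (@product_null_ysection _ _ _ _ leb leb _ mA) => b.
rewrite -(H b c x y z); congr (leb _).
by rewrite !ysectionE.
Qed.

Lemma lebesgue6_null1 (A : set mR6) : measurable A ->
  (forall a c x y z, leb [set b | A (a, b, c, x, y, z)] = 0%E) -> lebesgue6 A = 0%E.
Proof.
move=> mA H; apply: lebesgue6_null => // x y z; have {}mA := measurable_slice x y z mA.
apply: (@product_null_ysection _ _ _ _ leb2 leb _ mA) => c.
apply: (@product_null_xsection _ _ _ _ leb leb) => a.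
rewrite -(H a c x y z); congr (leb _).
by rewrite xsectionE ?ysectionE.
Qed.

Lemma lebesgue6_null2 (A : set mR6) : measurable A ->
  (forall a b x y z, leb [set c | A (a, b, c, x, y, z)] = 0%E) -> lebesgue6 A = 0%E.
Proof.
move=> mA H; apply: lebesgue6_null => // x y z.
apply: (@product_null_xsection _ _ _ _ leb2 leb) => -[a b].
rewrite -(H a b x y z); congr (leb _).
by rewrite xsectionE.
Qed.

(** These are the geodesics whose momentum c_3 vanishes. *)
Lemma lebesgue6_hyperplane : lebesgue6 [set z : mR6 | z.2 = 0] = 0%E.
Proof.
apply: (@product_null_xsection _ _ _ _ leb5 leb) => z.
rewrite (_ : xsection _ _ = [set (0 : R)]); first exact: lebesgue_measure_set1.
by rewrite xsectionE.
Qed.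

End null_sets.

(** * Measurability of the limiting position and the exceptional geodesics *)

Section almost_every_geodesic.
Context {R : realType}.
Local Notation mR := (measurableTypeR R).
Local Notation mR6 := (mR * mR * mR * mR * mR * mR)%type.

(** Measurability refers to the product sigma-algebra, so it is built up by adding one variable at a
    time. *)
Lemma continuous3_measurable (f : R * R * R -> R) : continuous f ->
  measurable_fun setT (f : mR * mR * mR -> R).
Proof.
move=> cf; apply: (@caratheodory_fun_measurable R _ (mR * mR)%type (f : (mR * mR) * mR -> R)) => [c|z]; last first.
  by move=> c; exact: (@cont_section (R * R)%type R R f z c (cf (z, c))).
apply: (@caratheodory_fun_measurable R _ mR (fun z : mR * mR => f (z, c))) => [b|a].
- apply: measurable_realfun.continuous_measurable_fun => a.
  apply: (@continuous_comp _ _ _ (fun a => (a, b, c)) f); last exact: cf.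
  by apply: cont_pair; [apply: cont_pair; [exact: cvg_id|exact: cvg_cst]|exact: cvg_cst].
- move=> b; apply: (@continuous_comp _ _ _ (fun b => (a, b, c)) f); last exact: cf.
  by apply: cont_pair; [apply: cont_pair; [exact: cvg_cst|exact: cvg_id]|exact: cvg_cst].
Qed.

Lemma cont_fst11 (z : R * R * R) : {for z, continuous (fun z : R * R * R => z.1.1)}.
Proof. by apply: (@continuous_comp _ _ _ (fun z : R * R * R => z.1) fst); exact: cvg_fst. Qed.

Lemma cont_snd12 (z : R * R * R) : {for z, continuous (fun z : R * R * R => z.1.2)}.
Proof. by apply: (@continuous_comp _ _ _ (fun z : R * R * R => z.1) snd); [exact: cvg_fst|exact: cvg_snd]. Qed.

Lemma cont_snd2 (z : R * R * R) : {for z, continuous (fun z : R * R * R => z.2)}.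
Proof. exact: cvg_snd. Qed.

Lemma lipschitz_continuous (f : R -> R -> R -> R) (K : R) :
  (forall a b c a' b' c', `|f a' b' c' - f a b c| <= K * dist1 a b c a' b' c') ->
  continuous (fun z : R * R * R => f z.1.1 z.1.2 z.2).
Proof.
move=> H z.
pose h (y : R * R * R) := K * (`|y.1.1 - z.1.1| + `|y.1.2 - z.1.2| + `|y.2 - z.2|).
have ch : h y @[y --> z] --> (0 : R).
  rewrite -[X in _ --> X](mulr0 K) /h; apply: cvgM; first exact: cvg_cst.
  have N (k : R * R * R -> R) : {for z, continuous k} -> `|k y - k z| @[y --> z] --> (0 : R).
    move=> ck; rewrite -[X in _ --> X](@normr0 _ R) -(subrr (k z)).
    by apply: cvg_norm; apply: cvgB; [exact: ck|exact: cvg_cst].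
  have := cvgD (cvgD (N _ (@cont_fst11 z)) (N _ (@cont_snd12 z))) (N _ (@cont_snd2 z)).
  by rewrite !addr0; exact.
apply/cvgrPdist_le => e e0.
have N : \forall y \near z, `|0 - h y| <= e by move/cvgrPdist_le : ch; exact.
apply: filterS N => y; rewrite sub0r normrN => hy.
rewrite distrC; apply: le_trans (H _ _ _ _ _ _) _.
exact: le_trans (ler_norm _) hy.
Qed.

Variables p1 p2 p3 : R.
Hypothesis psum : p1 + p2 + p3 = 1.
Hypothesis p1_lt0 : p1 < 0.
Hypothesis p12 : p1 <= p2.
Hypothesis p23 : p2 <= p3.
Hypothesis p3_lt1 : p3 < 1.
Local Notation p := (exponent p1 p2 p3).
Local Notation g := (kasner p1 p2 p3).
Local Notation lapse := (lapse p1 p2 p3).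
Local Notation drift := (drift p1 p2 p3).

Variable T : R.
Hypothesis T0 : 0 < T.

Definition initial_momentum (w : R * R * R) (i : 'I_3) : R :=
  T `^ (2 * p i) * vec3 w.1.1 w.1.2 w.2 0 i.

Lemma drift_limit_exists (w : R * R * R) i : exists Phi, forall t, 0 < t < T ->
  `|integ t T (drift (initial_momentum w) i) - Phi| <= (1 - p i)^-1 * t `^ (1 - p i).
Proof. exact: drift_integral_limit. Qed.

Definition total_drift i (w : R * R * R) : R := projT1 (cid (drift_limit_exists w i)).

Lemma total_driftP i w t : 0 < t < T ->
  `|integ t T (drift (initial_momentum w) i) - total_drift i w| <= (1 - p i)^-1 * t `^ (1 - p i).
Proof. by rewrite /total_drift; case: cid => L /= H; exact: H. Qed.

Lemma cont_initial_momentum i (w : R * R * R) :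
  {for w, continuous (fun w : R * R * R => initial_momentum w i)}.
Proof.
apply: cvgM; first exact: cvg_cst.
move: i; apply: ord3_ind; rewrite /prop_for /continuous_at mxE /=.
- by under eq_cvg do rewrite mxE /=; exact: cont_fst11.
- by under eq_cvg do rewrite mxE /=; exact: cont_snd12.
- by under eq_cvg do rewrite mxE /=; exact: cont_snd2.
Qed.

Lemma cont_drift_joint i (w : R * R * R) (r : R) : 0 < r ->
  {for (w, r), continuous (fun z : (R * R * R) * R => drift (initial_momentum z.1) i z.2)}.
Proof.
move=> r0.
have cm j : {for (w, r), continuous (fun z : (R * R * R) * R => initial_momentum z.1 j)}.
  apply: (@continuous_comp _ _ _ (@fst (R * R * R)%type R) (fun w => initial_momentum w j)).
    exact: cvg_fst.
  exact: cont_initial_momentum.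
have cp q : {for (w, r), continuous (fun z : (R * R * R) * R => z.2 `^ q)}.
  apply: (@continuous_comp _ _ _ (@snd (R * R * R)%type R) (fun r => r `^ q)).
    exact: cvg_snd.
  exact: cont_powR.
have cmp j : {for (w, r), continuous (fun z : (R * R * R) * R => initial_momentum z.1 j ^+ 2 * z.2 `^ (- (2 * p j)))}.
  by apply: cvgM; [apply: cvgM; exact: cm|exact: cp].
have cN : {for (w, r), continuous (fun z : (R * R * R) * R => lapse (initial_momentum z.1) z.2)}.
  apply: (@continuous_comp _ _ _
    (fun z : (R * R * R) * R => 1 + \sum_j initial_momentum z.1 j ^+ 2 * z.2 `^ (- (2 * p j))) (@Num.sqrt R)).
    rewrite (_ : (fun z => _) = fun z : (R * R * R) * R => 1 + (initial_momentum z.1 o0 ^+ 2 * z.2 `^ (- (2 * p o0)) +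
      initial_momentum z.1 o1 ^+ 2 * z.2 `^ (- (2 * p o1)) + initial_momentum z.1 o2 ^+ 2 * z.2 `^ (- (2 * p o2)))).
      by apply: cvgD; [exact: cvg_cst|apply: cvgD; [apply: cvgD; exact: cmp|exact: cmp]].
    by apply/funext => z; rewrite sum3.
  apply: is_derive_cont; apply: is_derive1_sqrt; exact: lt_le_trans ltr01 (lapse_arg_ge1 _ _ _ _ _).
apply: cvgM; first by apply: cvgM; [exact: cm|exact: cp].
by apply: cvgV; [exact: lt0r_neq0 (lapse_gt0 _ _ _ _ _)|exact: cN].
Qed.

(** The drift integral from a positive time is continuous in the velocity, and [total_drift] is the
    pointwise limit of such integrals. *)
Lemma measurable_total_drift i : measurable_fun setT (total_drift i : mR * mR * mR -> R).
Proof.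
(* The denominator starts at 2 so that t n < T already for n = 0. *)
pose t n : R := T / n.+2%:R.
have t0 n : 0 < t n by rewrite divr_gt0// ltr0n.
have tT n : t n < T by rewrite ltr_pdivrMr ?ltr0n// ltr_pMr// ltr1n.
have q0 : 0 < 1 - p i by rewrite subr_gt0; exact: exponent_lt1.
apply: (@measurable_realfun.measurable_fun_cvg _ _ _ _ (fun n w => integ (t n) T (drift (initial_momentum w) i))).
  move=> n; apply: continuous3_measurable => w.
  apply: (@cont_integ R (t n) T (tT n) _ (fun z => drift (initial_momentum z.1) i z.2)).
  apply: (@filterE _ (nbhs (w : (R * R * R)%type)) _) => w' y /andP[ty _]; apply: cont_drift_joint; exact: lt_le_trans ty.
move=> w _ /=.
have ct : t n @[n --> \oo] --> (0 : R)^'+.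
  move=> A [d /= d0 dA].
  exists (Num.truncn (T / d)) => //= n; rewrite /mkset => hn; apply: dA; last exact: t0.
  rewrite /= sub0r normrN gtr0_norm// /t ltr_pdivrMr ?ltr0n// mulrC -ltr_pdivrMr//.
  apply: lt_le_trans (Num.Theory.truncnS_gt _) _.
  by rewrite ler_nat ltnS leqW.
have cp : (t n) `^ (1 - p i) @[n --> \oo] --> (0 : R).
  by apply: (@cvg_comp _ _ _ t (fun t => t `^ (1 - p i)) _ (0^'+)); [exact: ct|exact: powR_cvg0].
have ck : (1 - p i)^-1 * (t n) `^ (1 - p i) @[n --> \oo] --> (0 : R).
  by rewrite -[X in _ --> X](mulr0 (1 - p i)^-1); apply: cvgM; [exact: cvg_cst|exact: cp].
apply/cvgrPdist_le => e e0.
have N : \forall n \near \oo, `|0 - (1 - p i)^-1 * (t n) `^ (1 - p i)| <= e.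
  by move/cvgrPdist_le : ck; exact.
apply: filterS N => n; rewrite sub0r normrN => hn.
rewrite distrC; apply: le_trans (total_driftP _ _ _) _; first by rewrite t0 tT.
exact: le_trans (ler_norm _) hn.
Qed.

Variables (F : 'rV[R]_4 -> 'M[R]_4) (E : bool -> seq 'I_3 -> R -> R -> R -> R).
Hypothesis mF : maxwell_solution g F.
Hypothesis hE : is_profile (1 - p3) (flux p1 p2 p3 F) E.
Hypothesis regular : forall a b c,
  (exists s, E s [::] a b c != 0) \/ (exists s j, E s [:: j] a b c != 0).

Definition endpoint (i : 'I_3) (z : mR6) : R :=
  vec3 z.1.1.1.1.1 z.1.1.1.1.2 z.1.1.1.2 0 i + total_drift i (z.1.1.2, z.1.2, z.2).

Lemma measurable_endpoint i : measurable_fun setT (endpoint i).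
Proof.
have m1 : measurable_fun setT (fun z : mR6 => z.1) by exact: measurable_fst.
have m11 : measurable_fun setT (fun z : mR6 => z.1.1) by exact: measurableT_comp m1.
have m111 : measurable_fun setT (fun z : mR6 => z.1.1.1) by exact: measurableT_comp m11.
have m1111 : measurable_fun setT (fun z : mR6 => z.1.1.1.1) by exact: measurableT_comp m111.
have m11111 : measurable_fun setT (fun z : mR6 => z.1.1.1.1.1) by exact: measurableT_comp m1111.
have m11112 : measurable_fun setT (fun z : mR6 => z.1.1.1.1.2) by exact: measurableT_comp m1111.
have m1112 : measurable_fun setT (fun z : mR6 => z.1.1.1.2) by exact: measurableT_comp m111.
have m112 : measurable_fun setT (fun z : mR6 => z.1.1.2) by exact: measurableT_comp m11.
have m12 : measurable_fun setT (fun z : mR6 => z.1.2) by exact: measurableT_comp m1.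
have m2 : measurable_fun setT (fun z : mR6 => z.2) by exact: measurable_snd.
apply: measurable_realfun.measurable_funD; last first.
  apply: (measurableT_comp (measurable_total_drift i)).
  by apply: measurable_fun_pair => //; exact: measurable_fun_pair.
move: i; apply: ord3_ind.
- by rewrite (_ : (fun z : mR6 => _) = fun z : mR6 => z.1.1.1.1.1)//; apply/funext => z; rewrite mxE.
- by rewrite (_ : (fun z : mR6 => _) = fun z : mR6 => z.1.1.1.1.2)//; apply/funext => z; rewrite mxE.
- by rewrite (_ : (fun z : mR6 => _) = fun z : mR6 => z.1.1.1.2)//; apply/funext => z; rewrite mxE.
Qed.

Lemma measurable_profile_endpoint s l :
  measurable_fun setT (fun z : mR6 => E s l (endpoint o0 z) (endpoint o1 z) (endpoint o2 z)).
Proof.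
have [K K0 H] := profile_lipschitz hE s l.
have mE := continuous3_measurable (lipschitz_continuous H).
refine (@measurableT_comp _ _ _ mR6 (mR * mR * mR)%type _ (fun z : mR * mR * mR => E s l z.1.1 z.1.2 z.2) setT (fun z => (endpoint o0 z, endpoint o1 z, endpoint o2 z)) mE _).
by apply: measurable_fun_pair; [apply: measurable_fun_pair|]; exact: measurable_endpoint.
Qed.

(* The j-th coordinate of the base point only translates the j-th coordinate of the endpoint, so that
   the sections of this set along that axis are countable. *)
Definition degenerate_set s j : set mR6 := [set z |
  E s [::] (endpoint o0 z) (endpoint o1 z) (endpoint o2 z) = 0 /\
  E s [:: j] (endpoint o0 z) (endpoint o1 z) (endpoint o2 z) != 0].

Lemma measurable_degenerate_set s j : measurable (degenerate_set s j).
Proof.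
have m0 := measurable_profile_endpoint s [::]; have m1 := measurable_profile_endpoint s [:: j].
rewrite (_ : degenerate_set s j =
  (fun z : mR6 => E s [::] (endpoint o0 z) (endpoint o1 z) (endpoint o2 z)) @^-1` [set 0] `&`
  (fun z : mR6 => E s [:: j] (endpoint o0 z) (endpoint o1 z) (endpoint o2 z)) @^-1` (~` [set 0])); last first.
  by apply/seteqP; split => z /= [z1 /eqP z2].
apply: measurableI.
  by have := m0 measurableT [set 0] (measurable_set1 _); rewrite setTI.
by have := m1 measurableT (~` [set 0]) (measurableC (measurable_set1 _)); rewrite setTI.
Qed.

(** Along a line in direction j the Taylor estimate loses its other two linear terms and becomes the
    hypothesis of [lebesgue_simple_zeros]. *)
Lemma degenerate_set_null s j : lebesgue6 (degenerate_set s j) = 0%E.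
Proof.
have [K K0 HK] := profile_taylor hE.
have mD := measurable_degenerate_set s j; move: j mD; apply: ord3_ind => mD.
- apply: lebesgue6_null0 => // b c x y z.
  pose f a := E s [::] (a + total_drift o0 (x, y, z)) (b + total_drift o1 (x, y, z)) (c + total_drift o2 (x, y, z)).
  pose df a := E s [:: o0] (a + total_drift o0 (x, y, z)) (b + total_drift o1 (x, y, z)) (c + total_drift o2 (x, y, z)).
  rewrite (_ : [set a | _] = [set a | f a = 0 /\ df a != 0]); last first.
    by apply/seteqP; split => a; rewrite /degenerate_set /endpoint /= !mxE.
  apply: (lebesgue_simple_zeros K0) => u v.
  have := HK s (u + total_drift o0 (x, y, z)) (b + total_drift o1 (x, y, z)) (c + total_drift o2 (x, y, z))
    (v + total_drift o0 (x, y, z)) (b + total_drift o1 (x, y, z)) (c + total_drift o2 (x, y, z)).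
  rewrite /dist1 !subrr normr0 !mulr0 !addr0 -/(f u) -/(f v) -/(df u).
  by rewrite (_ : v + _ - _ = v - u)//; ring.
- apply: lebesgue6_null1 => // b c x y z.
  pose f a := E s [::] (b + total_drift o0 (x, y, z)) (a + total_drift o1 (x, y, z)) (c + total_drift o2 (x, y, z)).
  pose df a := E s [:: o1] (b + total_drift o0 (x, y, z)) (a + total_drift o1 (x, y, z)) (c + total_drift o2 (x, y, z)).
  rewrite (_ : [set a | _] = [set a | f a = 0 /\ df a != 0]); last first.
    by apply/seteqP; split => a; rewrite /degenerate_set /endpoint /= !mxE.
  apply: (lebesgue_simple_zeros K0) => u v.
  have := HK s (b + total_drift o0 (x, y, z)) (u + total_drift o1 (x, y, z)) (c + total_drift o2 (x, y, z))
    (b + total_drift o0 (x, y, z)) (v + total_drift o1 (x, y, z)) (c + total_drift o2 (x, y, z)).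
  rewrite /dist1 !subrr normr0 !mulr0 !addr0 !add0r -/(f u) -/(f v) -/(df u).
  by rewrite (_ : v + _ - _ = v - u)//; ring.
- apply: lebesgue6_null2 => // b c x y z.
  pose f a := E s [::] (b + total_drift o0 (x, y, z)) (c + total_drift o1 (x, y, z)) (a + total_drift o2 (x, y, z)).
  pose df a := E s [:: o2] (b + total_drift o0 (x, y, z)) (c + total_drift o1 (x, y, z)) (a + total_drift o2 (x, y, z)).
  rewrite (_ : [set a | _] = [set a | f a = 0 /\ df a != 0]); last first.
    by apply/seteqP; split => a; rewrite /degenerate_set /endpoint /= !mxE.
  apply: (lebesgue_simple_zeros K0) => u v.
  have := HK s (b + total_drift o0 (x, y, z)) (c + total_drift o1 (x, y, z)) (u + total_drift o2 (x, y, z))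
    (b + total_drift o0 (x, y, z)) (c + total_drift o1 (x, y, z)) (v + total_drift o2 (x, y, z)).
  rewrite /dist1 !subrr normr0 !mulr0 !addr0 !add0r -/(f u) -/(f v) -/(df u).
  by rewrite (_ : v + _ - _ = v - u)//; ring.
Qed.

Lemma almost_every_geodesic_blows_up :
  almost_every_timelike_geodesic g T (blows_up_like g F (2 * p2 + 4 * p3)).
Proof.
rewrite /almost_every_timelike_geodesic.
have hyp : lebesgue6.-negligible [set z : mR6 | z.2 = 0].
  exists [set z : mR6 | z.2 = 0]; split => //; last exact: lebesgue6_hyperplane.
  have := @measurable_snd _ _ (mR * mR * mR * mR * mR)%type mR measurableT [set (0 : R)] (measurable_set1 _).
  by rewrite setTI.
have deg s j : lebesgue6.-negligible (degenerate_set s j).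
  exists (degenerate_set s j); split => //; [exact: measurable_degenerate_set|exact: degenerate_set_null].
(* Outside these seven sets c_3 is nonzero, and a zero of one profile at the endpoint makes all its
   first derivatives vanish there. By regularity the two profiles cannot both be zero. *)
have N := negligibleU hyp (negligibleU (negligibleU (negligibleU (deg true o0) (deg true o1)) (deg true o2))
  (negligibleU (negligibleU (deg false o0) (deg false o1)) (deg false o2))).
apply: negligibleS N => -[[[[[x1 x2] x3] w1] w2] w3] /=.
apply: contra_notP => /not_orP[w30 nodeg] gam I ig I0 g0 v0.
have nodeg' s j : ~ degenerate_set s j (x1, x2, x3, w1, w2, w3).
  move=> D; apply: nodeg; case: s D; move: j; apply: ord3_ind => D;
    by [left; left; left|left; left; right|left; right|right; left; left|right; left; right|right; right].
have gE : gam 0 = to_event (T, x1, x2, x3) by [].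
have tE : time (gam 0) = T by rewrite gE time_to_event.
have mE : momentum p1 p2 p3 gam = initial_momentum (w1, w2, w3).
  by apply/funext => i; rewrite /momentum /initial_momentum tE v0.
have xE i : gam 0 0 (spatial i) = vec3 x1 x2 x3 0 i.
  rewrite gE to_event_entry mxE; move: i.
  by apply: ord3_ind; rewrite ?spatial_o0 ?spatial_o1 ?spatial_o2.
apply: (@energy_density_blows_up R p1 p2 p3 psum p1_lt0 p12 p23 p3_lt1 F E mF hE gam I
  (fun i => total_drift i (w1, w2, w3)) ig I0).
- by move=> i t; rewrite tE mE; exact: total_driftP.
- rewrite mE /initial_momentum mxE /= mulf_neq0//; first by rewrite gt_eqF// powR_gt0.
  exact/eqP.
- apply: contrapT => /forallNP H.
  have E0 s : E s [::] (endpoint o0 (x1, x2, x3, w1, w2, w3)) (endpoint o1 (x1, x2, x3, w1, w2, w3))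
      (endpoint o2 (x1, x2, x3, w1, w2, w3)) = 0.
    by have /negP := H s; rewrite negbK !xE => /eqP.
  have [[s]|[s [j Ej]]] := regular (endpoint o0 (x1, x2, x3, w1, w2, w3)) (endpoint o1 (x1, x2, x3, w1, w2, w3))
      (endpoint o2 (x1, x2, x3, w1, w2, w3)).
    by rewrite E0 eqxx.
  by apply: (nodeg' s j).
Qed.

End almost_every_geodesic.

(** * Generic initial data *)

Section data_topology.
Context {R : realType}.
Implicit Types (D : data_space R) (a b : 'I_4) (l : seq 'I_3) (e : R).

Definition data_partial D a b l : 'rV[R]_3 -> R := iter_partial l (component (val D) a b).

Lemma near_data_partial D a b l e : 0 < e ->
  \forall D' \near D, forall x, `|data_partial D' a b l x - data_partial D a b l x| <= e.
Proof.
move=> e0.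
pose S : set {uniform 'rV[R]_3 -> R} := [set h | forall x, `|h x - data_partial D a b l x| <= e].
have N : nbhs (jet D (a, b, l)) S.
  apply/uniform_nbhs; exists [set xy | ball xy.1 e xy.2]; split; first by rewrite -entourage_from_ballE; exists e.
  by move=> h /= H x; rewrite distrC; apply: ltW; exact: H.
have := @proj_continuous _ (fun=> {uniform 'rV[R]_3 -> R}) (a, b, l) (jet D) _ N.
exact: (@initial_continuous _ _ (@jet R) D).
Qed.

Lemma near_data_partials D (L : seq (seq 'I_3)) e : 0 < e ->
  \forall D' \near D, forall a b l, l \in L -> forall x,
    `|data_partial D' a b l x - data_partial D a b l x| <= e.
Proof.
move=> e0; elim: L => [|l L IH]; first by apply: filterE.
have N : \forall D' \near D, forall a b x,
    `|data_partial D' a b l x - data_partial D a b l x| <= e.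
  apply: (@filter_forall (data_space R) 'I_4 (fun a D' => forall b x,
    `|data_partial D' a b l x - data_partial D a b l x| <= e) (nbhs D) (nbhs_filter D)) => a.
  apply: (@filter_forall (data_space R) 'I_4 (fun b D' => forall x,
    `|data_partial D' a b l x - data_partial D a b l x| <= e) (nbhs D) (nbhs_filter D)) => b.
  exact: near_data_partial.
apply: filterS2 N IH => D' H1 H2 a b m; rewrite inE => /orP[/eqP ->|]; first exact: H1.
exact: H2.
Qed.

(** The topology is initial, so convergence of the jets is enough; that is checked one component and
    one multi-index at a time. *)
Lemma cvg_data (T : Type) (F : set_system T) {FF : Filter F} (D_ : T -> data_space R) D :
  (forall a b l e, 0 < e -> \forall t \near F, forall x,
    `|data_partial (D_ t) a b l x - data_partial D a b l x| <= e) -> D_ @ F --> D.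
Proof.
move=> H.
have J : (jet \o D_) @ F --> jet D.
  apply/cvg_sup => -[[a b] l] U [_ [[/= C oC <-] CD CU]].
  have : nbhs (jet D (a, b, l)) C by exact: open_nbhs_nbhs.
  move=> /uniform_nbhs[S [/=]]; rewrite -entourage_from_ballE => -[e /= e0 eS] SC.
  have e2 : 0 < e / 2 by rewrite divr_gt0.
  have := H a b l (e / 2) e2; apply: filterS => t Ht.
  apply: CU; apply: SC => x _; apply: eS; rewrite /ball /= distrC.
  by apply: le_lt_trans (Ht x) _; rewrite ltr_pdivrMr// ltr_pMr// ltr1n.
move=> U [_ [[/= C oC <-] CD CU]].
have : nbhs (jet D) C by exact: open_nbhs_nbhs.
by move=> /J JC; apply: (@filterS _ F FF ((jet \o D_) @^-1` C) _ _ JC) => t Ht; exact: CU.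
Qed.

End data_topology.

Section translation.
Context {R : realType} {n : nat}.
Implicit Types (f : 'rV[R]_n -> R) (c : R).

Lemma partial_addC i f c : partial i (fun x => f x + c) = partial i f.
Proof.
apply/funext => x; rewrite /partial /derive.
rewrite (_ : (fun h : R => h^-1 *: (((fun x => f x + c) \o shift x) (h *: delta_mx 0 i) - (f x + c))) =
  (fun h : R => h^-1 *: ((f \o shift x) (h *: delta_mx 0 i) - f x)))//.
by apply/funext => h /=; rewrite opprD addrACA subrr addr0.
Qed.

Lemma iter_partial_addC l f c :
  iter_partial l (fun x => f x + c) = fun x => iter_partial l f x + (if nilp l then c else 0).
Proof.
elim: l => [//|i l IH] /=; rewrite IH partial_addC.
by apply/funext => x; rewrite addr0.
Qed.

Lemma smooth_on_addC U f c : smooth_on U f -> smooth_on U (fun x => f x + c).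
Proof.
move=> sf l x Ux; have [cf df] := sf l x Ux; rewrite iter_partial_addC; split.
  have := @cvgD R R _ (nbhs x) _ (iter_partial l f) (fun=> if nilp l then c else 0) _ _ cf (cvg_cst _).
  exact.
by move=> i; apply: derivableD; [exact: df|exact: derivable_cst].
Qed.

End translation.

(** * Perturbing the data by constants *)

Section constant_data.
Context {R : realType}.
Implicit Types (D : data_space R) (k : R * R).

(* The data shifted by the exact solution with constant t^(1 - 2 p_1) F_(t1) = k.1 and F_23 = k.2. *)
Definition constant_field k : 'M[R]_4 :=
  k.1 *: (delta_mx q0 q1 - delta_mx q1 q0) + k.2 *: (delta_mx q2 q3 - delta_mx q3 q2).

Lemma constant_field_antisym k : (constant_field k)^T = - constant_field k.
Proof.
by apply/matrixP => i j; rewrite !mxE ![(j == _) && _]andbC; ring.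
Qed.

(** The constraints involve derivatives only, which constants do not change. *)
Lemma shift_data_subproof D k : maxwell_data (fun x => val D x + constant_field k).
Proof.
have [anti per sm divE divB] := set_valP D.
have cE a b : component (fun x => val D x + constant_field k) a b =
    fun x => component (val D) a b x + constant_field k a b.
  by apply/funext => x; rewrite /component mxE.
split.
- by move=> x; rewrite linearD/= (anti x) constant_field_antisym; exact: esym (opprD _ _).
- by move=> x i; congr (_ + _); exact: per.
- by move=> a b; rewrite cE; apply: smooth_on_addC; exact: sm.
- by move=> x; under eq_bigr do rewrite cE partial_addC; exact: divE.
- by move=> x; rewrite !cE !partial_addC; exact: divB.
Qed.

Definition shift_data D k : data_space R :=
  SigSub (mem_set (shift_data_subproof D k)) : set_type maxwell_data.

Lemma data_partial_shift D k a b l x : data_partial (shift_data D k) a b l x =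
  data_partial D a b l x + (if nilp l then constant_field k a b else 0).
Proof.
rewrite /data_partial; transitivity (iter_partial l (fun x => component (val D) a b x + constant_field k a b) x).
  by congr (iter_partial _ _ _); apply/funext => y; rewrite /component /= mxE.
by rewrite iter_partial_addC.
Qed.

Lemma constant_field_le k a b : `|constant_field k a b| <= 2 * `|k.1| + 2 * `|k.2|.
Proof.
have D2 i j i' j' : `|(delta_mx i j - delta_mx i' j' : 'M[R]_4) a b| <= 2.
  rewrite !mxE; apply: le_trans (ler_normB _ _) _.
  by rewrite !ger0_norm ?ler0n// -natrD ler_nat; do 2 case: (_ && _).
rewrite /constant_field mxE [X in X + _]mxE [X in _ + X]mxE.
apply: le_trans (ler_normD _ _) _; rewrite !normrM.
by apply: lerD; rewrite mulrC ler_wpM2r.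
Qed.

Lemma near_shift_data D (O : set (data_space R)) : open O -> O D ->
  exists2 d : R, 0 < d & forall k, `|k.1| < d -> `|k.2| < d -> O (shift_data D k).
Proof.
move=> oO OD.
have C : shift_data D @ (nbhs ((0 : R), (0 : R))) --> D.
  apply: cvg_data => a b l e e0.
  (* e / 4 matches the bound 2 |k.1| + 2 |k.2| of [constant_field_le]. *)
  have N : \forall k \near ((0 : R), (0 : R)), ball ((0 : R), (0 : R)) (e / 4) k.
    by apply: nbhsx_ballx; rewrite divr_gt0.
  apply: filterS N => k [/= k1 k2] x.
  rewrite data_partial_shift [_ + (if _ then _ else _)]addrC addrK.
  rewrite /ball /= sub0r normrN in k1; rewrite /ball /= sub0r normrN in k2.
  case: nilp; last by rewrite normr0 ltW.
  apply: le_trans (constant_field_le _ _ _) _; lra.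
have /C/nbhs_ballP[d /= d0 dO] : nbhs D O by exact: open_nbhs_nbhs.
exists d => // k k1 k2; apply: (dO k).
by split; rewrite /ball /= sub0r normrN.
Qed.

End constant_data.

Section initial_data.
Context {R : realType}.
Implicit Types (D : data_space R) (F : 'rV[R]_4 -> 'M[R]_4).

Lemma event_line (t h : R) (i : 'I_3) (x : 'rV[R]_3) :
  event t (h *: delta_mx 0 i + x) = h *: delta_mx 0 (spatial i) + event t x.
Proof.
have vE (y : 'rV[R]_3) : y = vec3 (y 0 o0) (y 0 o1) (y 0 o2).
  by apply/rowP; apply: ord3_ind; rewrite mxE.
have := to_event_shift i h (t, x 0 o0, x 0 o1, x 0 o2).
rewrite {2}/to_event /= -vE => <-; rewrite /to_event [in LHS](vE (h *: _ + x)) /shift_point /=.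
congr (event _ (vec3 _ _ _)).
- by rewrite !mxE -!val_eqE /= addrC; move: i; apply: ord3_ind; rewrite /= ?mulr1 ?mulr0 ?mulr1n ?mulr0n.
- by rewrite !mxE -!val_eqE /= addrC; move: i; apply: ord3_ind; rewrite /= ?mulr1 ?mulr0 ?mulr1n ?mulr0n.
- by rewrite !mxE -!val_eqE /= addrC; move: i; apply: ord3_ind; rewrite /= ?mulr1 ?mulr0 ?mulr1n ?mulr0n.
Qed.

(** Spatial lines through a point of the slice t = 1 stay in it, so spatial derivatives commute with
    the restriction. *)
Lemma iter_partial_data_at1 F l a b x :
  iter_partial l (component (data_at1 F) a b) x = iter_partial (map spatial l) (component F a b) (event 1 x).
Proof.
elim: l x => [//|i l IH] x.
refine (etrans (esym (line_deriveE _ _ _)) (etrans _ (line_deriveE _ _ _))).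
rewrite (_ : (fun s : R => iter_partial l _ _) =
  fun s : R => iter_partial (map spatial l) (component F a b) (s *: delta_mx 0 (spatial i) + event 1 x)) //.
by apply/funext => s; rewrite -event_line; exact: IH.
Qed.

Definition base_partial D (s : bool) (i : 'I_3) (l : seq 'I_3) : 'rV[R]_3 -> R :=
  if s then data_partial D q0 (spatial i) l
  else data_partial D (spatial (succ3 i)) (spatial (succ3 (succ3 i))) l.

Lemma flux_at1 p1 p2 p3 F D s i l a b c : val D = data_at1 F ->
  flux p1 p2 p3 F s i l (1, a, b, c) = base_partial D s i l (vec3 a b c).
Proof.
move=> DF; rewrite /flux /= powR1 mul1r /base_component /base_partial /data_partial DF.
by case: s; rewrite iter_partial_data_at1.
Qed.

Lemma base_partial_shift D k s i l x : base_partial (shift_data D k) s i l x =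
  base_partial D s i l x + uniform_shift (fun s => if s then k.1 else k.2) s i l.
Proof.
have H : (if s then constant_field k q0 (spatial i)
    else constant_field k (spatial (succ3 i)) (spatial (succ3 (succ3 i)))) =
    uniform_shift (fun s => if s then k.1 else k.2) s i [::].
  rewrite /uniform_shift /constant_field; case: s; move: i; apply: ord3_ind;
    by rewrite ?spatial_o0 ?spatial_o1 ?spatial_o2 !mxE /= !(subr0, sub0r, subrr, mulr0, mulr1, addr0, add0r).
have -> : uniform_shift (fun s => if s then k.1 else k.2) s i l =
    if nilp l then uniform_shift (fun s => if s then k.1 else k.2) s i [::] else 0.
  by rewrite /uniform_shift andbT; case: (nilp l); rewrite ?andbT ?andbF.
by rewrite -H /base_partial; case: s {H}; rewrite data_partial_shift.
Qed.

Lemma base_partial_close D D' s i l x e :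
  (forall a b, `|data_partial D' a b l x - data_partial D a b l x| <= e) ->
  `|base_partial D' s i l x - base_partial D s i l x| <= e.
Proof. by move=> H; case: s; exact: H. Qed.

End initial_data.

(** * The open and dense set of data *)

Section generic_data.
Context {R : realType}.
Variables p1 p2 p3 : R.
Hypothesis psum : p1 + p2 + p3 = 1.
Hypothesis p1_lt0 : p1 < 0.
Hypothesis p12 : p1 <= p2.
Hypothesis p23 : p2 <= p3.
Hypothesis p3_lt1 : p3 < 1.
Local Notation p := (exponent p1 p2 p3).
Local Notation g := (kasner p1 p2 p3).
Local Notation flux := (flux p1 p2 p3).

(* Data that no solution attains belong to this set vacuously, hence the case distinction in
   [dense_blowing_data]. *)
Definition blowing_data : set (data_space R) := [set D | forall F, maxwell_solution g F ->
  val D = data_at1 F -> forall t0 : R, 0 < t0 ->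
  almost_every_timelike_geodesic g t0 (blows_up_like g F (2 * p2 + 4 * p3))].

(** The constants are generic for the profile of F1. Any solution with data near the shifted ones is
    compared directly with F1 plus these constants, and the lower bound e on value or gradient
    survives the comparison. *)
Lemma near_blowing_data D1 F1 d : maxwell_solution g F1 -> val D1 = data_at1 F1 -> 0 < d ->
  exists k : R * R, [/\ `|k.1| < d, `|k.2| < d & \forall D \near shift_data D1 k, blowing_data D].
Proof.
move=> m1 D1F d0.
have r1 := flux_reduced psum m1.
have [E1 hE1] := @exists_profile R p p12 p23 psum p3_lt1 _ r1.
have per1 s l a b c n0 n1 n2 := @profile_shift R p p3_lt1 _ E1 s l a b c n0 n1 n2 r1 hE1.
have [k [kd [e e0 gen]]] := @generic_shift R E1 (profile_lipschitz hE1) (profile_taylor hE1) per1 d d0.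
exists (k true, k false); split; [exact: kd|exact: kd|].
pose L := sobolev_indices [::] ++ sobolev_indices [:: o0] ++ sobolev_indices [:: o1] ++ sobolev_indices [:: o2].
(* [profile_close] loses a factor 20, which leaves an error of e / 2 < e. *)
have e1 : 0 < e / 40 by rewrite divr_gt0.
have e10 := ltW e1.
apply: filterS (near_data_partials (shift_data D1 (k true, k false)) L e1) => D DL F mF DF t0 t00.
have rF := flux_reduced psum mF.
have [E hE] := @exists_profile R p p12 p23 psum p3_lt1 _ rF.
have kE : (fun s => if s then k true else k false) = k by apply/funext; case.
have close l : {subset sobolev_indices l <= L} -> forall s a b c,
    `|E s l a b c - E1 s l a b c - uniform_shift k s o0 l| <= 20 * (e / 40).
  move=> lL s a b c.
  refine (@profile_close R p p12 p23 p3_lt1 _ _ _ _ k _ l rF r1 hE hE1 e10 _ s a b c) => {s a b c}.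
  move=> m /lL mL s i a b c.
  rewrite (flux_at1 _ _ _ _ _ _ _ _ _ DF) (flux_at1 _ _ _ _ _ _ _ _ _ D1F).
  have := @base_partial_close R (shift_data D1 (k true, k false)) D s i m (vec3 a b c) (e / 40)
    (fun a' b' => DL a' b' m mL (vec3 a b c)).
  by rewrite base_partial_shift /= kE opprD addrA.
have e2 : 20 * (e / 40) < e by rewrite mulrA ltr_pdivrMr// [ltRHS]mulrC ltr_pM2r// ltr_nat.
apply: (@almost_every_geodesic_blows_up R p1 p2 p3 psum p1_lt0 p12 p23 p3_lt1 t0 t00 F E mF hE).
move=> a b c; case: (gen a b c) => [[s es]|[s [j ej]]]; [left; exists s|right; exists s, j].
- have sL : {subset sobolev_indices [::] <= L} by move=> m mm; rewrite mem_cat mm.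
  apply/eqP => Es; have := close [::] sL s a b c.
  rewrite /uniform_shift /= Es sub0r -opprD normrN => H1.
  by have := le_lt_trans (le_trans es H1) e2; rewrite ltxx.
- have jL : {subset sobolev_indices [:: j] <= L}.
    move=> m; rewrite /L !mem_cat; move: j {ej}; apply: ord3_ind => ->; by rewrite ?orbT.
  apply/eqP => Es; have := close [:: j] jL s a b c.
  rewrite /uniform_shift /= subr0 Es sub0r normrN => H1.
  by have := le_lt_trans (le_trans ej H1) e2; rewrite ltxx.
Qed.

Lemma dense_blowing_data : dense blowing_data°.
Proof.
move=> O [D1 OD1] oO.
have [[D [OD [F [mF DF]]]]|none] := pselect (exists D, O D /\ exists F, maxwell_solution g F /\ val D = data_at1 F).
  have [d d0 dO] := near_shift_data oO OD.
  have [k [k1 k2 near_k]] := near_blowing_data mF DF d0.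
  by exists (shift_data D k); split; [exact: dO|exact: near_k].
exists D1; split => //.
have OD : nbhs D1 O by exact: open_nbhs_nbhs.
apply: filterS OD => D OD F mF DF; exfalso; apply: none.
by exists D; split => //; exists F.
Qed.

End generic_data.

(** If all exponents were nonnegative, the sum of their squares would be at most p_3 times their
    sum, that is p_3 < 1. *)
Lemma kasner_exponent_lt0 (R : realType) (p1 p2 p3 : R) :
  p1 + p2 + p3 = 1 -> p1 ^+ 2 + p2 ^+ 2 + p3 ^+ 2 = 1 -> p1 <= p2 -> p2 <= p3 -> p3 < 1 -> p1 < 0.
Proof.
move=> s1 s2 h12 h23 h3; rewrite ltNge; apply/negP => p10.
have p20 : 0 <= p2 by lra.
have a : p1 ^+ 2 <= p1 * p3 by rewrite expr2 ler_wpM2l//; lra.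
have b : p2 ^+ 2 <= p2 * p3 by rewrite expr2 ler_wpM2l//.
have c : p3 ^+ 2 = p3 * p3 by rewrite expr2.
have : p1 * p3 + p2 * p3 + p3 * p3 = p3 by rewrite -!mulrDl s1 mul1r.
lra.
Qed.

Theorem theorem1p12 (R : realType) (p1 p2 p3 : R)
    (hsum : p1 + p2 + p3 = 1) (hsqr : p1 ^+ 2 + p2 ^+ 2 + p3 ^+ 2 = 1)
    (hp12 : p1 <= p2) (hp23 : p2 <= p3) (hp3 : p3 < 1) :
  exists A : set (data_space R),
    open A /\ dense A /\
    forall F : 'rV[R]_4 -> 'M[R]_4,
      maxwell_solution (kasner p1 p2 p3) F ->
      (exists2 D : data_space R, A D & val D = data_at1 F) ->
      forall t0 : R, 0 < t0 ->
        almost_every_timelike_geodesic (kasner p1 p2 p3) t0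
          (blows_up_like (kasner p1 p2 p3) F (2 * p2 + 4 * p3)).
Proof.
have p1_lt0 := kasner_exponent_lt0 hsum hsqr hp12 hp23 hp3.
exists (blowing_data p1 p2 p3)°; split; first exact: open_interior.
split; first exact: dense_blowing_data.
by move=> F mF [D AD DF]; exact: (interior_subset AD F mF DF).
Qed.
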